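(* Let $M\ge1$ be an integer. The set $\mathcal{U}(x)$ has zero Lebesgue measure for any $x>0$. Furthermore: (i) if $x\in(0,1]$, then $\dim_H\mathcal{U}(x)=1$; (ii) if $x\in(1,x_{KL})$, then $0<\dim_H\mathcal{U}(x)<1$; (iii) if $x\in[x_{KL},x_G)$, then $|\mathcal{U}(x)|=\aleph_0$; (iv) if $x\ge x_G$, then $\mathcal{U}(x)=\{q_x\}$.
   Context: For $q\in(1,M+1]$ and $x\ge0$, a $q$-expansion of $x$ is a sequence $(d_i)_{i\ge1}\in\{0,1,\ldots,M\}^{\mathbb{N}}$ with $x=\sum_{i\ge1}d_iq^{-i}$. $\mathcal{U}(x)$ is the set of $q\in(1,M+1]$ such that $x$ has exactly one $q$-expansion. For $x>0$, $q_x:=\min\{1+M,1+M/x\}$. The Komornik–Loreti constant $q_{KL}=q_{KL}(M)$ is the smallest element of $\mathcal{U}(1)$. The generalized golden ratio is $q_G=q_G(M):=k+1$ if $M=2k$, and $q_G:=\frac{k+1+\sqrt{k^2+6k+5}}{2}$ if $M=2k+1$. (One has $1<q_G<q_{KL}<M+1$.) Set $x_G:=\frac{M}{q_G-1}$ and $x_{KL}:=\frac{M}{q_{KL}-1}$, so $1<x_{KL}<x_G$. $|A|$ denotes cardinality and $\dim_H$ Hausdorff dimension in $\mathbb{R}$ with the Euclidean metric. *)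

(* Defs.v *)
From HB Require Import structures.
From mathcomp Require Import all_boot all_order all_algebra.
From mathcomp Require Import all_classical all_reals all_analysis.

Set Implicit Arguments.
Unset Strict Implicit.
Unset Printing Implicit Defensive.
Import Order.TTheory GRing.Theory Num.Theory.
Import numFieldNormedType.Exports.
Local Open Scope classical_set_scope.
Local Open Scope ring_scope.

Section Expansions.
Context {R : realType}.
Implicit Types (M : nat) (q x : R).

(* Digits are indexed from 0: [d i] is the coefficient of [q ^ -(i + 1)]. *)
Definition is_expansion M q x (d : nat -> 'I_M.+1) : Prop :=
  series (fun i => (d i)%:R * q ^- i.+1) @ \oo --> x.

Definition univoque_bases M x : set R :=
  [set q | 1 < q <= M.+1%:R /\
           exists! d : nat -> 'I_M.+1, is_expansion q x d].

Definition q_base M x : R := Num.min (1 + M%:R) (1 + M%:R / x).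

(* [get] picks an element of the set; this one has at most one, the smallest
   element of [univoque_bases M 1]. *)
Definition q_KL M : R :=
  get (univoque_bases M 1 `&` lbound (univoque_bases M 1)).

Definition q_G M : R :=
  let k : R := M./2%:R in
  if odd M then (k + 1 + Num.sqrt (k ^+ 2 + 6 * k + 5)) / 2 else k + 1.

Definition x_KL M : R := M%:R / (q_KL M - 1).
Definition x_G M : R := M%:R / (q_G M - 1).

End Expansions.

Section HausdorffDimension.
Context {R : realType}.
Local Open Scope ereal_scope.
Implicit Types (A : set R) (s delta : R).

Definition diameter A : \bar R :=
  ereal_sup [set `|p.1 - p.2|%:E | p in A `*` A].

(* The diameter to the power [s]; the empty set contributes 0 even when
   [s = 0], while a singleton then contributes [0 `^ 0 = 1]. *)
Definition diameter_pow s A : \bar R :=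
  if A == set0 then 0 else diameter A `^ s.

Definition hausdorff_premeasure s delta A : \bar R :=
  ereal_inf [set \sum_(0 <= i <oo) diameter_pow s (F i) |
    F in [set F : nat -> set R | A `<=` \bigcup_i F i /\
                                 forall i, diameter (F i) <= delta%:E]].

Definition hausdorff_measure s A : \bar R :=
  ereal_sup [set hausdorff_premeasure s delta A |
    delta in [set delta | (0 < delta)%R]].

Definition hausdorff_dim A : \bar R :=
  ereal_inf [set s%:E | s in [set s | (0 <= s)%R /\ hausdorff_measure s A = 0]].

End HausdorffDimension.

(* Main.v *)
(** A sequence [d] is the only [q]-expansion of its value iff the tails of [d] after a
    digit [< M] and of its reflection [M - d] after a digit [> 0] all have value [< 1] in
    base [q] ([univ]); since values decrease in [q], univoque sequences stay univoque when
    [q] grows. Once a univoque sequence is neither constantly [M] nor constantly [0] on an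
    initial stretch, all its further tails and their reflections have value [< 1]
    ([strong]).

    Upper bounds: below [M + 1], where for [x > 1] all bases lie, the intervals of values
    with a given first digit overlap. A strong sequence never falls in these overlaps, so
    all its tails have values outside the holes of an expanding map; hence prefixes of
    length [m] number fewer than [q ^ m] for some [m], so [O(r ^ m)] for some [r < q], and
    a prefix of length [m] of the expansion of [x] determines the base up to [O(q ^ -m)].

    Lower bounds: free concatenations of two or more words give many univoque sequences;
    reading the choices as an expansion maps the corresponding bases onto [[0, 1]] by a
    Hoelder function. For [x > 1] the words come from the Thue-Morse sequence, available
    as soon as [q > q_KL]; for [x <= 1] they are the blocks [0 M u] with [u] arbitrary, in
    bases close to [M + 1].

    Below [q_KL] strong sequences are eventually periodic, whence countability, and below
    [q_G] there are none, so that only the constant expansion [M M M ...] remains. *)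
Require Import Defs.
From mathcomp Require Import all_boot all_order all_algebra.
From mathcomp Require Import all_classical all_reals all_analysis.
From mathcomp Require Import ring lra zify.
Import Order.TTheory GRing.Theory Num.Theory.
Import numFieldNormedType.Exports.
Local Open Scope classical_set_scope.
Local Open Scope ring_scope.

Set Implicit Arguments.
Unset Strict Implicit.
Unset Printing Implicit Defensive.

(** * Values of digit sequences *)

(** The bound 1 on tails is the price of a carry: a tail worth at least 1 after a digit below [M]
    can give 1 to that digit, and [q <= M + 1] ensures that what remains can be expanded again.
    Since [x] is fixed and the base varies, different elements of the set have expansions in
    different bases. Values are monotone and Lipschitz in the base, so the intermediate value
    theorem turns a digit sequence into a base. Prefixes are counted in one fixed base with some
    slack, which covers all nearby bases; compactness then glues finitely many neighbourhoods, as an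
    exponent below 1 survives finite unions only. In the lower bounds [x] enters only through a
    finite prefix, a run of digits [M] for [x > 1] and a stretch of the quasi-greedy expansion in
    base [M + 1] for [x <= 1]; a freely chosen strong sequence follows. The holes close as the base
    tends to [M + 1], which makes room for dimension 1 when such bases are allowed. *)

Lemma expr_inv_small (R : realType) (q C e : R) : 1 < q -> 0 < e ->
  exists N, forall n, (N <= n)%N -> C * q ^- n < e.
Proof.
move=> q1 e0.
have q0 : 0 < q by lra.
have nq : `|q^-1| < 1.
  by rewrite ger0_norm ?invr_ge0 ?ltW// invf_lt1//.
have /cvgrPdist_lt /(_ e e0) [N _ hN] := cvg_geometric C nq.
exists N => n Nn; have := hN n Nn.
rewrite /= /geometric /= sub0r normrN exprVn => h.
exact: le_lt_trans (ler_norm _) h.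
Qed.

Definition shift T n (d : nat -> T) : nat -> T := fun i => d (n + i)%N.

Lemma shift0 T (d : nat -> T) : shift 0 d = d.
Proof. by []. Qed.

Lemma shift_shift T m n (d : nat -> T) : shift m (shift n d) = shift (n + m) d.
Proof. by apply/funext => i; rewrite /shift addnA. Qed.

Definition refl M (d : nat -> 'I_M.+1) : nat -> 'I_M.+1 := fun i => rev_ord (d i).

Lemma reflK M (d : nat -> 'I_M.+1) : refl (refl d) = d.
Proof. by apply/funext => i; rewrite /refl rev_ordK. Qed.

Lemma refl_shift M n (d : nat -> 'I_M.+1) : refl (shift n d) = shift n (refl d).
Proof. by []. Qed.

Lemma reflE M (d : nat -> 'I_M.+1) i : (refl d i : nat) = (M - d i)%N.
Proof. by rewrite /refl /= subSS. Qed.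

Lemma digit_leM M (a : 'I_M.+1) : (a <= M)%N.
Proof. by rewrite -ltnS. Qed.

Definition cat_seq T (w : seq T) (d : nat -> T) : nat -> T :=
  fun i => nth (d (i - size w)%N) w i.

Lemma cat_seq_lt T (x0 : T) w d i : (i < size w)%N -> cat_seq w d i = nth x0 w i.
Proof. by move=> iw; rewrite /cat_seq; apply: set_nth_default. Qed.

Lemma cat_seq_ge T (w : seq T) d i : cat_seq w d (size w + i) = d i.
Proof. by rewrite /cat_seq nth_default ?leq_addr// addKn. Qed.

Lemma cat_nseq_ge T n (a : T) d i : cat_seq (nseq n a) d (n + i) = d i.
Proof. by have := cat_seq_ge (nseq n a) d i; rewrite size_nseq. Qed.

Lemma shift_cat_seq T (w : seq T) d : shift (size w) (cat_seq w d) = d.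
Proof. by apply/funext => i; rewrite /shift cat_seq_ge. Qed.

Lemma shift_cat_seq_lt T (w : seq T) d n : (n <= size w)%N ->
  shift n (cat_seq w d) = cat_seq (drop n w) d.
Proof.
move=> nw; apply/funext => i; rewrite /shift /cat_seq size_drop nth_drop.
by congr (nth (d _) _ _); lia.
Qed.

Lemma cat_seq0 T (d : nat -> T) : cat_seq [::] d = d.
Proof. by apply/funext => i; rewrite /cat_seq nth_nil subn0. Qed.

Section Value.
Context {R : realType} {M : nat}.
Implicit Types (q p x y : R) (d s t : nat -> 'I_M.+1).

Definition psum q d n : R := \sum_(i < n) (d i)%:R * q ^- i.+1.

Definition val q d : R := limn (psum q d).

Definition vmax q : R := M%:R / (q - 1).

Lemma psumE q d : series (fun i => (d i)%:R * q ^- i.+1) = psum q d.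
Proof. by apply/funext => n; rewrite /series /= big_mkord. Qed.

Lemma psumS q d n : psum q d n.+1 = psum q d n + (d n)%:R * q ^- n.+1.
Proof. by rewrite /psum big_ord_recr. Qed.

Lemma psumSl q d n : psum q d n.+1 = ((d 0)%:R + psum q (shift 1 d) n) / q.
Proof.
rewrite /psum big_ord_recl /= expr1 mulrDl; congr (_ + _).
rewrite mulr_suml; apply: eq_bigr => i _.
by rewrite /bump /= add1n /shift add1n exprSr invfM mulrA.
Qed.

Lemma psum_eq q d s n : (forall i, (i < n)%N -> d i = s i) -> psum q d n = psum q s n.
Proof. by move=> h; apply: eq_bigr => i _; rewrite h. Qed.

Lemma psum_ge0 q d n : 0 < q -> 0 <= psum q d n.
Proof.
by move=> q0; apply: sumr_ge0 => i _; rewrite mulr_ge0// invr_ge0 exprn_ge0// ltW.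
Qed.

Lemma vmaxE q : 1 < q -> (M%:R + vmax q) / q = vmax q.
Proof. by move=> q1; rewrite /vmax; field; lra. Qed.

Lemma vmax_ge0 q : 1 < q -> 0 <= vmax q.
Proof. by move=> q1; rewrite /vmax divr_ge0// subr_ge0 ltW. Qed.

Lemma digit_le (a : 'I_M.+1) : (a%:R : R) <= M%:R.
Proof. by rewrite ler_nat digit_leM. Qed.

Lemma psum_le q d n : 1 < q -> psum q d n <= vmax q.
Proof.
move=> q1; have q0 : 0 < q by lra.
elim: n d => [|n IH] d; first by rewrite /psum big_ord0 vmax_ge0.
rewrite psumSl -[leRHS]vmaxE// ler_pM2r ?invr_gt0//.
exact: lerD (digit_le _) (IH _).
Qed.

Lemma psum_ndecr q d : 0 < q -> nondecreasing_seq (psum q d).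
Proof.
move=> q0; apply/nondecreasing_seqP => n; rewrite psumS lerDl.
by rewrite mulr_ge0// invr_ge0 exprn_ge0// ltW.
Qed.

Lemma psum_cvg q d : 1 < q -> psum q d @ \oo --> val q d.
Proof.
move=> q1; apply: nondecreasing_is_cvgn; first by apply: psum_ndecr; lra.
by exists (vmax q) => _ [n _ <-]; exact: psum_le.
Qed.

Lemma is_expansionE q x d : 1 < q -> is_expansion q x d <-> val q d = x.
Proof.
move=> q1; rewrite /is_expansion psumE; split=> [h|<-]; last exact: psum_cvg.
by apply: cvg_lim h.
Qed.

Lemma psum_le_val q d n : 1 < q -> psum q d n <= val q d.
Proof.
move=> q1; apply: nondecreasing_cvgn_le; first by apply: psum_ndecr; lra.
by apply/cvg_ex; eexists; apply: psum_cvg.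
Qed.

Lemma val_le_of_psum q d C : 1 < q -> (forall n, psum q d n <= C) -> val q d <= C.
Proof.
move=> q1 h; apply: limr_le; first by apply/cvg_ex; eexists; apply: psum_cvg.
by apply: nearW => n; exact: h.
Qed.

Lemma val_ge0 q d : 1 < q -> 0 <= val q d.
Proof. by move=> q1; apply: le_trans (psum_le_val d 0 q1); rewrite /psum big_ord0. Qed.

Lemma val_le q d : 1 < q -> val q d <= vmax q.
Proof. by move=> q1; apply: val_le_of_psum => // n; exact: psum_le. Qed.

Lemma val_rec q d : 1 < q -> val q d = ((d 0)%:R + val q (shift 1 d)) / q.
Proof.
move=> q1; apply: cvg_lim => //.
rewrite -(cvg_shiftS (psum q d)) /=.
have -> : (fun n => psum q d n.+1) = (fun n => ((d 0)%:R + psum q (shift 1 d) n) / q).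
  by apply/funext => n; rewrite psumSl.
apply: cvgMr_tmp; apply: cvgD; first exact: cvg_cst.
exact: psum_cvg.
Qed.

Lemma val_split q d n : 1 < q -> val q d = psum q d n + q ^- n * val q (shift n d).
Proof.
move=> q1; have q0 : q != 0 by lra.
elim: n => [|n IH]; first by rewrite /psum big_ord0 add0r expr0 invr1 mul1r.
rewrite {1}IH psumS (val_rec (shift n d))// shift_shift addn1 /shift addn0.
by rewrite exprSr invfM; ring.
Qed.

(** The error between [r n] and the value of the [n]-th tail is multiplied by [q] at each step, so a
    bounded solution of the recursion must consist of the tail values. This evaluates reflected,
    constant, alternating and greedy sequences without limits. *)
Lemma val_unique q d (r : nat -> R) C : 1 < q -> (forall n, `|r n| <= C) ->
  (forall n, r n = ((d n)%:R + r n.+1) / q) -> val q d = r 0%N.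
Proof.
move=> q1 rC rE; have q0 : q != 0 by lra.
have h n : val q d - r 0%N = q ^- n * (val q (shift n d) - r n).
  elim: n => [|n ->]; first by rewrite expr0 invr1 mul1r.
  rewrite (val_rec (shift n d))// rE shift_shift addn1 /shift addn0.
  by rewrite exprSr invfM; ring.
apply/eqP; rewrite -subr_eq0 -normr_le0 leNgt; apply/negP => e0.
have [N /(_ N (leqnn N))] := expr_inv_small (vmax q + C) q1 e0.
rewrite (h N) normrM normfV normrX (@gtr0_norm _ q) ?(lt_trans _ q1)//.
rewrite mulrC ltr_pM2l ?invr_gt0 ?exprn_gt0 ?(lt_trans _ q1)//.
apply/negP; rewrite -leNgt; apply: le_trans (ler_normB _ _) _; apply: lerD => //.
by rewrite ger0_norm ?val_ge0 ?val_le.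
Qed.

Lemma val_refl q d : 1 < q -> val q (refl d) = vmax q - val q d.
Proof.
move=> q1; pose r n := vmax q - val q (shift n d).
have := @val_unique q (refl d) r (vmax q) q1; rewrite /r shift0; apply=> n.
  have := val_ge0 (shift n d) q1; have := val_le (shift n d) q1 => h1 h2.
  by rewrite ger0_norm; lra.
rewrite (val_rec (shift n d))// shift_shift addn1 reflE natrB ?digit_leM// /shift addn0.
by rewrite -{1}(vmaxE q1); ring.
Qed.

Lemma val_cst q (a : 'I_M.+1) : 1 < q -> val q (fun=> a) = a%:R / (q - 1).
Proof.
move=> q1; apply: (@val_unique q (fun=> a) (fun=> a%:R / (q - 1)) `|a%:R / (q - 1)| q1) => // n.
by field; lra.
Qed.

Lemma digit_le_val q d n : 1 < q -> (d n)%:R * q ^- n.+1 <= val q d.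
Proof.
move=> q1; apply: le_trans (psum_le_val d n.+1 q1); rewrite psumS lerDr.
by apply: psum_ge0; lra.
Qed.

Lemma val_gt0 q d n : 1 < q -> (0 < d n)%N -> 0 < val q d.
Proof.
move=> q1 dn; apply: lt_le_trans (digit_le_val d n q1).
by rewrite mulr_gt0 ?ltr0n// invr_gt0 exprn_gt0//; lra.
Qed.

Lemma val_gt0_ex q d : 1 < q -> 0 < val q d -> exists n, (0 < d n)%N.
Proof.
move=> q1 v0; apply: contrapT => /forallNP h.
have /(val_le_of_psum q1) : forall n, psum q d n <= 0; last by rewrite leNgt v0.
move=> n; rewrite /psum big1// => i _.
by move: (h i) => /negP; rewrite -leqNgt leqn0 => /eqP ->; rewrite mul0r.
Qed.

(** Exponents start at 1, so every term loses at least the factor [p / q]. The uniform loss gives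
    strict monotonicity and, later, a margin between tail values and 1. *)
Lemma val_mono q p d : 1 < p -> p <= q -> val q d <= p / q * val p d.
Proof.
move=> p1 pq; have q1 : 1 < q by lra.
have p0 : 0 < p by lra.
have q0 : 0 < q by lra.
apply: val_le_of_psum => // n.
apply: le_trans (_ : p / q * psum p d n <= _); last first.
  by rewrite ler_pM2l ?divr_gt0//; exact: psum_le_val.
rewrite /psum mulr_sumr; apply: ler_sum => i _.
rewrite mulrCA; apply: ler_wpM2l => //.
rewrite !exprS !invfM.
have -> : p / q * (p^-1 / p ^+ i) = q^-1 / p ^+ i.
  by field; rewrite expf_neq0 !lt0r_neq0.
rewrite ler_pM2l ?invr_gt0// lef_pV2 ?posrE ?exprn_gt0//.
by apply: lerXn2r => //; rewrite nnegrE ltW.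
Qed.

Lemma val_mono_le q p d : 1 < p -> p <= q -> val q d <= val p d.
Proof.
move=> p1 pq; apply: le_trans (val_mono d p1 pq) _.
have := val_ge0 d p1 => v0.
rewrite ler_piMl// ler_pdivrMr; lra.
Qed.

Lemma val_mono_lt q p d : 1 < p -> p < q -> 0 < val p d -> val q d < val p d.
Proof.
move=> p1 pq v0; apply: le_lt_trans (val_mono d p1 (ltW pq)) _.
rewrite gtr_pMl// ltr_pdivrMr; lra.
Qed.

(** The solution of [lip p * (p - 1) = p * vmax p], the fixed point of the estimate obtained by
    unfolding one digit. *)
Definition lip p : R := p * vmax p / (p - 1).

Lemma lip_ge0 p : 1 < p -> 0 <= lip p.
Proof. by move=> p1; have := vmax_ge0 p1 => v; rewrite /lip !mulr_ge0 ?invr_ge0//; lra. Qed.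

Lemma val_lip p q r d : 1 < p -> p <= q -> q <= r ->
  val q d - val r d <= lip p * (r - q).
Proof.
move=> p1 pq qr; have q1 : 1 < q by lra.
have r1 : 1 < r by lra.
have v0 := vmax_ge0 p1; have l0 := lip_ge0 p1.
have vq s : val q s <= vmax p by apply: le_trans (val_mono_le s p1 pq) (val_le s p1).
(* Each unfolded digit shrinks the error term by the factor [r]; letting [k] grow removes it. *)
have h k s : val q s - val r s <= lip p * (r - q) + vmax p * r ^- k.
  elim: k s => [|k IH] s.
    rewrite expr0 invr1 mulr1; have := vq s; have := val_ge0 s r1.
    have : 0 <= lip p * (r - q) by rewrite mulr_ge0 ?subr_ge0.
    by lra.
  rewrite (val_rec s q1) (val_rec s r1).
  set a := (s 0)%:R; set u := val q _; set w := val r _.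
  have hu : u - w <= lip p * (r - q) + vmax p * r ^- k by exact: IH.
  have -> : (a + u) / q - (a + w) / r = (a + u) * ((r - q) / (q * r)) + (u - w) / r.
    by field; lra.
  have au : a + u <= p * vmax p.
    apply: le_trans (lerD (digit_le _) (vq _)) _.
    by rewrite -{1}(vmaxE p1) /vmax le_eqVlt; apply/orP; left; apply/eqP; field; lra.
  have h1 : (a + u) * ((r - q) / (q * r)) <= p * vmax p * ((r - q) / r).
    apply: ler_pM => //.
    - by rewrite addr_ge0// val_ge0.
    - by rewrite mulr_ge0 ?subr_ge0// invr_ge0 mulr_ge0//; lra.
    - rewrite ler_wpM2l ?subr_ge0// lef_pV2 ?posrE//; [nra|nra|lra].
  have h2 : (u - w) / r <= (lip p * (r - q) + vmax p * r ^- k) / r.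
    by rewrite ler_pM2r ?invr_gt0//; lra.
  apply: le_trans (lerD h1 h2) _.
  have -> : vmax p / r ^+ k.+1 = vmax p / r ^+ k / r by rewrite exprSr invfM mulrA.
  rewrite [in X in _ + X <= _]mulrDl mulrA addrA lerD2r.
  have -> : p * vmax p * (r - q) / r + lip p * (r - q) / r = (p * vmax p + lip p) * (r - q) / r.
    by ring.
  rewrite ler_pdivrMr; last lra.
  rewrite mulrAC; apply: ler_wpM2r; first by rewrite subr_ge0.
  have -> : p * vmax p = lip p * (p - 1) by rewrite /lip; field; lra.
  by rewrite -[X in _ + X]mulr1 -mulrDr ler_wpM2l//; lra.
apply/ler_addgt0Pr => e e0.
have [N /(_ N (leqnn N)) /ltW hN] := expr_inv_small (vmax p) r1 e0.
by apply: le_trans (h N d) _; rewrite lerD2l.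
Qed.

(** The base is the supremum of those in [[p, r]] whose value is still at least [x]; [val_lip]
    supplies the continuity. *)
Lemma val_ivt p r d x : 1 < p -> p <= r -> val r d <= x -> x <= val p d ->
  exists2 q, p <= q <= r & val q d = x.
Proof.
move=> p1 pr rx xp.
have l0 := lip_ge0 p1.
pose K := lip p + 1; have K0 : 0 < K by rewrite /K; lra.
have lipK q q' : p <= q -> q <= q' -> val q d <= val q' d + K * (q' - q).
  move=> pq qq'; have := val_lip d p1 pq qq'.
  rewrite /K mulrDl mul1r; lra.
pose S := [set q | p <= q <= r /\ x <= val q d].
have Sp : S p by split; [rewrite lexx pr|].
have ubS : has_ubound S by exists r => q [/andP[]].
have supS : has_sup S by split; [exists p|].
pose c := sup S.
have pc : p <= c by exact: ub_le_sup.
have cr : c <= r by apply: ge_sup; [exists p | move=> q [/andP[]]].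
exists c; first by rewrite pc cr.
apply/eqP; rewrite eq_le; apply/andP; split.
  rewrite leNgt; apply/negP => h.
  have cltr : c < r.
    by rewrite lt_neqAle cr andbT; apply: contraTneq h => ->; rewrite -leNgt.
  pose e := Num.min (r - c) ((val c d - x) / K).
  have e0 : 0 < e by rewrite lt_min subr_gt0 cltr divr_gt0// subr_gt0.
  have er : e <= r - c by rewrite ge_min lexx.
  have eK : K * e <= val c d - x.
    by rewrite mulrC -ler_pdivlMr// ge_min lexx orbT.
  have : S (c + e).
    split; first by lra.
    have := @lipK c (c + e) pc; rewrite addrAC subrr add0r; lra.
  by move/(ub_le_sup ubS); rewrite -/c; lra.
rewrite leNgt; apply/negP => h.
have e0 : 0 < (x - val c d) / K by rewrite divr_gt0// subr_gt0.
have [q [/andP[pq qr] xq] cq] := sup_adherent e0 supS.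
have qc : q <= c by apply: ub_le_sup => //; split; [rewrite pq qr|].
have := lipK q c pq qc.
have : K * (c - q) < x - val c d.
  rewrite mulrC -ltr_pdivlMr//; rewrite -/c in cq; lra.
lra.
Qed.

(** Greedy digits capped at [M]. Where the cap is inactive the new remainder is below 1, and
    [q <= M + 1] means [1 <= vmax q], so remainders never leave [[0, vmax q]]. *)
Lemma expansion_exists q y : 1 < q -> q <= M.+1%:R -> 0 <= y -> y <= vmax q ->
  exists d, val q d = y.
Proof.
move=> q1 qM y0 yv; have q0 : 0 < q by lra.
pose dig z : 'I_M.+1 := inord (minn M (Num.truncn (q * z))).
pose r n := iter n (fun z => q * z - (dig z)%:R) y.
have vq : q * vmax q = M%:R + vmax q by rewrite -{1}(vmaxE q1); field; lra.
have v1 : 1 <= vmax q by rewrite /vmax ler_pdivlMr ?subr_gt0// mul1r; move: qM; rewrite -natr1; lra.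
have rb n : 0 <= r n <= vmax q.
  elim: n => [|n /andP[IH0 IH1]]; first by rewrite y0 yv.
  rewrite /= -/(r n); set z := r n in IH0 IH1 *.
  have qz : 0 <= q * z by rewrite mulr_ge0// ltW.
  have qzv : q * z <= M%:R + vmax q by rewrite -vq ler_pM2l.
  rewrite /dig inordK ?ltnS ?geq_minl// /minn; case: ltnP => h.
    have hM : M%:R <= q * z by rewrite -truncn_ge_nat// ltnW.
    by rewrite subr_ge0 hM; lra.
  have t1 : (Num.truncn (q * z))%:R <= q * z by rewrite truncn_le.
  have := truncnS_gt (q * z); rewrite -natr1.
  by rewrite subr_ge0 t1; lra.
exists (fun n => dig (r n)).
apply: (@val_unique q _ r (vmax q)) => // n.
  by have /andP[h1 h2] := rb n; rewrite ger0_norm.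
by rewrite /= -/(r n); field; lra.
Qed.

(** Taking the ceiling minus 1 instead of the floor keeps all remainders positive, so nonzero digits
    occur arbitrarily far out. *)
Lemma quasi_greedy_exists x : (0 < M)%N -> 0 < x <= 1 ->
  exists2 d, val M.+1%:R d = x & forall n, 0 < val M.+1%:R (shift n d) <= 1.
Proof.
move=> M0 /andP[x0 x1]; set q : R := M.+1%:R.
have q1 : 1 < q by rewrite ltr1n.
have q0 : 0 < q by lra.
pose dig z : 'I_M.+1 := inord `|Num.ceil (q * z) - 1|%N.
pose r n := iter n (fun z => q * z - (dig z)%:R) x.
have digE z : 0 < z <= 1 -> (dig z)%:R < q * z <= (dig z)%:R + 1.
  move=> /andP[z0 z1]; have qz : 0 < q * z by rewrite mulr_gt0.
  have c1 : (1 <= Num.ceil (q * z))%R by rewrite -gtz0_ge1 ceil_gt_int.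
  have cM : (Num.ceil (q * z) <= M.+1)%R.
    by rewrite ceil_le_int -/q -[leRHS]mulr1 /= ler_pM2l.
  rewrite inordK; last by lia.
  have -> : (`|Num.ceil (q * z) - 1|%N%:R : R) = (Num.ceil (q * z))%:~R - 1.
    by rewrite -[X in _ = _ - X](@mulr1z R) -intrB natr_absz ger0_norm ?subr_ge0.
  have := Num.Theory.ceil_ge (q * z); have := gt_pred_ceil (q * z).
  rewrite intrD intrN; lra.
have rb n : 0 < r n <= 1.
  elim: n => [|n IH]; first by rewrite x0 x1.
  by rewrite /= -/(r n); have := digE _ IH; lra.
have hv n : val q (shift n (fun n => dig (r n))) = r n.
  rewrite -[in RHS](addn0 n).
  apply: (@val_unique q _ (fun k => r (n + k)%N) 1) => // k.
    by have := rb (n + k)%N; move=> /andP[a b]; rewrite ger0_norm// ltW.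
  by rewrite /shift addnS /= -/(r _); field; lra.
by exists (fun n => dig (r n)) => [|n]; [exact: (hv 0%N) | rewrite hv].
Qed.

End Value.

(** * Univoque sequences *)

(** Bounding the position of the first difference allows finite windows to be compared. *)
Definition lexlt_below (f g : nat -> nat) n :=
  exists2 m, (m < n)%N & (forall i, (i < m)%N -> f i = g i) /\ (f m < g m)%N.

Definition lexlt (f g : nat -> nat) := exists n, lexlt_below f g n.

Lemma lexltP f g :
  lexlt f g <-> exists m, (forall i, (i < m)%N -> f i = g i) /\ (f m < g m)%N.
Proof.
split=> [[n [m _ h]]|[m h]]; first by exists m.
by exists m.+1, m.
Qed.

Lemma lexlt_total (f g : nat -> nat) : [\/ lexlt f g, f = g | lexlt g f].
Proof.
have [fg|/existsNP[n /eqP fgn]] := pselect (forall n, f n = g n).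
  by apply: Or32; apply/funext.
have /ex_minnP[m fgm mmin] : exists n, f n != g n by exists n.
have h i : (i < m)%N -> f i = g i.
  by move=> im; apply/eqP; apply: contraTT im => /mmin; rewrite -leqNgt.
case: (ltngtP (f m) (g m)) fgm => // fgm _; [apply: Or31|apply: Or33]; apply/lexltP.
  by exists m.
by exists m; split=> // i im; rewrite h.
Qed.

Lemma lexlt_trans f g h : lexlt f g -> lexlt g h -> lexlt f h.
Proof.
move=> /lexltP[m [mE mlt]] /lexltP[n [nE nlt]]; apply/lexltP.
exists (minn m n); split=> [i|].
  by rewrite leq_min => /andP[im jn]; rewrite mE// nE.
case: (ltngtP m n) => mn.
- by rewrite -nE.
- by rewrite mE.
- by apply: ltn_trans mlt _; rewrite mn.
Qed.

Lemma lexlt_irr f : ~ lexlt f f.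
Proof. by move=> /lexltP[m [_]]; rewrite ltnn. Qed.

Section Univoque.
Context {R : realType} {M : nat}.
Implicit Types (q p x y : R) (d s t : nat -> 'I_M.+1).

Definition dlt d s := lexlt (fun i => d i) (fun i => s i).

Lemma dlt_total d s : [\/ dlt d s, d = s | dlt s d].
Proof.
have [h|h|h] := lexlt_total (fun i => d i) (fun i => s i).
- exact: Or31.
- by apply: Or32; apply/funext => i; apply: val_inj; exact: (congr1 (@^~ i) h).
- exact: Or33.
Qed.

Lemma dlt_refl d s : dlt d s <-> dlt (refl s) (refl d).
Proof.
split=> /lexltP[m [h1 h2]]; apply/lexltP; exists m; rewrite ?reflE in h1 h2 *; split=> [i im|].
- by rewrite !reflE h1.
- by have := digit_leM (s m); lia.
- have := h1 i im; rewrite !reflE.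
  by have := digit_leM (s i); have := digit_leM (d i); lia.
- by have := digit_leM (s m); have := digit_leM (d m); lia.
Qed.

Definition univ q d := forall n,
  ((d n < M)%N -> val q (shift n.+1 d) < 1) /\
  ((0 < d n)%N -> val q (refl (shift n.+1 d)) < 1).

Definition strong q d := forall n,
  val q (shift n d) < 1 /\ val q (refl (shift n d)) < 1.

Lemma univ_shift q n d : univ q d -> univ q (shift n d).
Proof. by move=> h m; have := h (n + m)%N; rewrite shift_shift addnS. Qed.

Lemma univ_refl q d : univ q d -> univ q (refl d).
Proof.
move=> h n; have [h1 h2] := h n; rewrite reflE -!refl_shift reflK; split=> dn.
  by apply: h2; lia.
by apply: h1; lia.
Qed.

Lemma strong_refl q d : strong q d -> strong q (refl d).
Proof. by move=> h m; rewrite -refl_shift reflK; have [] := h m. Qed.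

Lemma strong_univ q d : strong q d -> univ q d.
Proof. by move=> h n; have [] := h n.+1. Qed.

Lemma univ_mono q p d : 1 < p -> p <= q -> univ p d -> univ q d.
Proof.
move=> p1 pq h n; have [h1 h2] := h n; split=> dn.
  by apply: le_lt_trans (h1 dn); exact: val_mono_le.
by apply: le_lt_trans (h2 dn); exact: val_mono_le.
Qed.

Lemma strong_mono q p d : 1 < p -> p <= q -> strong p d -> strong q d.
Proof.
move=> p1 pq h n; have [h1 h2] := h n.
by split; [apply: le_lt_trans h1|apply: le_lt_trans h2]; exact: val_mono_le.
Qed.

Lemma first_diff d s : d <> s ->
  exists m, (forall i, (i < m)%N -> d i = s i) /\ d m != s m.
Proof.
have [/lexltP[m [h1 h2]] _||/lexltP[m [h1 h2]] _] := dlt_total d s => //.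
- exists m; split=> [i im|]; first by apply: val_inj; exact: h1.
  by apply/eqP => e; rewrite e ltnn in h2.
- exists m; split=> [i im|]; first by apply: val_inj; rewrite /= h1.
  by apply/eqP => e; rewrite e ltnn in h2.
Qed.

Lemma val_diff q d s m : 1 < q -> (forall i, (i < m)%N -> d i = s i) ->
  val q d - val q s = q ^- m.+1 *
    ((d m)%:R - (s m)%:R + (val q (shift m.+1 d) - val q (shift m.+1 s))).
Proof.
move=> q1 h; rewrite (val_split d m.+1 q1) (val_split s m.+1 q1) !psumS (psum_eq q h).
by ring.
Qed.

Lemma natrB_ge1 (a b : nat) : (a < b)%N -> 1 <= b%:R - a%:R :> R.
Proof. by move=> ab; rewrite lerBrDl natr1 ler_nat. Qed.

(** At the first difference [s] gains at least 1, while the rest of [t] after that digit, which is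
    below [M], is worth less than 1. *)
Lemma lex_val_lt q t s : 1 < q -> univ q t -> dlt t s -> val q t < val q s.
Proof.
move=> q1 ut /lexltP[m [h1 h2]]; rewrite -subr_gt0.
rewrite (@val_diff q s t m q1); last by move=> i im; apply: val_inj; rewrite /= h1.
rewrite mulr_gt0 ?invr_gt0 ?exprn_gt0//; first lra.
have := natrB_ge1 h2; have := val_ge0 (shift m.+1 s) q1.
have : val q (shift m.+1 t) < 1 by apply: (ut m).1; apply: leq_trans h2 (digit_leM _).
lra.
Qed.

Lemma lex_val_lt' q t s : 1 < q -> univ q s -> dlt t s -> val q t < val q s.
Proof.
move=> q1 us /dlt_refl /(lex_val_lt q1 (univ_refl us)).
by rewrite !val_refl//; lra.
Qed.

Lemma univ_dlt q t s : 1 < q -> univ q t -> val q t < val q s -> dlt t s.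
Proof.
move=> q1 ut ts; have [//|e|h] := dlt_total t s; first by rewrite e ltxx in ts.
by have := lex_val_lt' q1 ut h; rewrite ltNge (ltW ts).
Qed.

(** If a tail after a digit below [M] were worth at least 1, raising the digit and expanding the
    tail value minus 1 would give a second expansion; lowering a digit is symmetric. Conversely, two
    expansions of [x] are lexicographically comparable, against strict monotonicity. *)
Lemma univoqueP q x : 1 < q -> q <= M.+1%:R -> univoque_bases M x q <->
  exists2 d, val q d = x & univ q d.
Proof.
move=> q1 qM; split=> [[_ [d [/is_expansionE dx du]]]|[d dx ud]].
  exists d => [|n]; first exact: dx.
  have key (a : 'I_M.+1) s : a != d n ->
      (d n)%:R + val q (shift n.+1 d) = a%:R + val q s -> False.
    move=> adn e; pose w := mkseq d n ++ [:: a]; pose D := cat_seq w s.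
    have sw : size w = n.+1 by rewrite size_cat size_mkseq addn1.
    have Dd i : (i < n)%N -> D i = d i.
      move=> i_n; rewrite /D (cat_seq_lt ord0) ?sw ?(ltn_trans i_n)//.
      by rewrite nth_cat size_mkseq i_n nth_mkseq.
    have Dn : D n = a.
      rewrite /D (cat_seq_lt ord0) ?sw//.
      by rewrite nth_cat size_mkseq ltnn subnn.
    have De : shift n.+1 D = s by rewrite -sw shift_cat_seq.
    have : val q D = x.
      rewrite -(dx q1); apply/eqP; rewrite -subr_eq0 (@val_diff q D d n)// De Dn.
      by rewrite mulf_eq0; apply/orP; right; apply/eqP; lra.
    move/(is_expansionE _ _ q1)/du => dD.
    by move: adn; rewrite -Dn dD eqxx.
  have v0 := val_ge0 (shift n.+1 d) q1.
  have vm := val_le (shift n.+1 d) q1.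
  split=> [dn|dn]; rewrite ltNge; apply/negP => h.
    have [||s sE] := @expansion_exists R M q (val q (shift n.+1 d) - 1) q1 qM; try lra.
    have ia : (d n).+1%:R = (d n)%:R + 1 :> R by rewrite natr1.
    apply: (key (inord (d n).+1) s); last by rewrite inordK// sE ia; lra.
    by rewrite -val_eqE /= inordK//; lia.
  rewrite val_refl// in h.
  have [||s sE] := @expansion_exists R M q (val q (shift n.+1 d) + 1) q1 qM; try lra.
  have ia : (d n).-1%:R + 1 = (d n)%:R :> R by rewrite natr1 prednK.
  have dM := ltn_ord (d n).
  apply: (key (inord (d n).-1) s); last by rewrite inordK ?sE -?ia; [lra|lia].
  by rewrite -val_eqE /= inordK//; lia.
split; first by rewrite q1 qM.
exists d; split=> [|s /(is_expansionE _ _ q1) sx]; first exact/is_expansionE.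
have [h|//|h] := dlt_total d s.
  by have := lex_val_lt q1 ud h; rewrite dx sx ltxx.
by have := lex_val_lt' q1 ud h; rewrite dx sx ltxx.
Qed.

(** If a tail below 1 starts with [M], then [M] plus the next tail is below [q <= M + 1], so the
    next tail is below 1 as well; for other digits [univ] says so directly. *)
Lemma univ_strong_next q d n : 1 < q -> q <= M.+1%:R -> univ q d ->
  val q (shift n d) < 1 -> val q (refl (shift n d)) < 1 ->
  strong q (shift n d).
Proof.
move=> q1 qM ud; have q0 : 0 < q by lra.
have aux s : univ q s -> val q s < 1 -> val q (shift 1 s) < 1.
  move=> us s1; have [sM|] := ltnP (s 0) M; first exact: (us 0%N).1.
  move=> Ms; have e : (s 0)%:R = M%:R :> R.
    by congr _%:R; apply/eqP; rewrite eqn_leq Ms digit_leM.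
  have : M%:R + val q (shift 1 s) < q.
    by rewrite -e; move: s1; rewrite (val_rec s q1) ltr_pdivrMr// mul1r.
  by move: qM; rewrite -natr1; lra.
move=> h1 h2 m; elim: m => [|m [IH1 IH2]]; first by rewrite shift0.
have e : shift m.+1 (shift n d) = shift 1 (shift m (shift n d)).
  by rewrite [RHS]shift_shift addn1.
have u : univ q (shift m (shift n d)) by do 2!apply: univ_shift.
by rewrite e refl_shift; split; apply: aux => //; exact: univ_refl.
Qed.

(** A digit strictly between 0 and [M] triggers both halves of [univ]. If only 0 and [M] occur, a
    change between them gives one bound at once; the other comes from the next digit and is pulled
    back through a leading 0. *)
Lemma univ_strong_ex q d : 1 < q -> q <= M.+1%:R -> univ q d ->
  [\/ d = (fun=> ord0), d = (fun=> ord_max) | exists n, strong q (shift n d)].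
Proof.
move=> q1 qM ud.
have [[n /andP[d0 dM]]|/forallNP h] := pselect (exists n, 0 < d n < M)%N.
  apply: Or33; exists n.+1; have [h1 h2] := ud n.
  by apply: univ_strong_next => //; [exact: h1|exact: h2].
have hd n : d n = 0 :> nat \/ d n = M :> nat.
  have := h n; have := digit_leM (d n); have := ltn_ord (d n); lia.
have vr s : (s 0%N = 0 :> nat) -> val q (shift 1 s) < 1 -> val q s < 1.
  move=> s0 s1; rewrite val_rec// s0 add0r ltr_pdivrMr; lra.
have [[n dn]|/forallNP hn] := pselect (exists n, d n <> d n.+1).
  apply: Or33; exists n.+1.
  have dn' : (d n : nat) <> d n.+1 by move=> /val_inj.
  have [h1 h2] := ud n; have [h3 h4] := ud n.+1.
  have e : shift n.+2 d = shift 1 (shift n.+1 d) by rewrite shift_shift addn1.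
  have e0 : shift n.+1 d 0%N = d n.+1 by rewrite /shift addn0.
  have M0 : (0 < M)%N by have := digit_leM (d n); have := digit_leM (d n.+1); lia.
  have [a|a] := hd n; have [b|b] := hd n.+1; try lia.
    apply: univ_strong_next => //; first by apply: h1; lia.
    by apply: vr; [rewrite reflE e0; lia|rewrite -refl_shift -e; apply: h4; lia].
  apply: univ_strong_next => //; last by apply: h2; lia.
  by apply: vr; [rewrite e0|rewrite -e; apply: h3; lia].
have dc n : d n = d 0%N.
  by elim: n => // n <-; apply/esym; have := hn n; exact: contrapT.
have [d0|d0] := hd 0%N; [apply: Or31|apply: Or32]; apply/funext => n; apply: val_inj.
  by rewrite /= dc.
by rewrite /= dc.
Qed.

Lemma univ_nontrivial_strong q d : (0 < M)%N -> 1 < q -> q <= M.+1%:R -> univ q d ->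
  0 < val q d < vmax (M := M) q -> exists n, strong q (shift n d).
Proof.
move=> M0 q1 qM ud /andP[v0 vM]; case: (univ_strong_ex q1 qM ud) => // e.
  by move: v0; rewrite e val_cst// mul0r ltxx.
by move: vM; rewrite e val_cst// ltxx.
Qed.

(** Bootstrapping: if all tails are worth at most [1 + C], comparing [t] with [s] at their first
    difference replaces [C] by [q ^- m.+1 * C]. In the limit the bound is 1, and a last comparison
    is strict because [s] has nonzero digits further on. *)
Lemma lex_strong_half q s : 1 < q -> val q s <= 1 ->
  (forall n, exists2 m, (n <= m)%N & (0 < s m)%N) ->
  forall t, (forall n, dlt (shift n t) s) -> val q t < 1.
Proof.
move=> q1 s1 sinf; have q0 : 0 < q by lra.
have step t C : (forall n, dlt (shift n t) s) -> 0 <= C ->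
    (forall n, val q (shift n t) <= 1 + C) -> exists m,
    val q t <= psum q s m.+1 + q ^- m.+1 * C.
  move=> ht C0 hC; have := ht 0%N; rewrite shift0 => /lexltP[m [h1 h2]]; exists m.
  rewrite (val_split t m.+1 q1) !psumS.
  have -> : psum q t m = psum q s m by apply: psum_eq => i im; apply: val_inj; exact: h1.
  rewrite -!addrA lerD2l [(s m)%:R * _]mulrC [(t m)%:R * _]mulrC -!mulrDr.
  rewrite ler_pM2l ?invr_gt0 ?exprn_gt0//.
  have := natrB_ge1 h2; have := hC m.+1; lra.
have le1 t : (forall n, dlt (shift n t) s) -> val q t <= 1.
  move=> ht; have h k : forall t, (forall n, dlt (shift n t) s) ->
      val q t <= 1 + q ^- k * vmax (M := M) q.
    elim: k => [|k IH] {ht}t ht.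
      rewrite expr0 invr1 mul1r; apply: le_trans (val_le t q1) _; lra.
    have C0 : 0 <= q ^- k * vmax (M := M) q.
      by rewrite mulr_ge0 ?vmax_ge0// invr_ge0 exprn_ge0// ltW.
    have [|m hm] := step t _ ht C0.
      by move=> n; apply: IH => j; rewrite shift_shift.
    apply: le_trans hm _; apply: lerD; first exact: le_trans (psum_le_val s m.+1 q1) s1.
    rewrite mulrA; apply: ler_wpM2r; first exact: vmax_ge0.
    rewrite -invfM -exprD lef_pV2 ?posrE ?exprn_gt0// ler_eXn2l//; lia.
  apply/ler_addgt0Pr => e e0.
  have [N /(_ N (leqnn N)) /ltW hN] := expr_inv_small (vmax (M := M) q) q1 e0.
  by apply: le_trans (h N t ht) _; rewrite lerD2l mulrC.
move=> t ht; have [|m hm] := step t 0 ht (lexx 0).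
  by move=> n; rewrite addr0; apply: le1 => j; rewrite shift_shift.
rewrite mulr0 addr0 in hm; apply: le_lt_trans hm (lt_le_trans _ s1).
have [j mj sj] := sinf m.+1.
rewrite (val_split s m.+1 q1) ltrDl mulr_gt0 ?invr_gt0 ?exprn_gt0//.
by apply: (@val_gt0 _ _ q _ (j - m.+1)) => //; rewrite /shift subnKC.
Qed.

Lemma lex_strong q s d : 1 < q -> val q s <= 1 ->
  (forall n, exists2 m, (n <= m)%N & (0 < s m)%N) ->
  (forall n, dlt (shift n d) s) -> (forall n, dlt (shift n (refl d)) s) ->
  strong q d.
Proof.
move=> q1 s1 sinf h1 h2 n; split; apply: (lex_strong_half q1 s1 sinf) => m.
  by rewrite shift_shift.
by rewrite refl_shift shift_shift.
Qed.

Lemma strong_dlt q d s : 1 < q -> 1 <= val q s -> strong q d ->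
  forall n, dlt (shift n d) s /\ dlt (shift n (refl d)) s.
Proof.
move=> q1 s1 sd n; split; apply: univ_dlt q1 _ _.
- by apply: univ_shift; exact: strong_univ.
- by apply: lt_le_trans s1; have [] := sd n.
- by apply: univ_shift; apply: univ_refl; exact: strong_univ.
- by apply: lt_le_trans s1; have [] := sd n.
Qed.

(** A digit [M] imposes only the reflected condition, and the reflected prefix consists of zeros,
    which merely divide a value below 1 by a power of [q]. *)
Lemma univ_nseq_max q n d : 1 < q -> strong q d ->
  univ q (cat_seq (nseq n ord_max) d).
Proof.
move=> q1 sd m; have [nm|mn] := leqP n m; last first.
  rewrite (cat_seq_lt ord0) ?size_nseq// nth_nseq mn ltnn; split=> // _.
  rewrite shift_cat_seq_lt ?size_nseq// drop_nseq.
  elim: (n - m.+1)%N => [|k IH] /=; first by rewrite cat_seq0; exact: (sd 0%N).2.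
  rewrite val_rec// reflE /cat_seq /= subnn add0r.
  rewrite ltr_pdivrMr; last lra.
  by rewrite mul1r; apply: lt_trans q1; exact: IH.
have e j : cat_seq (nseq n ord_max) d (n + j) = d j.
  by rewrite -[X in (X + j)%N](size_nseq n (ord_max : 'I_M.+1)) cat_seq_ge.
have -> : shift m.+1 (cat_seq (nseq n ord_max) d) = shift (m - n).+1 d.
  apply/funext => i; rewrite /shift -(e ((m - n).+1 + i)%N); congr cat_seq; lia.
rewrite -(subnKC nm) e addnC addnK.
exact: (strong_univ sd).
Qed.

End Univoque.

(** * The Thue-Morse sequence *)

Section ThueMorse.
Variable M : nat.
Hypothesis M0 : (0 < M)%N.
Local Open Scope nat_scope.
Implicit Types (f g s : nat -> nat).

Let k := M./2.

Let kM : k.+1 <= M /\ M <= k.*2.+1 /\ k.*2 <= M.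
Proof. by rewrite /k; have := odd_double_half M; lia. Qed.

Definition bar f := fun i => M - f i.

Definition lexle_below f g n := lexlt_below f g n \/ forall i, i < n -> f i = g i.

(** The word doubles by appending its reflection with the last digit raised by 1. For [M = 1] this
    is the Thue-Morse sequence without its initial 0. *)
Fixpoint tm_word n i : nat :=
  if n is n'.+1 then
    if i < 2 ^ n' then tm_word n' i
    else if i.+1 == 2 ^ n then (M - tm_word n' (2 ^ n').-1).+1
    else M - tm_word n' (i - 2 ^ n')
  else k.+1.

Definition tm i := tm_word i i.

Lemma tm_wordE n i : i < 2 ^ n -> tm_word n i = tm i.
Proof.
have st m l : i < 2 ^ m -> tm_word (m + l) i = tm_word m i.
  move=> im; elim: l => [|l IH]; first by rewrite addn0.
  rewrite addnS /= ifT//; apply: leq_trans im _; rewrite leq_exp2l//; lia.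
move=> i_n; rewrite /tm; have [h|h] := leqP n i.
  by have := st n (i - n) i_n; rewrite subnKC.
by have := st i (n - i) (ltn_expl i (isT : 1 < 2)); rewrite subnKC// ltnW.
Qed.

Lemma tm0 : tm 0 = k.+1.
Proof. by []. Qed.

Lemma exp2_gt0 n : 0 < 2 ^ n.
Proof. by rewrite expn_gt0. Qed.

Lemma tmD n i : i.+1 < 2 ^ n -> tm (2 ^ n + i) = M - tm i.
Proof.
move=> i_n; rewrite -(@tm_wordE n.+1) ?expnS; last by have := exp2_gt0 n; lia.
rewrite /= ifF; last by lia.
by rewrite ifF ?addKn ?tm_wordE// ?expnS; lia.
Qed.

Lemma tm_last n : tm (2 ^ n.+1).-1 = (M - tm (2 ^ n).-1).+1.
Proof.
have e := exp2_gt0 n; rewrite -(@tm_wordE n.+1) ?expnS; last by lia.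
by rewrite /= ifF ?ifT ?tm_wordE ?expnS; try lia.
Qed.

(** The last digit is always [k.+1] or [M - k]. So it can be lowered, and its reflection can be
    raised without exceeding [M]. *)
Lemma tm_last_bound n : 0 < tm (2 ^ n).-1 <= M.
Proof.
have := kM => -[h1 [h2 h3]].
have [e|e] : tm (2 ^ n).-1 = k.+1 \/ tm (2 ^ n).-1 = M - k.
  elim: n => [|n IH]; first by left.
  by rewrite tm_last; case: IH => ->; lia.
all: by rewrite e; lia.
Qed.

Lemma tm_le i : tm i <= M.
Proof.
have := kM => -[h1 [h2 h3]].
suff h n : i < 2 ^ n -> tm i <= M by apply: (h i); exact: ltn_expl.
elim: n i => [|n IH] i; first by rewrite ltnS leqn0 => /eqP ->.
rewrite expnS => i_n; have [h|h] := ltnP i (2 ^ n); first exact: IH.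
have [e|e] := eqVneq i (2 ^ n.+1).-1; first by rewrite e; have /andP[] := tm_last_bound n.+1.
rewrite -(subnKC h) tmD; first by lia.
by move/eqP: e; rewrite expnS; lia.
Qed.

Lemma tm_ge n j : j < 2 ^ n -> M - tm j <= tm (2 ^ n + j) <= (M - tm j).+1.
Proof.
move=> jn; have [h|h] := ltnP j.+1 (2 ^ n); first by rewrite tmD//; lia.
have -> : 2 ^ n + j = (2 ^ n.+1).-1 by rewrite expnS; lia.
have -> : j = (2 ^ n).-1 by lia.
by rewrite tm_last; lia.
Qed.

Lemma lexlt_below_mono f g m n : m <= n -> lexlt_below f g m -> lexlt_below f g n.
Proof. by move=> mn [j jm h]; exists j => //; apply: leq_trans mn. Qed.

(** Tails are compared only while they stay within the first [2 ^ n] letters. There the lower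
    comparison is already strict, whereas the upper one may be a tie until the next block is
    seen. *)
Definition tm_order n :=
  (forall i, i < 2 ^ n -> lexlt_below (bar tm) (shift i tm) (2 ^ n - i)) /\
  (forall i, i < 2 ^ n -> lexle_below (shift i tm) tm (2 ^ n - i)).

(** A tie is broken by the next block: it starts like the reflection of [tm], which lies strictly
    below the tail of [tm] at [2 ^ n - i]. *)
Lemma tm_order_overlap n i : tm_order n -> 0 < i < 2 ^ n ->
  lexlt_below (shift i tm) tm (2 ^ n.+1 - i).
Proof.
move=> [Pa Pb] /andP[i0 i_n]; rewrite expnS; set L := 2 ^ n in Pa Pb i_n *.
have [h|h] := Pb i i_n; first by apply: lexlt_below_mono h; lia.
have Li : L - i < L by lia.
have [m mi [h1 h2]] := Pa _ Li.
have e j : j <= m -> shift i tm (L - i + j) = bar tm j.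
  move=> jm; rewrite /shift /bar; have -> : i + (L - i + j) = L + j by lia.
  by rewrite tmD//; lia.
exists (L - i + m); first lia.
split=> [j jm|]; last by rewrite e.
have [/h//|jL] := ltnP j (L - i).
rewrite -(subnKC jL) e; last lia.
by rewrite h1//; lia.
Qed.

Lemma tm_orderP n : tm_order n.
Proof.
have := kM => -[hk1 [hk2 hk3]].
elim: n => [|n IH].
  split=> i; rewrite expn0 ltnS leqn0 => /eqP ->; rewrite subn0.
    by exists 0; rewrite /bar /shift ?tm0; [|split=> //; lia].
  by right=> j; rewrite ltnS leqn0 => /eqP ->.
have [Pa Pb] := IH; split=> i; have := exp2_gt0 n; rewrite expnS => L0 i_n.
  have [iL|Li] := ltnP i (2 ^ n).
    by apply: lexlt_below_mono (Pa i iL); lia.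
  rewrite -(subnKC Li); set j := i - 2 ^ n.
  have jL : j < 2 ^ n by rewrite /j; lia.
  (* In the second half the sequence is reflected, so the upper comparison at [j] becomes a lower
     one; the raised last digit breaks a tie. *)
  have [[m mj [h1 h2]]|h] := Pb j jL; rewrite /shift.
    rewrite /shift in h1 h2; exists m; first lia.
    rewrite /bar; split=> [l lm|].
      by rewrite -addnA tmD ?h1//; lia.
    by have /tm_ge : j + m < 2 ^ n; [lia|rewrite addnA; have := tm_le m; lia].
  rewrite /shift in h; exists (2 ^ n - j).-1; first lia.
  rewrite /bar; split=> [l lm|].
    by rewrite -addnA tmD ?h//; lia.
  have -> : 2 ^ n + j + (2 ^ n - j).-1 = (2 ^ n.+1).-1 by rewrite expnS; lia.
  rewrite tm_last -h; last lia.
  by have -> : j + (2 ^ n - j).-1 = (2 ^ n).-1 by lia.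
have [iL|Li] := ltnP i (2 ^ n).
  have [->|i0] := posnP i; first by right.
  by left; rewrite -expnS; apply: tm_order_overlap => //; rewrite i0.
rewrite -(subnKC Li); set j := i - 2 ^ n.
have jL : j < 2 ^ n by rewrite /j; lia.
(* Reflection turns the strict lower comparison into an upper one, which the raised last digit may
   weaken to a tie. *)
have [m mj [h1 h2]] := Pa j jL; rewrite /shift /bar in h1 h2 *.
have e l : l < m -> tm (2 ^ n + j + l) = tm l.
  by move=> lm; rewrite -addnA tmD; [rewrite -h1//; have := tm_le l|]; lia.
have /tm_ge : j + m < 2 ^ n by lia.
rewrite addnA => /andP[_ ub].
have tj := tm_le (j + m); have tm_m := tm_le m.
have [hl|hl] := ltnP (tm (2 ^ n + j + m)) (tm m).
  by left; exists m; [lia|split].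
have [hm|hm] := ltnP (j + m).+1 (2 ^ n).
  by move: hl; rewrite -addnA tmD//; lia.
by right=> l lL; have [/e//|ml] := ltnP l m; have -> : l = m by [lia]; rewrite /shift; lia.
Qed.

Lemma tm_tail_gt i : lexlt (bar tm) (shift i tm).
Proof. by exists (2 ^ i - i); apply: (tm_orderP i).1; exact: ltn_expl. Qed.

Lemma tm_tail_lt i : 0 < i -> lexlt (shift i tm) tm.
Proof.
move=> i0; exists (2 ^ i.+1 - i); apply: tm_order_overlap; first exact: tm_orderP.
by rewrite i0 ltn_expl.
Qed.

Lemma bar_tm_tail_lt i : lexlt (bar (shift i tm)) tm.
Proof.
have /lexltP[m [h1 h2]] := tm_tail_gt i; apply/lexltP; exists m; rewrite /bar in h1 h2 *.
split=> [j jm|]; last by have := tm_le m; have := tm_le (i + m); rewrite /shift in h2 *; lia.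
by rewrite -h1//; have := tm_le j; lia.
Qed.

(** * Sequences whose windows stay below a Thue-Morse prefix *)

Definition bounded_by s := forall i, s i <= M.

Lemma barK s : bounded_by s -> bar (bar s) = s.
Proof. by move=> h; apply/funext => i; rewrite /bar; have := h i; lia. Qed.

Lemma bar_bounded s : bounded_by (bar s).
Proof. by move=> i; exact: leq_subr. Qed.

Lemma shift_bounded i s : bounded_by s -> bounded_by (shift i s).
Proof. by move=> h j; exact: h. Qed.

(** The prefix of length [2 ^ n] and its reflection, repeated in turn. These sequences replace [tm]
    as bounds in bases where [tm] is worth more than 1. *)
Definition tm_per n i :=
  let r := i %% 2 ^ n.+1 in if r < 2 ^ n then tm r else M - tm (r - 2 ^ n).

Lemma tm_per_lt n i : i < 2 ^ n -> tm_per n i = tm i.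
Proof. by move=> h; rewrite /tm_per modn_small ?h// expnS; lia. Qed.

Lemma tm_perD n i : tm_per n (2 ^ n + i) = M - tm_per n i.
Proof.
have e := exp2_gt0 n; rewrite /tm_per -modnDmr expnS; set r := i %% (2 * 2 ^ n).
have rl : r < 2 * 2 ^ n by rewrite ltn_mod; lia.
have [h|h] := ltnP r (2 ^ n).
  by rewrite modn_small ?ifF ?addKn//; lia.
have -> : (2 ^ n + r) %% (2 * 2 ^ n) = r - 2 ^ n.
  have -> : 2 ^ n + r = 2 * 2 ^ n + (r - 2 ^ n) by lia.
  by rewrite modnDl modn_small//; lia.
by rewrite ifT; [have := tm_le (r - 2 ^ n)|]; lia.
Qed.

Lemma tm_per_bounded n : bounded_by (tm_per n).
Proof. by move=> i; rewrite /tm_per; case: ifP => _; [exact: tm_le|exact: leq_subr]. Qed.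

Definition windows_lt n s := forall i,
  lexlt_below (shift i s) tm (2 ^ n) /\ lexlt_below (shift i (bar s)) tm (2 ^ n).

Lemma lexlt_asym f g : lexlt f g -> lexlt g f -> False.
Proof. by move=> fg gf; apply: (@lexlt_irr f); exact: lexlt_trans gf. Qed.

(** Since [tm_per n] becomes its own reflection after [2 ^ n] letters, a tail that differs only
    later would have a reflected tail, starting there, above [tm_per n]. *)
Lemma windows_ltP n s : bounded_by s ->
  (forall i, lexlt (shift i s) (tm_per n)) ->
  (forall i, lexlt (shift i (bar s)) (tm_per n)) -> windows_lt n s.
Proof.
suff half u : bounded_by u -> (forall i, lexlt (shift i u) (tm_per n)) ->
    (forall i, lexlt (shift i (bar u)) (tm_per n)) ->
    forall i, lexlt_below (shift i u) tm (2 ^ n).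
  move=> sM h1 h2 i; split; apply: half => //; first exact: bar_bounded.
  by rewrite barK.
move=> uM h1 h2 i; have /lexltP[m [e1 e2]] := h1 i.
have [mL|Lm] := ltnP m (2 ^ n).
  exists m => //; split=> [j jm|]; last by rewrite -(tm_per_lt mL).
  by rewrite e1// tm_per_lt//; lia.
case: (lexlt_asym (h2 (i + 2 ^ n))).
apply/lexltP; exists (m - 2 ^ n); rewrite /shift /bar in e1 e2 *; split=> [j jm|].
  rewrite -addnA e1; last lia.
  by rewrite tm_perD; have := tm_per_bounded n j; lia.
have := e2; rewrite -(subnKC Lm) tm_perD addnA.
have := tm_per_bounded n (m - 2 ^ n); have := uM (i + 2 ^ n + (m - 2 ^ n)).
by rewrite addKn; lia.
Qed.

(** The next block is squeezed: reflected windows bound it from below by the reflected prefix, and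
    the strict upper bound, the longer prefix, exceeds that only in its last digit. *)
Lemma windows_next n s i : bounded_by s -> windows_lt n.+1 s ->
  (forall l, l < 2 ^ n -> s (i + l) = tm l) ->
  forall l, l < 2 ^ n -> s (i + 2 ^ n + l) = M - tm l.
Proof.
move=> sM D h; have [[m mL [e1 e2]] _] := D i; rewrite /shift in e1 e2.
have Lm : 2 ^ n <= m.
  by rewrite leqNgt; apply/negP => mn; rewrite h// ltnn in e2.
set j := m - 2 ^ n; have jE : m = 2 ^ n + j by rewrite subnKC.
have jL : j < 2 ^ n by move: mL; rewrite expnS; lia.
have a l : l < j -> s (i + 2 ^ n + l) = M - tm l.
  by move=> lj; rewrite -addnA e1 ?tmD//; lia.
have b : s (i + 2 ^ n + j) = M - tm j.
  have lower : M - tm j <= s (i + 2 ^ n + j).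
    rewrite leqNgt; apply/negP => c.
    have [_ [m' m'L [f1 f2]]] := D (i + 2 ^ n); rewrite /shift /bar in f1 f2.
    have [c1|c1|c1] := ltngtP m' j.
    - by move: f2; rewrite a// subKn ?tm_le// ltnn.
    - have := f1 j c1; lia.
    - by move: f2; rewrite c1; lia.
  move: e2; rewrite jE addnA; have /andP[_] := tm_ge jL; lia.
have jlast : j.+1 = 2 ^ n.
  apply/eqP; rewrite eqn_leq jL leqNgt; apply/negP => c.
  by move: e2; rewrite jE addnA b tmD// ltnn.
move=> l lL; have [/a//|jl] := ltnP l j.
by have -> : l = j by lia.
Qed.

Lemma windows_per n s i : bounded_by s -> windows_lt n.+1 s ->
  (forall l, l < 2 ^ n -> s (i + l) = tm l) ->
  forall l, s (i + l) = tm_per n l.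
Proof.
move=> sM D h l.
have bD : windows_lt n.+1 (bar s) by move=> j; have [] := D j; rewrite barK.
suff blk c : forall r, r < 2 ^ n ->
    s (i + (c * 2 ^ n + r)) = (if odd c then M - tm r else tm r).
  rewrite {1}(divn_eq l (2 ^ n)) blk ?ltn_mod ?exp2_gt0//.
  rewrite [X in tm_per n X](divn_eq l (2 ^ n)); set r := l %% _.
  have rL : r < 2 ^ n by rewrite ltn_mod exp2_gt0.
  elim: (l %/ 2 ^ n) => [|c IH]; first by rewrite mul0n add0n tm_per_lt.
  rewrite mulSn -addnA tm_perD -IH /=; case: (odd c) => //=.
  by rewrite subKn ?tm_le.
elim: c => [r rL|c IH r rL]; first by rewrite mul0n add0n h.
have -> : i + (c.+1 * 2 ^ n + r) = i + c * 2 ^ n + 2 ^ n + r by rewrite mulSn; lia.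
case co : (odd c) IH; rewrite /= co /= => IH.
  have := @windows_next n (bar s) (i + c * 2 ^ n) (@bar_bounded s) bD _ r rL.
  rewrite /bar => e; have {e} := e _.
  have := sM (i + c * 2 ^ n + 2 ^ n + r); have := tm_le r.
  move=> u1 u2 e; suff : M - s (i + c * 2 ^ n + 2 ^ n + r) = M - tm r by lia.
  by apply: e => l0 l0L; rewrite -addnA IH// subKn// tm_le.
by apply: windows_next => // l0 l0L; rewrite -addnA IH.
Qed.

(** Maximality of the periodic tail serves the minimality of [q_KL]: it forbids that a whole
    sequence exceeds its own periodic tail. *)
Definition periodic_max s := exists i P, 0 < P /\ shift (i + P) s = shift i s /\
  forall j, ~ lexlt (shift i s) (shift j s).

(** Descent on the window length. Once the prefix of half the length occurs, all that follows is
    determined; if its reflection occurs, the prefix comes next; if neither does, shorter windows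
    already lie below. At length 1 every digit equals [k]. *)
Lemma windows_periodic n s : bounded_by s -> windows_lt n s -> periodic_max s.
Proof.
have := kM => -[hk1 [hk2 hk3]] sM.
elim: n => [|n IH] D.
  have sk j : s j = k.
    have [[m1 m1L [_ h1]] [m2 m2L [_ h2]]] := D j.
    move: h1 h2; rewrite /shift /bar; have -> : m1 = 0 by lia.
    have -> : m2 = 0 by lia.
    by rewrite addn0 tm0; have := sM j; lia.
  exists 0, 1; split=> //; split=> [|j]; first by apply/funext => j; rewrite /shift !sk.
  by move=> /lexltP[m [_]]; rewrite /shift !sk ltnn.
have [[i hi]|/forallNP N] := pselect (exists i, forall l, l < 2 ^ n -> s (i + l) = tm l).
  have pi := windows_per sM D hi.
  exists i, (2 ^ n.+1); split; first exact: exp2_gt0.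
  split=> [|j].
    apply/funext => l; rewrite /shift -addnA !pi /tm_per.
    by rewrite -modnDml modnn add0n.
  move=> /lexltP[m [e1 e2]]; rewrite /shift in e1 e2.
  have [mL|Lm] := ltnP m (2 ^ n).
    have [[m' m'L [f1 f2]] _] := D j; rewrite /shift in f1 f2.
    have [c|c|c] := ltngtP m' m.
    - by move: f2; rewrite -e1// hi ?ltnn//; lia.
    - by move: e2; rewrite f1// hi// ltnn.
    - by move: e2; rewrite -c hi c//; rewrite c in f2; lia.
  have hj l : l < 2 ^ n -> s (j + l) = tm l.
    by move=> lL; rewrite -e1 ?hi//; lia.
  by move: e2; rewrite pi (windows_per sM D hj) ltnn.
have bD : windows_lt n.+1 (bar s) by move=> j; have [] := D j; rewrite barK.
have N' i : ~ forall l, l < 2 ^ n -> bar s (i + l) = tm l.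
  move=> h; apply: (N (i + 2 ^ n)) => l lL.
  have := windows_next (@bar_bounded s) bD h lL; rewrite /bar.
  by have := sM (i + 2 ^ n + l); have := tm_le l; lia.
apply: IH => i; have [[m mL [e1 e2]] [m' m'L [f1 f2]]] := D i.
split; [exists m => //|exists m' => //]; rewrite ltnNge; apply/negP => c.
  by apply: (N i) => l lL; rewrite -e1//; lia.
by apply: (N' i) => l lL; rewrite -f1//; lia.
Qed.

(** * Free concatenations of Thue-Morse blocks *)

Section FreeWords.
Variable n : nat.
Hypothesis n0 : 0 < n.
Let L := 2 ^ n.

Let L2 : 2 <= L.
Proof. by rewrite /L -[X in X <= _]expn1 leq_exp2l. Qed.

(* The words [w^- w^-] (for [false]) and [w bar(w)] (for [true]), where [w] is the
   Thue-Morse prefix of length [L] and [w^-] is [w] with its last digit decremented,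
   can be concatenated freely. *)
Definition tm_free (t : nat -> bool) i : nat :=
  let b := i %/ L in let r := i %% L in
  if t b./2 then (if odd b then M - tm r else tm r) else tm r - (r.+1 == L).

Let tm_freeE t b r : r < L -> tm_free t (b * L + r) =
  if t b./2 then (if odd b then M - tm r else tm r) else tm r - (r.+1 == L).
Proof.
by move=> rL; rewrite /tm_free divnMDl ?modnMDl ?divn_small ?modn_small ?addn0//; lia.
Qed.

Lemma tm_free_bounded t : bounded_by (tm_free t).
Proof.
move=> i; rewrite /tm_free; have := tm_le (i %% L).
by case: (t _); [case: odd|]; lia.
Qed.

(** A tie on the first [L - r] letters is broken by the reflected prefix that follows, since it lies
    strictly below the tail of [tm] at [L - r]. *)
Let window r f : r < L -> lexle_below f tm (L - r) ->
  (forall l, l < r -> f (L - r + l) = M - tm l) -> lexle_below f tm L.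
Proof.
move=> rL [h|h] hn; first by left; apply: lexlt_below_mono h; exact: leq_subr.
have [r0|r0] := posnP r; first by right=> i iL; apply: h; lia.
have Lr : L - r < L by lia.
have [m mr [e1 e2]] := (tm_orderP n).1 _ Lr; rewrite /bar /shift in e1 e2.
left; exists (L - r + m); first by rewrite /L; lia.
split=> [j jm|]; last by rewrite hn//; lia.
have [/h//|Lj] := ltnP j (L - r).
by rewrite -(subnKC Lj) hn ?e1//; lia.
Qed.

(** A window meets at most two blocks, [r] being the offset in the first. Either the first piece is
    strictly smaller, or the second block starts with the reflected prefix, as [window] demands. *)
Lemma tm_free_window t i :
  lexle_below (shift i (tm_free t)) tm L /\ lexle_below (shift i (bar (tm_free t))) tm L.
Proof.
have L0 : 0 < L by lia.
set b := i %/ L; set r := i %% L; have rL : r < L by rewrite ltn_mod.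
have iE : i = b * L + r := divn_eq i L.
have v1 l : l < L - r -> shift i (tm_free t) l =
    if t b./2 then (if odd b then M - tm (r + l) else tm (r + l))
    else tm (r + l) - ((r + l).+1 == L).
  by move=> lr; rewrite /shift iE -addnA tm_freeE//; lia.
have v2 l : l < r -> shift i (tm_free t) (L - r + l) =
    if t b.+1./2 then (if odd b.+1 then M - tm l else tm l) else tm l - (l.+1 == L).
  move=> lr; rewrite /shift -tm_freeE; last lia.
  by congr tm_free; rewrite mulSn iE; lia.
have w1 l : l < L - r -> shift i (bar (tm_free t)) l =
    if t b./2 then (if odd b then tm (r + l) else M - tm (r + l))
    else M - tm (r + l) + ((r + l).+1 == L).
  move=> lr; have := v1 l lr; rewrite /shift /bar => ->.
  have := tm_le (r + l); have /andP[+ _] := tm_last_bound n.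
  case: (t _); first by case: odd; lia.
  move=> t0 t1; case: eqP => [e|_]; last lia.
  by move: t0; have -> : (2 ^ n).-1 = r + l; [rewrite -/L; lia|lia].
have w2 l : l < r -> shift i (bar (tm_free t)) (L - r + l) =
    if t b.+1./2 then (if odd b.+1 then tm l else M - tm l) else M - tm l.
  move=> lr; have := v2 l lr; rewrite /shift /bar => ->.
  have -> : (l.+1 == L) = false by lia.
  rewrite subn0; have := tm_le l.
  by case: (t _) => //; case: (odd _) => //; lia.
have up : lexle_below (shift r tm) tm (L - r) by apply: (tm_orderP n).2.
have lo : lexlt_below (bar (shift r tm)) tm (L - r).
  have [m mr [e1 e2]] := (tm_orderP n).1 _ rL; exists m => //; rewrite /bar /shift in e1 e2 *.
  have a1 := tm_le m; have a2 := tm_le (r + m).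
  split=> [j jm|]; last lia.
  by rewrite -e1// subKn// tm_le.
have ext f g h : (forall l, l < h -> f l = g l) -> lexlt_below f tm h -> lexlt_below g tm h.
  move=> fg [m mh [e1 e2]]; exists m => //; rewrite -fg//; split=> // j jm.
  by rewrite -fg ?e1//; lia.
have ext' f g h : (forall l, l < h -> f l = g l) -> lexle_below f tm h -> lexle_below g tm h.
  move=> fg [/(ext _ _ _ fg)|e]; first by left.
  by right=> l lh; rewrite -fg ?e.
have half : b.+1./2 = (odd b + b./2) by rewrite -uphalfE uphalf_half.
case tb : (t b./2) in v1 w1; last first.
  have nb l : l < r -> shift i (bar (tm_free t)) (L - r + l) = M - tm l.
    move=> lr; rewrite w2//; case: ifP => // + ; rewrite half.
    by case ob : (odd b); rewrite /= ?ob//= add0n tb.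
  split; last first.
    apply: (window rL) => //.
    have [m mr [e1 e2]] := lo; rewrite /bar /shift in e1 e2.
    have bf l : l < L - r -> (r + l).+1 != L ->
        shift i (bar (tm_free t)) l = M - tm (r + l).
      by move=> lr ne; rewrite w1// (negbTE ne) addn0.
    have pre j : j < m -> shift i (bar (tm_free t)) j = tm j.
      by move=> jm; rewrite bf ?e1//; lia.
    (* Lowering the last digit of [w] raises it by 1 in the reflection; this can turn the strict
       inequality into a tie, but no more. *)
    have [em|nem] := eqVneq (r + m).+1 L; last first.
      by left; exists m => //; split=> //; rewrite bf.
    have [c|c] := ltnP (shift i (bar (tm_free t)) m) (tm m).
      by left; exists m.
    right=> j jL; have [/pre//|mj] := ltnP j m; have -> : j = m by lia.
    by move: c; rewrite w1// em eqxx; lia.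
  left; apply: (@lexlt_below_mono _ _ (L - r)); first lia.
  have [[m mr [e1 e2]]|e] := up.
    rewrite /shift in e1 e2; exists m => //; rewrite v1//; split=> [j jm|]; last lia.
    rewrite v1; last lia.
    have -> : ((r + j).+1 == L) = false by lia.
    by rewrite subn0 e1.
  rewrite /shift in e; exists (L - r).-1; first lia.
  split=> [j jm|].
    rewrite v1; last lia.
    have -> : ((r + j).+1 == L) = false by lia.
    by rewrite subn0 e//; lia.
  rewrite v1; last lia.
  have -> : (r + (L - r).-1).+1 == L by lia.
  rewrite -(e (L - r).-1); last lia.
  have /andP[+ _] := tm_last_bound n.
  by have -> : (2 ^ n).-1 = r + (L - r).-1; [rewrite -/L|]; lia.
case ob : (odd b) in v1 w1.
  split.
    left; apply: lexlt_below_mono (leq_subr r L) _.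
    by apply: ext lo => l lr; rewrite v1.
  apply: (window rL).
    by apply: ext' up => l lr; rewrite w1.
  by move=> l lr; rewrite w2// /= ob /=; case: ifP.
split; last first.
  left; apply: lexlt_below_mono (leq_subr r L) _.
  by apply: ext lo => l lr; rewrite w1.
apply: (window rL); first by apply: ext' up => l lr; rewrite v1.
by move=> l lr; rewrite v2// half ob add0n tb /= ob.
Qed.

Lemma tm_free_ltM t j : exists2 i, j <= i & tm_free t i < M.
Proof.
have := kM => -[hk1 _].
case tj : (t j).
  exists (j.*2.+1 * L + 0); first by rewrite addn0; nia.
  rewrite tm_freeE; last lia.
  by rewrite /= uphalf_double tj odd_double /= tm0; lia.
exists (j.*2 * L + L.-1); first nia.
rewrite tm_freeE; last lia.
rewrite doubleK tj prednK ?eqxx; last lia.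
have /andP[h1 h2] := tm_last_bound n; rewrite -/L in h1 h2; lia.
Qed.

Lemma tm_free_gt0 t j : exists2 i, j <= i & 0 < tm_free t i.
Proof.
have := kM => -[hk1 _].
exists (j.*2 * L + 0); first by rewrite addn0; nia.
rewrite tm_freeE; last lia.
rewrite doubleK odd_double tm0; case: (t j) => //.
have -> : (1 == L) = false by lia.
by rewrite subn0.
Qed.

Lemma tm_free_diff t u m : (forall i, i < m -> t i = u i) -> t m <> u m ->
  (forall i, i < m * (2 * L) -> tm_free t i = tm_free u i) /\
  exists2 i, i < m.+1 * (2 * L) & tm_free t i <> tm_free u i.
Proof.
move=> tu tum; split=> [i im|].
  have : (i %/ L)./2 < m.
    rewrite -divn2 -divnMA ltn_divLR; last lia.
    by rewrite [L * 2]mulnC.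
  by rewrite /tm_free => /tu ->.
(* The last letter of the first block coded by [t m]: there [w] and [w^-] differ, because that digit
   of [w] is positive. *)
exists (m.*2 * L + L.-1); first by rewrite -mul2n; nia.
rewrite !tm_freeE; try lia.
rewrite doubleK odd_double prednK ?eqxx; last lia.
have /andP[h1 h2] := tm_last_bound n; rewrite -/L in h1 h2.
by move: tum; case: (t m); case: (u m) => //; lia.
Qed.

End FreeWords.
End ThueMorse.

(** * The constants [q_G] and [q_KL] *)

Definition to_digits M (f : nat -> nat) : nat -> 'I_M.+1 := fun i => inord (f i).

Lemma to_digitsE M f : bounded_by M f -> (fun i => to_digits M f i : nat) = f.
Proof. by move=> h; apply/funext => i; rewrite /to_digits inordK// ltnS. Qed.

Lemma refl_to_digits M f : bounded_by M f ->
  refl (to_digits M f) = to_digits M (bar M f).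
Proof.
move=> h; apply/funext => i; apply: val_inj; rewrite /= subSS.
by rewrite /to_digits !inordK ?ltnS// leq_subr.
Qed.

Lemma dlt_to_digits M f g : bounded_by M f -> bounded_by M g ->
  dlt (to_digits M f) (to_digits M g) <-> lexlt f g.
Proof. by move=> hf hg; rewrite /dlt !to_digitsE. Qed.

Section BaseConstants.
Context {R : realType} (M : nat) (M0 : (0 < M)%N).
Implicit Types (q p x y : R) (d s t : nat -> 'I_M.+1).

Let k := M./2.

Definition alternate (a b i : nat) := if odd i then b else a.

(** Constantly [k] if [M = 2k], and [k + 1], [k] alternating if [M = 2k + 1]: the sequence worth 1
    in base [q_G]. *)
Definition golden_seq := to_digits M (alternate (M - k) k).

Let kM : (k <= M)%N /\ (k < M)%N /\ (k <= M - k <= k.+1)%N.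
Proof. by rewrite /k; have := odd_double_half M; lia. Qed.

Let alt_bounded a b : (a <= M)%N -> (b <= M)%N -> bounded_by M (alternate a b).
Proof. by move=> ha hb i; rewrite /alternate; case: ifP. Qed.

Lemma val_alternate q a b : 1 < q -> (a <= M)%N -> (b <= M)%N ->
  val q (to_digits M (alternate a b)) = (a%:R * q + b%:R) / (q ^+ 2 - 1).
Proof.
move=> q1 ha hb; have q2 : q ^+ 2 - 1 != 0 by rewrite gt_eqF//; nra.
pose r n := (if odd n then b%:R * q + a%:R else a%:R * q + b%:R) / (q ^+ 2 - 1).
apply: (@val_unique _ _ q _ r (Num.max `|r 0%N| `|r 1%N|) q1) => n.
  have -> : r n = r (odd n) by rewrite /r oddb.
  by rewrite le_max; case: (odd n); rewrite lexx ?orbT.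
rewrite /to_digits inordK ?ltnS; last exact: alt_bounded.
by rewrite /r /alternate /=; case: (odd n) => /=; field; rewrite q2/=; lra.
Qed.

(** Value 1 means [q ^+ 2 - 1 = (M - k) * q + k], whose root above 1 is [q_G]. The bound 2 on [vmax]
    makes the reflection of an expansion of 1 worth at most 1 in bases from [q_G] on. *)
Lemma q_G_bounds : 1 < q_G M :> R /\ vmax (M := M) (q_G M) <= 2 :> R /\
  forall q, 1 < q -> (q < q_G M -> 1 < val q golden_seq) /\
                    (q_G M < q -> val q golden_seq < 1).
Proof.
have [h1 [h2 h3]] := kM; have h4 : (M - k <= M)%N by lia.
have hM := odd_double_half M; rewrite -/k in hM.
have k0 : 0 <= k%:R :> R by [].
have main (g : R) : 1 < g -> M%:R <= 2 * (g - 1) ->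
    (forall q, 1 < q -> q < g -> q ^+ 2 - 1 < (M - k)%:R * q + k%:R) ->
    (forall q, 1 < q -> g < q -> (M - k)%:R * q + k%:R < q ^+ 2 - 1) ->
    1 < g /\ vmax (M := M) g <= 2 /\
    forall q, 1 < q -> (q < g -> 1 < val q golden_seq) /\ (g < q -> val q golden_seq < 1).
  move=> g1 gM a b; split=> //; split; first by rewrite /vmax ler_pdivrMr ?subr_gt0.
  move=> q q1; rewrite /golden_seq val_alternate//.
  have q2 : 0 < q ^+ 2 - 1 by nra.
  by split=> h; [rewrite ltr_pdivlMr// mul1r a|rewrite ltr_pdivrMr// mul1r b].
rewrite /q_G -/k; case oM : (odd M) hM => hM; last first.
  have e : M = k.*2 by rewrite -hM.
  have k1 : 1 <= k%:R :> R by rewrite ler1n; lia.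
  have e1 : M%:R = 2 * k%:R :> R by rewrite {1}e -mul2n natrM.
  have e2 : (M - k)%N = k by lia.
  by apply: main; rewrite ?e1 ?e2; [lra|lra|move=> q q1 h; nra|move=> q q1 h; nra].
have e : M = k.*2.+1 by rewrite -{1}hM.
have e1 : M%:R = 2 * k%:R + 1 :> R by rewrite {1}e -natr1 -mul2n natrM.
have e2 : (M - k)%:R = k%:R + 1 :> R by rewrite natr1; congr _%:R; lia.
set S := Num.sqrt _.
have P0 : 0 <= k%:R ^+ 2 + 6 * k%:R + 5 :> R by nra.
have S2 : S ^+ 2 = k%:R ^+ 2 + 6 * k%:R + 5 by rewrite sqr_sqrtr.
have S0 : 0 <= S by rewrite sqrtr_ge0.
have Sk : k%:R + 2 <= S by rewrite leNgt; apply/negP => h; nra.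
set g := (k%:R + 1 + S) / 2.
have gE : g ^+ 2 = (k%:R + 1) * g + (k%:R + 1) by rewrite /g; lra.
have gk : k%:R + 3/2 <= g by rewrite /g; lra.
by apply: main; rewrite ?e1 ?e2; [lra|lra|move=> q q1 h; nra|move=> q q1 h; nra].
Qed.

Lemma golden_seq_strong q : 1 < q -> val q golden_seq < 1 -> strong q golden_seq.
Proof.
have [h1 [h2 h3]] := kM; have h4 : (M - k <= M)%N by lia.
move=> q1 v1.
have v2 : val q (to_digits M (alternate k (M - k))) < 1.
  apply: le_lt_trans v1; rewrite /golden_seq !val_alternate//.
  rewrite ler_pM2r ?invr_gt0; last nra.
  have : k%:R <= (M - k)%:R :> R by rewrite ler_nat; lia.
  nra.
have sh a b n : shift n (to_digits M (alternate a b)) =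
    if odd n then to_digits M (alternate b a) else to_digits M (alternate a b).
  case on : (odd n); apply/funext => i; rewrite /shift /to_digits /alternate oddD on /=.
    by case: (odd i).
  by [].
have rf a b : (a <= M)%N -> (b <= M)%N ->
    refl (to_digits M (alternate a b)) = to_digits M (alternate (M - a) (M - b)).
  move=> ha hb; rewrite refl_to_digits; last exact: alt_bounded.
  by congr to_digits; apply/funext => i; rewrite /bar /alternate; case: odd.
move=> n; rewrite refl_shift rf// !sh subKn//; split; case: odd => //.
Qed.

(** Dropping the first digit and reflecting maps [golden_seq] to itself but reverses comparisons, so
    a strong sequence cannot start with [M - k]. Then [d] and its reflection both start below
    [M - k], which leaves no digit. *)
Lemma strong_golden_empty q d : 1 < q -> q < q_G M -> ~ strong q d.
Proof.
have [h1 [h2 h3]] := kM; have h4 : (M - k <= M)%N by lia.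
have gb := alt_bounded h4 h1.
move=> q1 qg sd; have [_ [_ /(_ q q1)[/(_ qg) v1 _]]] := q_G_bounds.
have key s : strong q s -> (s 0 < M - k)%N.
  move=> ss; have lt n := strong_dlt q1 (ltW v1) ss n.
  have [/lexltP[[|m] [e1 e2]] _] := lt 0%N.
    by move: e2; rewrite shift0 /golden_seq /to_digits inordK// ltnS.
  have [_ L] := lt 1%N; case: (@lexlt_irr (fun i => golden_seq i : nat)).
  apply: lexlt_trans L; apply/lexltP; exists m.
  have gE i : (golden_seq i : nat) = alternate (M - k) k i.
    by rewrite /golden_seq /to_digits inordK// ltnS.
  have ga i : alternate (M - k) k i = (M - alternate (M - k) k i.+1)%N.
    by rewrite /alternate /=; case: odd => //=; rewrite subKn.
  have gl i := gb i.+1.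
  split=> [i im|].
    by rewrite /shift reflE add1n gE ga -(gE i.+1) -(e1 i.+1).
  rewrite /shift reflE add1n gE ga; move: e2; rewrite gE /shift add0n => e2.
  by have := gl m; lia.
have a := key _ sd; have b := key _ (strong_refl sd).
by rewrite reflE in b; have := ltn_ord (d 0%N); lia.
Qed.

Lemma univ_golden_max q d : 1 < q -> q <= M.+1%:R -> q < q_G M -> univ q d ->
  0 < val q d -> val q d = vmax (M := M) q.
Proof.
move=> q1 qM qg ud v0; apply/eqP; rewrite eq_le val_le//= leNgt; apply/negP => h.
have [|n] := @univ_nontrivial_strong R M q d M0 q1 qM ud; first by rewrite v0 h.
exact: strong_golden_empty.
Qed.

Definition dtm := to_digits M (tm M).

Let tmM : bounded_by M (tm M) := tm_le M0.

Let dtmE i : (dtm i : nat) = tm M i.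
Proof. by rewrite /dtm /to_digits inordK ?ltnS. Qed.

Lemma dtm_inf n : exists2 m, (n <= m)%N & (0 < dtm m)%N.
Proof.
exists (2 ^ n).-1; first by have := ltn_expl n (isT : (1 < 2)%N); lia.
by rewrite dtmE; have /andP[] := tm_last_bound M0 n.
Qed.

Lemma val_gt0_inf q s : 1 < q -> (forall n, exists2 m, (n <= m)%N & (0 < s m)%N) ->
  0 < val q s.
Proof. by move=> q1 /(_ 0%N)[m _]; exact: val_gt0. Qed.

Lemma val_M1_lt1 s m : (s m < M)%N -> val M.+1%:R s < 1 :> R.
Proof.
move=> sm; have q1 : 1 < M.+1%:R :> R by rewrite ltr1n.
have : 0 < val (M.+1%:R : R) (refl s) by apply: (@val_gt0 _ _ _ _ m) => //; rewrite reflE; lia.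
rewrite val_refl// /vmax -natr1 addrK divff ?subr_gt0// pnatr_eq0; lia.
Qed.

Lemma tm_base : exists2 q : R, 1 < q < M.+1%:R & val q dtm = 1.
Proof.
have M1 : 1 < M.+1%:R :> R by rewrite ltr1n.
have M2 : 2 <= M.+1%:R :> R by rewrite ler_nat.
have t2 : (dtm 2 < M)%N.
  rewrite dtmE.
  have -> : tm M 2 = (M - tm M 0)%N by exact: (@tmD M M0 1 0).
  by rewrite tm0; lia.
have v1 := val_M1_lt1 t2.
have p1 : 1 < 3/2 :> R by lra.
have [|||q /andP[q1 q2] qE] := @val_ivt R M (3/2) M.+1%:R dtm 1 p1; first by lra.
- exact: ltW.
- apply: le_trans (psum_le_val dtm 2 p1).
  rewrite !psumS /psum big_ord0 !dtmE add0r expr1.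
  have a : 1 <= (tm M 0)%:R :> R by rewrite ler1n tm0.
  have b : 1 <= (tm M 1)%:R :> R.
    by rewrite ler1n; have /andP[] := tm_last_bound M0 1.
  apply: le_trans (_ : 1 * (3/2)^-1 + 1 * (3 / 2) ^- 2 <= _); first by lra.
  by apply: lerD; apply: ler_wpM2r.
exists q => //; rewrite (lt_le_trans p1 q1) lt_neqAle q2 andbT.
by apply/eqP => e; move: v1; rewrite -e qE ltxx.
Qed.

(** The Thue-Morse inequalities are the lexicographic criterion with [dtm] itself, worth 1, as the
    bound. *)
Lemma dtm_strong1 q : 1 < q -> val q dtm = 1 -> strong q (shift 1 dtm).
Proof.
move=> q1 v1; apply: (@lex_strong _ _ q dtm) => //; [by rewrite v1|exact: dtm_inf| |].
  move=> n; rewrite shift_shift add1n /dlt.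
  have -> : (fun i => shift n.+1 dtm i : nat) = shift n.+1 (tm M).
    by apply/funext => i; exact: dtmE.
  rewrite to_digitsE//; exact: tm_tail_lt.
move=> n; rewrite refl_shift shift_shift add1n /dlt.
have -> : (fun i => shift n.+1 (refl dtm) i : nat) = bar M (shift n.+1 (tm M)).
  by apply/funext => i; rewrite /shift reflE dtmE.
rewrite to_digitsE//; exact: bar_tm_tail_lt.
Qed.

Definition dtm_per n := to_digits M (tm_per M n).

Lemma dtm_per_val q : 1 < q -> 1 < val q dtm -> exists n, 1 < val q (dtm_per n).
Proof.
move=> q1 v1; have e0 : 0 < val q dtm - 1 by rewrite subr_gt0.
have [N /(_ (2 ^ N)%N) hN] := expr_inv_small (vmax (M := M) q) q1 e0.
exists N; apply: lt_le_trans (psum_le_val (dtm_per N) (2 ^ N) q1).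
have -> : psum q (dtm_per N) (2 ^ N) = psum q dtm (2 ^ N).
  by apply: psum_eq => i i_n; rewrite /dtm_per /dtm /to_digits tm_per_lt.
have := val_split dtm (2 ^ N) q1.
have := hN (ltnW (ltn_expl N (isT : (1 < 2)%N))).
have : q ^- (2 ^ N) * val q (shift (2 ^ N) dtm) <= q ^- (2 ^ N) * vmax (M := M) q.
  by apply: ler_wpM2l (val_le _ q1); rewrite invr_ge0 exprn_ge0//; lra.
lra.
Qed.

Lemma dlt_periodic q s : 1 < q -> 1 < val q dtm ->
  (forall n, 1 < val q (dtm_per n) -> forall i,
    dlt (shift i s) (dtm_per n) /\ dlt (shift i (refl s)) (dtm_per n)) ->
  exists i P, (0 < P)%N /\ shift (i + P) s = shift i s /\
    forall j, ~ dlt (shift i s) (shift j s).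
Proof.
move=> q1 v1 h; have [n vn] := dtm_per_val q1 v1.
have pb := tm_per_bounded M0 n.
pose f i : nat := s i.
have fb : bounded_by M f by move=> i; exact: digit_leM.
have [i [P [P0 [e mx]]]] : periodic_max f.
  apply: (@windows_periodic M M0 n) => //; apply: windows_ltP => // i.
    by have [+ _] := h n vn i; rewrite /dlt /dtm_per to_digitsE.
  have [_] := h n vn i; rewrite /dlt /dtm_per to_digitsE//.
exists i, P; split=> //; split=> [|j]; last exact: mx.
by apply/funext => j; apply: val_inj; exact: (congr1 (@^~ j) e).
Qed.

Lemma strong_periodic q s : 1 < q -> 1 < val q dtm -> strong q s ->
  exists i P, (0 < P)%N /\ shift (i + P) s = shift i s.
Proof.
move=> q1 v1 ss; have [|i [P [P0 [e _]]]] := dlt_periodic (s := s) q1 v1.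
  by move=> n /ltW vn i; exact: strong_dlt ss i.
by exists i, P.
Qed.

(** In a smaller base, an expansion of 1 would lie, with all its tails and reflections, below those
    [dtm_per n] that are worth more than 1, hence have a maximal periodic tail. But that tail recurs
    later, where it is worth less than 1 and so is smaller than the whole sequence. *)
Lemma q_KLP : 1 < (q_KL M : R) < M.+1%:R /\ val (q_KL M : R) dtm = 1.
Proof.
have [q0 /andP[q1 qM] v1] := tm_base.
suff -> : q_KL M = q0 by rewrite q1 qM.
have inU : univoque_bases M 1 q0.
  apply/(univoqueP _ q1 (ltW qM)); exists dtm => // n.
  by have [a b] := dtm_strong1 q1 v1 n; rewrite shift_shift add1n in a b.
have lb : lbound (univoque_bases M 1) q0.
  move=> p Up; have [/andP[p1 pM] _] := Up; rewrite leNgt; apply/negP => pq.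
  have [s vs us] := (univoqueP _ p1 pM).1 Up.
  have pM' : p < M.+1%:R by exact: lt_trans pq qM.
  have v1p : 1 < val p dtm.
    by rewrite -v1; apply: val_mono_lt => //; apply: val_gt0_inf => //; exact: dtm_inf.
  have vs' : p = (s 0)%:R + val p (shift 1 s).
    by have := val_rec s p1; rewrite vs => /(congr1 ( *%R^~ p)); rewrite mul1r divfK//; lra.
  have s1 : val p (shift 1 s) < 1.
    have [sM|sM] := ltnP (s 0%N) M; first exact: (us 0%N).1.
    have e : (s 0)%:R = M%:R :> R by congr _%:R; apply/eqP; rewrite eqn_leq sM digit_leM.
    by move: pM'; rewrite -natr1; rewrite e in vs'; lra.
  have s0 : (0 < s 0%N)%N.
    by rewrite lt0n; apply/eqP => e; move: vs'; rewrite e add0r; lra.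
  have st : strong p (shift 1 s).
    by apply: univ_strong_next => //; exact: (us 0%N).2.
  have pg : q_G M <= p by rewrite leNgt; apply/negP => /(strong_golden_empty p1); exact.
  have rs : val p (refl s) <= 1.
    have [g1 [g2 _]] := q_G_bounds.
    rewrite val_refl// vs lerBlDr; apply: le_trans g2.
    by rewrite /vmax ler_pM2l ?ltr0n// lef_pV2 ?posrE ?subr_gt0// lerD2r.
  have [|i [P [P0 [e mx]]]] := dlt_periodic (s := s) p1 v1p.
    move=> n vn [|i]; last first.
      have [a b] := strong_dlt p1 (ltW vn) st i.
      by rewrite refl_shift !shift_shift !add1n in a b.
    rewrite !shift0; split; apply: univ_dlt p1 _ _ => //.
    - by rewrite vs.
    - exact: univ_refl.
    - exact: le_lt_trans rs vn.
  apply: (mx 0%N); rewrite shift0 -e; apply: univ_dlt p1 _ _; first exact: univ_shift.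
  have -> : shift (i + P) s = shift (i + P).-1 (shift 1 s).
    by rewrite shift_shift add1n prednK// addn_gt0 P0 orbT.
  by rewrite vs; have [] := st (i + P).-1.
apply: get_unique; first by split.
move=> y [Uy lby]; apply/eqP; rewrite eq_le; apply/andP; split.
  exact: lby.
exact: lb.
Qed.

(** Beyond [q_KL] the sequence [tm] is worth less than 1, so a long prefix of it followed by digits
    [M] is still worth at most 1. This bound is strict for free concatenations: after a tie with the
    prefix, a digit below [M] eventually comes. *)
Lemma tm_free_strong p : q_KL M < p -> exists2 n, (0 < n)%N &
  forall t : nat -> bool, strong p (to_digits M (tm_free M n t)).
Proof.
have [/andP[q1 qM] v1] := q_KLP; move=> qp; have p1 : 1 < p by lra.
have vp : val p dtm < 1.
  by rewrite -v1; apply: val_mono_lt => //; rewrite v1.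
have e0 : 0 < 1 - val p dtm by rewrite subr_gt0.
have [N hN] := expr_inv_small (vmax (M := M) p) p1 e0.
pose n := N.+1; exists n => // t.
have nL : (n <= 2 ^ n)%N by apply: ltnW; exact: ltn_expl.
pose f i := if (i < 2 ^ n)%N then tm M i else M.
have fb : bounded_by M f by move=> i; rewrite /f; case: ifP.
have tb := @tm_free_bounded M M0 n isT t.
have lt u : bounded_by M u -> (forall i, lexle_below (shift i u) (tm M) (2 ^ n)) ->
    (forall j, exists2 i, (j <= i)%N & (u i < M)%N) ->
    forall i, dlt (shift i (to_digits M u)) (to_digits M f).
  move=> ub w um i; apply/(dlt_to_digits (shift_bounded i ub) fb).
  have [[m mL [e1 e2]]|e] := w i.
    apply/lexltP; exists m; rewrite /f mL; split=> // j jm.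
    by rewrite (ltn_trans jm mL) e1.
  have [j ij um'] := um (i + 2 ^ n)%N.
  have [//|eq|/lexltP[m [h1 h2]]] := lexlt_total (shift i u) f.
    have := congr1 (@^~ (j - i)%N) eq; rewrite /= /shift /f subnKC; last lia.
    by rewrite ifF; [move=> e'; rewrite e' ltnn in um'|lia].
  move: h2; rewrite /f; case: ifP => [mL|_]; first by rewrite e ?ltnn.
  by have := ub (i + m)%N; rewrite /shift; lia.
apply: (@lex_strong _ _ p (to_digits M f)) => //.
- rewrite (val_split _ (2 ^ n) p1).
  have -> : psum p (to_digits M f) (2 ^ n) = psum p dtm (2 ^ n).
    by apply: psum_eq => i i_n; rewrite /dtm /to_digits /f i_n.
  have := psum_le_val dtm (2 ^ n) p1.
  have := hN (2 ^ n)%N; rewrite (leq_trans _ nL)// => /(_ isT).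
  have : p ^- (2 ^ n) * val p (shift (2 ^ n) (to_digits M f)) <= p ^- (2 ^ n) * vmax (M := M) p.
    by apply: ler_wpM2l (val_le _ p1); rewrite invr_ge0 exprn_ge0//; lra.
  lra.
- move=> j; exists (j + 2 ^ n)%N; first exact: leq_addr.
  by rewrite /to_digits inordK ?ltnS// /f ifF//; lia.
- apply: lt => // [i|j]; first by have [] := @tm_free_window M M0 n isT t i.
  exact: tm_free_ltM.
- move=> i; rewrite refl_to_digits//; apply: lt => //.
  + exact: bar_bounded.
  + by move=> l; have [] := @tm_free_window M M0 n isT t l.
  + move=> j; have [l jl l0] := @tm_free_gt0 M M0 n isT t j; exists l => //.
    by rewrite /bar; lia.
Qed.

End BaseConstants.

(** * Counting prefixes of univoque sequences *)

Section Counting.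
Context {R : realType} {M : nat}.
Implicit Types (d s : nat -> 'I_M.+1) (u v : R).

(** The slack [e] absorbs a change of base, so that univoque sequences of all bases near [q] are
    counted in base [q] alone. *)
Definition almost_univ (q e : R) d := forall n,
  ((d n < M)%N -> val q (shift n.+1 d) <= 1 + e) /\
  ((0 < d n)%N -> val q (refl (shift n.+1 d)) <= 1 + e).

Lemma univ_almost_univ (q p e : R) d : 1 < q -> q <= p -> lip (M := M) q * (p - q) <= e ->
  univ p d -> almost_univ q e d.
Proof.
move=> q1 qp he ud n; have [h1 h2] := ud n.
split=> dn; [have := h1 dn; have := val_lip (shift n.+1 d) q1 (lexx q) qp
  | have := h2 dn; have := val_lip (refl (shift n.+1 d)) q1 (lexx q) qp]; lra.
Qed.

Definition prefix_of m d : m.-tuple 'I_M.+1 := mktuple (fun i : 'I_m => d i).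

Lemma prefix_ofE m d s : prefix_of m d = prefix_of m s <->
  forall i, (i < m)%N -> d i = s i.
Proof.
split=> [e i im|h].
  by have := congr1 (fun w => tnth w (Ordinal im)) e; rewrite !tnth_mktuple.
by apply: eq_from_tnth => i; rewrite !tnth_mktuple h.
Qed.

Lemma prefix_of_cons m d : prefix_of m.+1 d = [tuple of d 0 :: prefix_of m (shift 1 d)].
Proof.
apply: eq_from_tnth => i; rewrite tnth_mktuple.
case: (unliftP ord0 i) => [j|] ->; last by rewrite tnth0.
by rewrite tnthS tnth_mktuple.
Qed.

Definition words (q e : R) m u v : {set m.-tuple 'I_M.+1} :=
  [set w | `[< exists d, [/\ almost_univ q e d, u <= val q d <= v & prefix_of m d = w] >]].

Variable q : R.
Hypothesis (M0 : (0 < M)%N) (q1 : 1 < q) (qM : q < M.+1%:R).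

Let b := vmax (M := M) q.
(** Without slack the hole has length [(b - 1) / q], positive as [q < M + 1]. The slack [e] gives up
    a quarter of it on either side; half of it remains, of radius [h]. *)
Let e := (b - 1) / 4.
Let h := (b - 1) / (4 * q).
(* The hole between the values of expansions with first digits [j - 1] and [j] contains
   the interval of radius [h] around [c j]. *)
Let c (j : nat) := (2 * j%:R - 1 + b) / (2 * q).

Let b1 : 1 < b.
Proof. by rewrite /b /vmax ltr_pdivlMr ?subr_gt0// mul1r; move: qM; rewrite -natr1; lra. Qed.

Let q0 : 0 < q. Proof. by have := q1; lra. Qed.
Let e0 : 0 < e. Proof. by rewrite /e; have := b1; lra. Qed.
Let h0 : 0 < h. Proof. by rewrite /h divr_gt0//; have := b1; have := q1; lra. Qed.
Let hb : h < b.
Proof. by have := b1; have := q1 => *; rewrite /h ltr_pdivrMr; [nra|lra]. Qed.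

Let au := almost_univ q e.

Let au_shift n d : au d -> au (shift n d).
Proof. by move=> hd m; have := hd (n + m)%N; rewrite shift_shift addnS. Qed.

Let hole_lt d j : au d -> (d 0 < j)%N -> (j <= M)%N -> val q d <= c j - h.
Proof.
move=> ad dj jM; have [h1 _] := ad 0%N.
have := h1 (leq_trans dj jM) => vs.
rewrite (val_rec d q1).
have -> : c j - h = (j%:R + e) / q by rewrite /c /h /e; field; rewrite gt_eqF.
rewrite ler_pM2r ?invr_gt0//; have := natrB_ge1 (R := R) dj; lra.
Qed.

Let hole_ge d j : au d -> (0 < j)%N -> (j <= d 0)%N -> c j + h <= val q d.
Proof.
move=> ad j0 jd; have [_ h1] := ad 0%N.
have := h1 (leq_trans j0 jd); rewrite val_refl// -/b => vs.
rewrite (val_rec d q1).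
have -> : c j + h = (j%:R + b - 1 - e) / q by rewrite /c /h /e; field; rewrite gt_eqF.
rewrite ler_pM2r ?invr_gt0//.
have : j%:R <= (d 0%N)%:R :> R by rewrite ler_nat.
lra.
Qed.

(** After the common prefix the first digits differ, so a hole of width [2 * h] lies between the
    tail values; the prefix scales it down. *)
Let separated m d s : au d -> au s -> `|val q d - val q s| < 2 * h * q ^- m ->
  prefix_of m d = prefix_of m s.
Proof.
move=> ad as_ lt; apply/prefix_ofE => i im; apply/eqP/negP => /negP ne.
have /first_diff[n [en dn]] : d <> s by move=> ds; rewrite ds eqxx in ne.
have nm : (n < m)%N.
  by apply: leq_ltn_trans im; rewrite leqNgt; apply/negP => /en ds; rewrite ds eqxx in ne.
have big d' s' : au d' -> au s' -> (d' 0 < s' 0)%N -> 2 * h <= val q s' - val q d'.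
  move=> a1 a2 l; have := hole_ge a2 (leq_ltn_trans (leq0n _) l) (leqnn _).
  have := hole_lt a1 l (digit_leM _); lra.
have b2 : 2 * h <= `|val q (shift n d) - val q (shift n s)|.
  have [l|l|l] := ltngtP (d n) (s n).
  - by rewrite distrC; apply: le_trans (ler_norm _); apply: big;
      rewrite /shift ?addn0//; exact: au_shift.
  - by apply: le_trans (ler_norm _); apply: big; rewrite /shift ?addn0//; exact: au_shift.
  - by move: dn; rewrite -val_eqE /= l eqxx.
have E : val q d - val q s = q ^- n * (val q (shift n d) - val q (shift n s)).
  by rewrite (val_split d n q1) (val_split s n q1) (psum_eq q en); ring.
move: lt; rewrite E normrM normfV normrX (gtr0_norm q0) ltNge; apply/negP; rewrite negbK.
rewrite mulrC; apply: ler_pM => //.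
- by rewrite invr_ge0 exprn_ge0// ltW.
- by rewrite mulr_ge0// ltW.
- by rewrite lef_pV2 ?posrE ?exprn_gt0// ler_eXn2l// ltnW.
Qed.

Let W m u v := words q e m u v.

(** Pigeonhole: by [separated], each cell of width [2 * h * q ^- m] holds the value of at most one
    representative. *)
Lemma card_words_le m u v : u <= v -> #|W m u v|%:R <= 1 + (v - u) / (2 * h) * q ^+ m.
Proof.
move=> uv.
have /choice[f fP] : forall w, exists d, w \in W m u v ->
    [/\ au d, u <= val q d <= v & prefix_of m d = w].
  move=> w; case: (boolP (w \in W m u v)) => [|_]; last by exists (fun=> ord0).
  by rewrite inE => /asboolP[d hd]; exists d.
have qm : 0 < q ^+ m by rewrite exprn_gt0.
pose g w := (val q (f w) - u) / (2 * h) * q ^+ m.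
have g0 w : w \in W m u v -> 0 <= g w <= (v - u) / (2 * h) * q ^+ m.
  move=> /fP[_ /andP[lo up] _]; apply/andP; split.
    by apply: mulr_ge0 (ltW qm); rewrite divr_ge0 ?subr_ge0// mulr_ge0// ltW.
  rewrite ler_pM2r// ler_pM2r ?lerD2r// invr_gt0; have := h0; lra.
pose K := Num.truncn ((v - u) / (2 * h) * q ^+ m).
pose t w : 'I_K.+1 := inord (Num.truncn (g w)).
have tE w : w \in W m u v -> t w = Num.truncn (g w) :> nat.
  by move=> /g0/andP[_ gK]; rewrite /t inordK// ltnS; exact: le_truncn.
have inj : {in W m u v &, injective t}.
  move=> w w' ww ww' /(congr1 (fun z : 'I_K.+1 => z : nat)); rewrite !tE// => tt.
  have [a1 _ p1] := fP w ww; have [a2 _ p2] := fP w' ww'; rewrite -p1 -p2.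
  apply: separated => //.
  have /andP[g1 _] := g0 _ ww; have /andP[g2 _] := g0 _ ww'.
  have lt : `|g w - g w'| < 1.
    rewrite -truncn_le in g1; rewrite -truncn_le in g2.
    have := truncnS_gt (g w); have := truncnS_gt (g w'); rewrite -!natr1 tt in g1 *.
    by rewrite ltr_norml; lra.
  have E : g w - g w' = (val q (f w) - val q (f w')) / (2 * h * q ^- m).
    by rewrite /g; field; rewrite !gt_eqF.
  have D0 : 0 < 2 * h * q ^- m by rewrite mulr_gt0 ?invr_gt0//; have := h0; lra.
  by move: lt; rewrite E normrM normfV (gtr0_norm D0) ltr_pdivrMr// mul1r.
have : (#|W m u v| <= K.+1)%N.
  by rewrite -(card_in_imset inj); apply: leq_trans (max_card _) _; rewrite card_ord.
rewrite -(ler_nat R) => /le_trans; apply.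
rewrite -natr1 addrC lerD2l truncn_le.
by apply: mulr_ge0 (ltW qm); rewrite divr_ge0 ?subr_ge0// mulr_ge0// ltW.
Qed.

Let W_gt m u v : v < u -> #|W m u v| = 0%N.
Proof.
move=> vu; apply/eqP; rewrite cards_eq0; apply/eqP/setP => w; rewrite !inE.
by apply/asboolP => -[d [_ /andP[a1 a2] _]]; lra.
Qed.

(** The number [a] bounds the words, relative to [q ^+ m], per unit of length of the value interval.
    The threshold [m0] may depend on the interval, since each refinement uses finitely many. *)
Let density a := forall u v, 0 <= u -> v <= b -> forall eps, 0 < eps ->
  exists m0, forall m, (m0 <= m)%N ->
    #|W m u v|%:R <= (a * Num.max 0 (v - u) + eps) * q ^+ m.

Let density_init : density (2 * h)^-1.
Proof.
move=> u v u0 vb eps eps0; have [N hN] := expr_inv_small 1 q1 eps0.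
exists N => m /hN; rewrite mul1r => /ltW hm; have qm : 0 < q ^+ m by rewrite exprn_gt0.
have [uv|vu] := leP u v; last first.
  rewrite W_gt// mulr0n; apply: mulr_ge0 (ltW qm); apply: addr_ge0 (ltW eps0).
  by apply: mulr_ge0; [rewrite invr_ge0; have := h0; lra|rewrite le_max lexx].
apply: le_trans (card_words_le m uv) _.
rewrite max_r ?subr_ge0// [in leRHS]mulrDl addrC [_^-1 * _]mulrC lerD2l.
by rewrite -ler_pdivrMr// mul1r.
Qed.

Let th := h / b.

Let th01 : 0 < th < 1.
Proof.
have x1 := b1; have x2 := hb; have x3 := h0; apply/andP; split.
  by apply: divr_gt0 => //; lra.
by rewrite /th ltr_pdivrMr; lra.
Qed.

(** On either side of the hole the interval is shortened by [h], which for a length up to [b] is at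
    least the fraction [th = h / b]. *)
Let density_split a u v j : 0 <= a -> density a -> 0 <= u -> v <= b -> (0 < j <= M)%N ->
  u < c j < v -> forall eps, 0 < eps -> exists m0, forall m, (m0 <= m)%N ->
    #|W m u v|%:R <= ((1 - th) * a * (v - u) + eps) * q ^+ m.
Proof.
move=> a0 Pa u0 vb /andP[j0 jM] /andP[uc cv] eps eps0.
have eps2 : 0 < eps / 2 by rewrite divr_gt0.
have /andP[th0 th1] := th01; have hh := h0; have bb := b1.
have [m1 hm1] : exists m0, forall m, (m0 <= m)%N ->
    #|W m u (c j - h)|%:R <= (a * Num.max 0 (c j - h - u) + eps / 2) * q ^+ m.
  by apply: Pa => //; lra.
have [m2 hm2] : exists m0, forall m, (m0 <= m)%N ->
    #|W m (c j + h) v|%:R <= (a * Num.max 0 (v - (c j + h)) + eps / 2) * q ^+ m.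
  by apply: Pa => //; lra.
exists (maxn m1 m2) => m; rewrite geq_max => /andP[/hm1 l1 /hm2 l2].
have sub : W m u v \subset W m u (c j - h) :|: W m (c j + h) v.
  apply/fintype.subsetP => w hw; rewrite !inE.
  move: hw; rewrite inE => /asboolP[d [ad /andP[d1 d2] dw]].
  apply/orP; have [l|l] := ltnP (d 0%N) j; [left|right]; apply/asboolP; exists d; split=> //.
    by rewrite d1 hole_lt.
  by rewrite d2 hole_ge.
have card : (#|W m u v| <= #|W m u (c j - h)| + #|W m (c j + h) v|)%N.
  by apply: leq_trans (subset_leq_card sub) (leq_card_setU _ _).
have := card; rewrite -(ler_nat R) natrD => /le_trans; apply.
apply: le_trans (lerD l1 l2) _; rewrite -mulrDl ler_pM2r ?exprn_gt0//.
have max_le x : 0 < x <= b -> Num.max 0 (x - h) <= (1 - th) * x.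
  move=> /andP[x0 xb]; have thx : th * x <= h by rewrite /th mulrAC ler_pdivrMr; nra.
  by rewrite ge_max; apply/andP; split; nra.
have M1 : Num.max 0 (c j - h - u) <= (1 - th) * (c j - u).
  have -> : c j - h - u = (c j - u) - h by ring.
  by apply: max_le; lra.
have M2 : Num.max 0 (v - (c j + h)) <= (1 - th) * (v - c j).
  have -> : v - (c j + h) = (v - c j) - h by ring.
  by apply: max_le; lra.
have := ler_wpM2l a0 M1; have := ler_wpM2l a0 M2; nra.
Qed.

Let c_step j : (0 < j)%N -> j%:R <= q * c j <= (j%:R - 1) + b.
Proof.
move=> j0; have -> : q * c j = (2 * j%:R - 1 + b) / 2 by rewrite /c; field; rewrite gt_eqF.
by have := b1; lra.
Qed.

(** With no hole centre inside, all sequences with value in the interval share their first digit,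
    and dropping it stretches the interval by [q] within [[0, b]]. *)
Let W_step m u v d : 0 <= u -> v <= b -> au d -> u <= val q d <= v ->
  (forall j, (0 < j <= M)%N -> ~ u < c j < v) ->
  [/\ 0 <= q * u - (d 0)%:R, q * v - (d 0)%:R <= b &
    (#|W m.+1 u v| <= #|W m (q * u - (d 0)%:R) (q * v - (d 0)%:R)|)%N].
Proof.
move=> u0 vb ad /andP[du dv] nc; set j := d 0; have jM := digit_leM j.
have lo i : (0 < i <= j)%N -> c i <= u.
  move=> /andP[i0 ij]; rewrite leNgt; apply/negP => ui.
  apply: (nc i); first by rewrite i0 (leq_trans ij).
  by rewrite ui; have := hole_ge ad i0 ij; have := h0; lra.
have up i : (j < i <= M)%N -> v <= c i.
  move=> /andP[ji iM]; rewrite leNgt; apply/negP => ui.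
  apply: (nc i); first by rewrite iM (leq_ltn_trans _ ji).
  by rewrite ui andbT; have := hole_lt ad ji iM; have := h0; lra.
have bE : q * b = M%:R + b.
  by have := vmaxE (M := M) q1; rewrite -/b => {1}<-; field; rewrite gt_eqF.
split.
- have [j0|j0] := posnP j; first by rewrite j0 subr0 mulr_ge0// ltW.
  have jj : (0 < j <= j)%N by rewrite j0 leqnn.
  have /andP[c1 _] := c_step j0; have := lo _ jj.
  by rewrite -(ler_pM2l q0) subr_ge0; exact: le_trans.
- have [jM'|jM'] := ltnP j M; last first.
    have -> : (j : nat) = M by apply/eqP; rewrite eqn_leq jM jM'.
    by rewrite lerBlDl -bE ler_pM2l.
  have jj : (j < j.+1 <= M)%N by rewrite ltnS leqnn.
  have /andP[_ c2] := c_step (ltn0Sn j); have := up _ jj.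
  rewrite -(ler_pM2l q0) lerBlDl => /le_trans; apply; apply: le_trans c2 _.
  by rewrite -natr1; lra.
- set U := q * u - _; set V := q * v - _.
  have sub : W m.+1 u v \subset [set [tuple of j :: w] | w : m.-tuple 'I_M.+1 in W m U V]%SET.
    apply/fintype.subsetP => w; rewrite inE => /asboolP[s [as_ /andP[su sv] <-]].
    have s0 : s 0%N = j.
      apply: val_inj => /=; apply/eqP; rewrite eqn_leq; apply/andP; split.
        rewrite leqNgt; apply/negP => js.
        have sM : (s 0 <= M)%N := digit_leM _.
        have := up (s 0%N); rewrite js sM => /(_ isT).
        by have := hole_ge as_ (leq_ltn_trans (leq0n j) js) (leqnn _); have := h0; lra.
      rewrite leqNgt; apply/negP => js.
      have := lo j; rewrite leqnn (leq_ltn_trans (leq0n (s 0%N)) js) => /(_ isT).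
      by have := hole_lt as_ js jM; have := h0; lra.
    rewrite prefix_of_cons s0; apply/imsetP; exists (prefix_of m (shift 1 s)) => //.
    rewrite inE; apply/asboolP; exists (shift 1 s); split=> //; first exact: au_shift.
    have E : val q (shift 1 s) = q * val q s - j%:R.
      by rewrite (val_rec s q1) s0; field; rewrite gt_eqF.
    by rewrite E !lerD2r !ler_pM2l// su sv.
  by apply: leq_trans (subset_leq_card sub) (leq_imset_card _ _).
Qed.

(** Stretching by [q] within [[0, b]] must stop, so after finitely many steps the interval contains
    a hole centre and [density_split] applies. *)
Let density_step a : 0 <= a -> density a -> density ((1 - th) * a).
Proof.
move=> a0 Pa u v u0 vb eps eps0.
have /andP[th0 th1] := th01.
have [uv|vu|uv] := ltgtP u v; last 2 first.
- have [m0 hm] := Pa u v u0 vb eps eps0; exists m0 => m /hm.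
  by rewrite W_gt// max_l ?mulr0//; lra.
- have [m0 hm] := Pa u v u0 vb eps eps0; exists m0 => m /hm.
  by rewrite -uv subrr maxxx !mulr0.
rewrite max_r ?subr_ge0 ?ltW//.
have [k kb] : exists k, b <= q ^+ k * (v - u).
  have D : 0 < (v - u) by rewrite subr_gt0.
  have [N /(_ N (leqnn N)) /ltW hN] := expr_inv_small b q1 D.
  by exists N; rewrite mulrC -ler_pdivrMr ?exprn_gt0.
elim: k u v u0 vb uv kb eps eps0 => [|k IH] u v u0 vb uv kb eps eps0;
    have [[j [jM jc]]|nc] := pselect (exists j, (0 < j <= M)%N /\ u < c j < v);
    try exact: density_split jc _ eps0.
  (* The interval is now all of [[0, b]], which contains the centre of the first hole. *)
  exfalso; apply: nc; exists 1%N; split; first by rewrite M0.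
  rewrite expr0 mul1r in kb; have bb := b1; have qq := q1.
  have -> : u = 0 by lra. have -> : v = b by lra.
  rewrite /c divr_gt0 ?ltr_pdivrMr//=; try lra; nra.
have nc' j : (0 < j <= M)%N -> ~ u < c j < v by move=> jM jc; apply: nc; exists j.
have [[d [ad dv]]|nd] := pselect (exists d, au d /\ u <= val q d <= v); last first.
  exists 0%N => m _; have -> : W m u v = finset.set0.
    apply/setP => w; rewrite !inE; apply/asboolP => -[d [ad dv _]].
    by apply: nd; exists d.
  rewrite cards0 mulr_ge0 ?exprn_ge0 ?ltW// ltr_wpDl//.
  by apply: mulr_ge0; [apply: mulr_ge0 => //|]; lra.
have eq0 : 0 < q * eps by rewrite mulr_gt0.
have [U0 Vb _] := W_step 0 u0 vb ad dv nc'.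
have [||m0 hm] := IH _ _ U0 Vb _ _ (q * eps) eq0.
- by rewrite ltrD2r ltr_pM2l.
- apply: le_trans kb _; rewrite exprSr le_eqVlt; apply/orP; left; apply/eqP; ring.
exists m0.+1 => -[//|m]; rewrite ltnS => /hm lm.
have [_ _] := W_step m u0 vb ad dv nc'; rewrite -(ler_nat R) => /le_trans; apply.
apply: le_trans lm _; rewrite exprS le_eqVlt; apply/orP; left; apply/eqP; ring.
Qed.

(** Strict inequality at one length suffices: concatenating blocks of that length turns it into an
    exponential rate below [q]. *)
Lemma words_small : exists2 m, (0 < m)%N & #|words q e m 0 b|%:R < q ^+ m.
Proof.
have /andP[th0 th1] := th01; have hh := h0; have bb := b1.
have h2 : 0 <= (2 * h)^-1 by rewrite invr_ge0; lra.
have t0 : 0 < 1 - th by rewrite subr_gt0.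
have dn n : density ((1 - th) ^+ n * (2 * h)^-1).
  elim: n => [|n IH]; first by rewrite expr0 mul1r; exact: density_init.
  by rewrite exprS -mulrA; apply: density_step => //; rewrite mulr_ge0// exprn_ge0// ltW.
have i1 : 1 < (1 - th)^-1 by rewrite invf_gt1//; lra.
have [N /(_ N (leqnn N)) hN] := expr_inv_small ((2 * h)^-1 * b) i1 (ltac:(lra) : 0 < 1/4 :> R).
have [m0 hm] := dn N 0 b (lexx 0) (lexx b) (1/4) (ltac:(lra) : 0 < 1/4 :> R).
exists m0.+1 => //; apply: le_lt_trans (hm m0.+1 (leqnSn _)) _.
rewrite subr0 max_r ?(le_trans ler01 (ltW bb))//.
rewrite -[ltRHS]mul1r ltr_pM2r ?exprn_gt0//.
move: hN; rewrite exprVn invrK => hN.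
have -> : (1 - th) ^+ N / (2 * h) * b = (2 * h)^-1 * b * (1 - th) ^+ N by ring.
lra.
Qed.

End Counting.

(** * Covers, measure and dimension *)

Section FiniteCovers.
Context {R : realType}.
Implicit Types (E : set R) (s : R) (l : seq (R * R)).

(** One notion of cover for both purposes: exponent 1 gives Lebesgue null sets, any [s] bounds the
    Hausdorff dimension. *)
Definition fin_null s E := forall eps, 0 < eps -> exists l : seq (R * R),
  [/\ E `<=` [set y | exists2 ab, ab \in l & ab.1 <= y <= ab.2],
      forall ab, ab \in l -> ab.1 <= ab.2 <= ab.1 + eps &
      \sum_(ab <- l) (ab.2 - ab.1) `^ s <= eps].

Lemma fin_null_sub s E F : E `<=` F -> fin_null s F -> fin_null s E.
Proof.
by move=> EF h eps /h[l [a b c]]; exists l; split => //; exact: subset_trans EF a.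
Qed.

Lemma fin_nullU s E F : fin_null s E -> fin_null s F -> fin_null s (E `|` F).
Proof.
move=> hE hF eps e0; have e2 : 0 < eps / 2 by rewrite divr_gt0.
have [l1 [a1 b1 c1]] := hE _ e2; have [l2 [a2 b2 c2]] := hF _ e2.
exists (l1 ++ l2); split.
- move=> y [/a1[ab h ?]|/a2[ab h ?]]; exists ab => //; rewrite mem_cat h ?orbT//.
- by move=> ab; rewrite mem_cat => /orP[/b1|/b2]; lra.
- by rewrite big_cat /=; lra.
Qed.

Lemma fin_null1 s (x : R) : 0 < s -> fin_null s [set x].
Proof.
move=> s0 eps e0; exists [:: (x, x)]; split.
- by move=> y /= ->; exists (x, x); rewrite ?mem_seq1//= lexx.
- by move=> ab; rewrite mem_seq1 => /eqP -> /=; lra.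
- by rewrite big_seq1 /= subrr powR0 ?gt_eqF// ltW.
Qed.

Let cover_fun l (i : nat) : set R :=
  if (i < size l)%N then `[(nth (0, 0) l i).1, (nth (0, 0) l i).2]%classic else set0.

Let cover_fun_sub l E : E `<=` [set y | exists2 ab, ab \in l & ab.1 <= y <= ab.2] ->
  E `<=` \bigcup_i cover_fun l i.
Proof.
move=> h y /h[ab abl yab]; exists (index ab l) => //.
by rewrite /cover_fun index_mem abl nth_index//= in_itv.
Qed.

Let cover_fun_sum l (g : set R -> \bar R) : g set0 = 0%E -> (forall A, (0 <= g A)%E) ->
  (\sum_(0 <= i <oo) g (cover_fun l i) =
   \sum_(ab <- l) g `[ab.1, ab.2]%classic)%E.
Proof.
move=> g0 gp; rewrite (nneseries_split 0 (size l))//.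
rewrite add0n eseries0 ?adde0; last first.
  by move=> i li _; rewrite /cover_fun ltnNge li.
rewrite (big_nth (0, 0)); apply: eq_big_nat => i /andP[_ il].
by rewrite /cover_fun il.
Qed.

Lemma diameter_itv (a b : R) : a <= b -> diameter `[a, b]%classic = (b - a)%:E.
Proof.
move=> ab; apply/eqP; rewrite eq_le; apply/andP; split.
  apply: ge_ereal_sup => _ [[u v] /= [+ +] <-].
  rewrite /= !in_itv /= => /andP[u1 u2] /andP[v1 v2].
  by rewrite lee_fin ler_norml; lra.
apply: ereal_sup_ubound; exists (b, a) => /=.
  by split; rewrite /= in_itv /= lexx ab.
by rewrite ger0_norm// subr_ge0.
Qed.

Lemma diameter_pow_itv s (a b : R) : a <= b ->
  diameter_pow s `[a, b]%classic = ((b - a) `^ s)%:E.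
Proof.
move=> ab; rewrite /diameter_pow diameter_itv// poweR_EFin ifF//.
by apply/eqP/eqP/set0P; exists a; rewrite /= in_itv /= lexx.
Qed.

Lemma diameter_pow_ge0 s E : (0 <= diameter_pow s E)%E.
Proof. by rewrite /diameter_pow; case: ifP => // _; exact: poweR_ge0. Qed.

Lemma diameter_pow0 s : diameter_pow s (set0 : set R) = 0%E.
Proof. by rewrite /diameter_pow eqxx. Qed.

Lemma hausdorff_premeasure_ge0 s delta E : (0 <= hausdorff_premeasure s delta E)%E.
Proof.
apply: le_ereal_inf_tmp => _ [F _ <-]; apply: nneseries_ge0 => i _ _.
exact: diameter_pow_ge0.
Qed.

Lemma hausdorff_measure_ge0 s E : (0 <= hausdorff_measure s E)%E.
Proof.
apply: le_trans (hausdorff_premeasure_ge0 s 1 E) _.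
by apply: ereal_sup_ubound; exists 1 => /=.
Qed.

Lemma fin_null_hausdorff s E : fin_null s E -> hausdorff_measure s E = 0%E.
Proof.
move=> h; apply/eqP; rewrite eq_le hausdorff_measure_ge0 andbT.
apply: ge_ereal_sup => _ [delta /= d0 <-].
apply/lee_addgt0Pr => eps e0; rewrite add0e.
have m0 : 0 < Num.min delta eps by rewrite lt_min d0.
have [l [a b c]] := h _ m0.
have min1 : Num.min delta eps <= delta by rewrite ge_min lexx.
have min2 : Num.min delta eps <= eps by rewrite ge_min lexx orbT.
apply: le_trans (_ : (\sum_(0 <= i <oo) diameter_pow s (cover_fun l i) <= _)%E).
  apply: ereal_inf_lbound; exists (cover_fun l) => //; split.
    exact: cover_fun_sub.
  move=> i; rewrite /cover_fun; case: ifPn => il.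
    have /andP[h1 h2] := b _ (mem_nth (0, 0) il).
    by rewrite diameter_itv// lee_fin; lra.
  apply: ge_ereal_sup => _ [[u v] /= [[]]].
rewrite cover_fun_sum; [|exact: diameter_pow0|exact: diameter_pow_ge0].
rewrite big_seq_cond (eq_bigr (fun ab => ((ab.2 - ab.1) `^ s)%:E)); last first.
  by move=> ab /andP[/b/andP[ab1 _] _]; rewrite diameter_pow_itv.
by rewrite -big_seq_cond sumEFin lee_fin; lra.
Qed.

Lemma fin_null_dim s E : 0 <= s -> fin_null s E -> (hausdorff_dim E <= s%:E)%E.
Proof.
by move=> s0 h; apply: ereal_inf_lbound; exists s => //; split => //; exact: fin_null_hausdorff.
Qed.

Lemma hausdorff_dim_ge s E : (forall t, 0 <= t -> hausdorff_measure t E = 0%E -> s <= t) ->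
  (s%:E <= hausdorff_dim E)%E.
Proof.
move=> h; apply: le_ereal_inf_tmp => _ [t [t0 Ht] <-].
by rewrite lee_fin; exact: h.
Qed.

Lemma lebesgue_measure_cc (a b : R) : a <= b ->
  lebesgue_measure (`[a, b]%classic : set R) = (b - a)%:E.
Proof.
rewrite lebesgue_measure_itv /= lte_fin; case: ltgtP => // -> _.
by rewrite subrr.
Qed.

Lemma fin_null_negligible E : fin_null 1 E -> (@lebesgue_measure R).-negligible E.
Proof.
move=> h; have /choice[L hL] : forall n : nat, exists l : seq (R * R),
    [/\ E `<=` [set y | exists2 ab, ab \in l & ab.1 <= y <= ab.2],
      forall ab, ab \in l -> ab.1 <= ab.2 <= ab.1 + n.+1%:R^-1 &
      \sum_(ab <- l) (ab.2 - ab.1) `^ 1 <= n.+1%:R^-1].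
  by move=> n; apply: h; rewrite invr_gt0.
have mc n i : measurable (cover_fun (L n) i).
  by rewrite /cover_fun; case: ifP => _ //; exact: measurable_itv.
pose B n := \bigcup_i cover_fun (L n) i.
have mB n : measurable (B n) by apply: bigcupT_measurable.
exists (\bigcap_n B n); split; first exact: bigcapT_measurable.
  apply/eqP; rewrite eq_le measure_ge0 andbT.
  apply/lee_addgt0Pr => eps e0; rewrite add0e.
  have [n hn] : exists n : nat, n.+1%:R^-1 <= eps.
    exists (Num.truncn eps^-1); rewrite -[leRHS]invrK lef_pV2 ?posrE ?invr_gt0//.
    exact/ltW/truncnS_gt.
  apply: le_trans (_ : (lebesgue_measure (B n) <= _)%E).
    have mBn : measurable (\bigcap_n B n) by exact: bigcapT_measurable.
    apply: (@le_measure _ _ _ (@lebesgue_measure R) _ _ (mem_set mBn) (mem_set (mB n))).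
    exact: bigcap_inf.
  apply: le_trans
    (measure_sigma_subadditive (@lebesgue_measure R) (mc n) (mB n) (fun y By => By)) _.
  rewrite cover_fun_sum; [|exact: measure0|by move=> A; exact: measure_ge0].
  have [_ b c] := hL n.
  rewrite big_seq_cond (eq_bigr (fun ab => ((ab.2 - ab.1) `^ 1)%:E)); last first.
    move=> ab /andP[/b/andP[ab1 _] _]; rewrite powRr1 ?subr_ge0//.
    exact: lebesgue_measure_cc.
  by rewrite -big_seq_cond sumEFin lee_fin; apply: le_trans c hn.
by move=> y Ey n _; apply: cover_fun_sub Ey; have [] := hL n.
Qed.

(* [s -> [0, 1]] surjective and [t]-Hoelder: the [t]-dimensional measure is positive because
   Lebesgue measure is countably subadditive. *)
Lemma hausdorff_measure_holder t (E : set R) (g : R -> R) (C : R) : 0 <= t -> 0 < C ->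
  (forall y y', E y -> E y' -> `|g y - g y'| <= C * `|y - y'| `^ t) ->
  `[0, 1]%classic `<=` g @` E -> hausdorff_measure t E <> 0%E.
Proof.
move=> t0 C0 hg surj H0.
have P0 : (hausdorff_premeasure t 1 E <= 0)%E.
  by rewrite -H0; apply: ereal_sup_ubound; exists 1 => /=.
have iC : 0 < C^-1 by rewrite invr_gt0.
have : (hausdorff_premeasure t 1 E < (C^-1)%:E)%E by apply: le_lt_trans P0 _; rewrite lte_fin.
move/ereal_inf_lt => [_ [F [cF dF] <-]] lt.
have /choice[I hI] : forall i, exists I : R * R, [/\ I.1 <= I.2,
    ((I.2 - I.1)%:E <= C%:E * diameter_pow t (F i))%E &
    forall y, F i y -> E y -> I.1 <= g y <= I.2].
  move=> i; have [[y0 [Fy0 Ey0]]|/forallNP ne] := pselect (exists y, F i y /\ E y); last first.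
    exists (0, 0); split=> //=; first by rewrite subrr; apply: mule_ge0; [rewrite lee_fin ltW|exact: diameter_pow_ge0].
    by move=> y Fy Ey; case: (ne y).
  have dge y y' : F i y -> F i y' -> (`|y - y'|%:E <= diameter (F i))%E.
    by move=> Fy Fy'; apply: ereal_sup_ubound; exists (y, y').
  have Fn0 : F i != set0 by apply/set0P; exists y0.
  have := dF i; have := dge _ _ Fy0 Fy0; rewrite subrr normr0.
  case dE : (diameter (F i)) => [D| |] //; rewrite !lee_fin => D0 D1.
  have dpow : diameter_pow t (F i) = (D `^ t)%:E.
    by rewrite /diameter_pow (negbTE Fn0) dE poweR_EFin.
  have gD y y' : F i y -> E y -> F i y' -> E y' -> `|g y - g y'| <= C * D `^ t.
    move=> Fy Ey Fy' Ey'; apply: le_trans (hg _ _ Ey Ey') _.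
    rewrite ler_pM2l//; apply: ge0_ler_powR; rewrite ?nnegrE//.
    by have := dge _ _ Fy Fy'; rewrite dE lee_fin.
  pose S := g @` (F i `&` E).
  have S0 : S !=set0 by exists (g y0); exists y0.
  have lbS : has_lbound S.
    exists (g y0 - C * D `^ t) => _ [y [Fy Ey] <-].
    by have := gD _ _ Fy Ey Fy0 Ey0; rewrite ler_norml; lra.
  (* The image of [F i] is enclosed in an interval, hence in a measurable set, of length [C] times
     the [t]-th power of the diameter. *)
  exists (inf S, inf S + C * D `^ t); split=> /=.
  - by rewrite lerDl mulr_ge0 ?powR_ge0// ltW.
  - by rewrite addrAC subrr add0r dpow -EFinM.
  - move=> y Fy Ey; rewrite ge_inf//=; last by exists y.
    rewrite -lerBlDr; apply: lb_le_inf => // _ [y' [Fy' Ey'] <-].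
    by have := gD _ _ Fy Ey Fy' Ey'; rewrite ler_norml; lra.
have cov : `[0, 1]%classic `<=` \bigcup_i `[(I i).1, (I i).2]%classic.
  move=> z /surj[y Ey <-]; have [i _ Fy] := cF _ Ey.
  by exists i => //=; rewrite in_itv /=; have [_ _] := hI i; exact.
have : (1%:E <= \sum_(0 <= i <oo) lebesgue_measure (`[(I i).1, (I i).2]%classic : set R))%E.
  rewrite -[1%R](subr0 1) -(lebesgue_measure_cc ler01).
  by apply: (measure_sigma_subadditive (@lebesgue_measure R) _ _ cov) => *; exact: measurable_itv.
apply/negP; rewrite -ltNge.
apply: le_lt_trans (_ : (\sum_(0 <= i <oo) (C%:E * diameter_pow t (F i)) < 1)%E).
  apply: lee_nneseries => [i _ _|i _]; first exact: measure_ge0.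
  by have [I1 I2 _] := hI i; rewrite lebesgue_measure_cc.
rewrite nneseriesZl; last by move=> i _; exact: diameter_pow_ge0.
move: lt; set Sg := (\sum_(_ <= _ <oo) _)%E => lt.
have S0 : (0 <= Sg)%E by apply: nneseries_ge0 => i _ _; exact: diameter_pow_ge0.
move: lt S0; case: Sg => [r| |] //; rewrite lte_fin lee_fin => lt r0.
by rewrite -EFinM lte_fin -ltr_pdivlMl// mulr1.
Qed.

(** Asking for all [s >= s0] makes finite unions immediate and includes [s = 1]; having [s0 < 1]
    keeps the dimension below 1. *)
Definition small E := exists s0 : R, [/\ 0 < s0, s0 < 1 & forall s, s0 <= s -> fin_null s E].

Lemma small_sub E F : E `<=` F -> small F -> small E.
Proof.
by move=> EF [s0 [a b h]]; exists s0; split => // s /h; exact: fin_null_sub.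
Qed.

Lemma smallU E F : small E -> small F -> small (E `|` F).
Proof.
move=> [s [s0 s1 hs]] [t [t0 t1 ht]]; exists (Num.max s t); split.
- by rewrite lt_max s0.
- by rewrite gt_max s1 t1.
- by move=> u; rewrite ge_max => /andP[/hs h1 /ht h2]; exact: fin_nullU.
Qed.

Lemma small1 (x : R) : small [set x].
Proof.
exists (1/2); split; [lra|lra|] => s hs; apply: fin_null1; lra.
Qed.

Lemma small_compact E (a b : R) : 
  (forall q, a <= q <= b -> exists p1 p2, [/\ p1 < q, q < p2 & small (E `&` `[p1, p2]%classic)]) ->
  small (E `&` `[a, b]%classic).
Proof.
move=> h; have [ab|ba] := leP a b; last first.
  by apply: small_sub (small1 0) => y [_]; rewrite /= in_itv /= => /andP[]; lra.
have /choice[f hf] : forall q, exists p : R * R, a <= q <= b ->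
    [/\ p.1 < q, q < p.2 & small (E `&` `[p.1, p.2]%classic)].
  move=> q; have [qab|_] := boolP (a <= q <= b); last by exists (0, 0).
  by have [p1 [p2 hp]] := h q qab; exists (p1, p2).
have := @segment_compact R a b; rewrite compact_cover.
move=> /(_ R `[a, b]%classic (fun q => `](f q).1, (f q).2[%classic)).
case=> [q _|q qab|D sD cD]; first exact: interval_open.
  exists q => //=; rewrite in_itv /=.
  by rewrite /= in_itv /= in qab; have [-> ->] := hf q qab.
apply: (@small_sub _ (\bigcup_(q in [set q | q \in (finmap.enum_fset D)])
    (E `&` `[(f q).1, (f q).2]%classic))).
  move=> y [Ey /cD[q qD]]; rewrite /= in_itv /= => /andP[y1 y2].
  by exists q => //; split => //=; rewrite in_itv /= !ltW.
have : {subset finmap.enum_fset D <= `[a, b]%classic} by move=> q /sD.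
elim: (finmap.enum_fset D) => [|q l IH] sl.
  by apply: small_sub (small1 0) => y [q]; rewrite /= in_nil.
have qab := sl q (mem_head _ _); rewrite inE /= in_itv /= in qab.
have [_ _ sq] := hf q qab.
apply: small_sub (smallU sq (IH _)); last by move=> z zl; apply: sl; rewrite inE zl orbT.
move=> y [z] /=; rewrite inE => /orP[/eqP ->|zl] hy; first by left.
by right; exists z.
Qed.

End FiniteCovers.

(** * Covers of univoque bases *)

Section LocalCover.
Context {R : realType} {M : nat}.
Implicit Types (p q x y : R) (d s : nat -> 'I_M.+1).

Lemma psum_drop d n i y z : 1 < y -> y <= z -> (i < n)%N -> (0 < d i)%N ->
  (z - y) * z ^- i.+2 <= psum y d n - psum z d n.
Proof.
move=> y1 yz i_n di.
have y0 : 0 < y by lra.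
have z0 : 0 < z by lra.
have mono j : z ^- j <= y ^- j.
  rewrite lef_pV2 ?posrE ?exprn_gt0//; apply: lerXn2r => //; rewrite nnegrE; lra.
have nonneg m : psum z d m <= psum y d m.
  by apply: ler_sum => j _; apply: ler_wpM2l.
elim: n i_n => // n IH; rewrite ltnS leq_eqVlt => /orP[/eqP e|/IH h].
  rewrite !psumS -e; have := nonneg i.
  have d1 : 1 <= (d i)%:R :> R by rewrite ler1n.
  have key : (z - y) * z ^- i.+2 <= y ^- i.+1 - z ^- i.+1.
    have -> : (z - y) * z ^- i.+2 = z ^- i.+1 * ((z - y) / z).
      by rewrite [z ^+ i.+2]exprS invfM; ring.
    have -> : y ^- i.+1 - z ^- i.+1 = y ^- i * (y^-1) - z ^- i / z.
      by rewrite !exprSr !invfM.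
    apply: le_trans (_ : y ^- i * (y^-1 - z^-1) <= _); last first.
      by rewrite mulrBr lerB// ler_wpM2r ?mono// invr_ge0 ltW.
    have -> : y^-1 - z^-1 = (z - y) / (y * z) by field; rewrite !gt_eqF.
    have := mono i.+1; rewrite [y ^+ i.+1]exprSr invfM => hm.
    have -> : y ^- i * ((z - y) / (y * z)) = (y ^- i / y) * ((z - y) / z).
      by rewrite invfM; ring.
    by apply: ler_wpM2r => //; rewrite divr_ge0 ?subr_ge0// ltW.
  have : 0 <= (z - y) * z ^- i.+2 by rewrite mulr_ge0 ?subr_ge0// invr_ge0 exprn_ge0// ltW.
  nra.
rewrite !psumS; have := ler_wpM2l (ler0n R (d n)) (mono n.+1); lra.
Qed.

(** Both bases give [x] from the same [n] digits, so the partial sum drops between them by at most a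
    remainder of order [p ^- n]. The choice of [N0] forces an early nonzero digit, which bounds the
    drop from below. *)
Lemma prefix_dist p x d s n N0 y z : 1 < p -> 0 < x -> vmax (M := M) p * p ^- N0 < x ->
  (N0 <= n)%N -> p <= y -> y <= z -> z <= M.+1%:R -> val y d = x -> val z s = x ->
  (forall i, (i < n)%N -> d i = s i) ->
  z - y <= vmax (M := M) p * M.+1%:R ^+ N0.+1 * p ^- n.
Proof.
move=> p1 x0 hN Nn py yz zM dx sx ds.
have y1 : 1 < y by lra.
have z1 : 1 < z by lra.
have p0 : 0 < p by lra.
have [i iN di] : exists2 i, (i < N0)%N & (0 < d i)%N.
  apply: contrapT => nex.
  have d0 i : (i < N0)%N -> d i = 0 :> nat.
    by move=> iN; apply/eqP; rewrite -leqn0 leqNgt; apply/negP => h; apply: nex; exists i.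
  have := val_split d N0 y1; rewrite dx.
  have -> : psum y d N0 = 0 by rewrite /psum big1// => i _; rewrite d0// mul0r.
  rewrite add0r => e; have := hN; rewrite e; apply/negP; rewrite -leNgt mulrC.
  apply: ler_pM; rewrite ?val_ge0 ?invr_ge0 ?exprn_ge0//; try lra.
    exact: le_trans (val_mono_le _ p1 py) (val_le _ p1).
  by rewrite lef_pV2 ?posrE ?exprn_gt0//; [apply: lerXn2r => //; rewrite ?nnegrE|]; lra.
have drop := psum_drop y1 yz (leq_trans iN Nn) di.
have up : psum y d n <= x by rewrite -dx psum_le_val.
have lo : x - p ^- n * vmax (M := M) p <= psum z d n.
  have := val_split s n z1; rewrite sx (psum_eq z ds) => e.
  rewrite lerBlDr {1}e lerD2l; apply: ler_pM; rewrite ?val_ge0 ?invr_ge0 ?exprn_ge0//; try lra.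
    by rewrite lef_pV2 ?posrE ?exprn_gt0//; [apply: lerXn2r => //; rewrite ?nnegrE|]; lra.
  by apply: le_trans (val_mono_le _ p1 _) (val_le _ p1); lra.
have z0 : 0 < z by lra.
have : (z - y) * z ^- i.+2 <= p ^- n * vmax (M := M) p by lra.
rewrite ler_pdivrMr ?exprn_gt0// => /le_trans; apply.
rewrite [p ^- n * _]mulrC mulrAC; apply: ler_wpM2r; first by rewrite invr_ge0 exprn_ge0// ltW.
apply: ler_wpM2l; first exact: vmax_ge0.
apply: le_trans (_ : M.+1%:R ^+ i.+2 <= _).
  by apply: lerXn2r => //; rewrite nnegrE ltW.
by rewrite ler_weXn2l// ler1n.
Qed.

Lemma powR_exprn (a s : R) k : 0 <= a -> (a ^+ k) `^ s = (a `^ s) ^+ k.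
Proof.
by move=> a0; rewrite -powR_mulrn// -powRrM mulrC powRrM powR_mulrn// powR_ge0.
Qed.

Lemma univ_word_bound q : (0 < M)%N -> 1 < q -> q < M.+1%:R ->
  exists p r m, exists W : {set m.-tuple 'I_M.+1},
  [/\ 1 < p < q, q < r <= M.+1%:R, (0 < m)%N, #|W|%:R < p ^+ m &
    forall y d n, 1 < y <= r -> univ y d -> prefix_of m (shift n d) \in W].
Proof.
move=> M0 q1 qM; have [m m0 hA] := words_small M0 q1 qM.
set e := (vmax q - 1) / 4 in hA; set W := words q e m 0 (vmax q) in hA.
move: hA; set A : R := #|W|%:R => hA.
have q0 : 0 < q by lra.
have e0 : 0 < e.
  rewrite /e divr_gt0// subr_gt0 /vmax ltr_pdivlMr ?subr_gt0// mul1r.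
  by move: qM; rewrite -natr1; lra.
(* The growth rate per digit; any [p > 1] between it and [q] will do. *)
pose r := A `^ m%:R^-1.
have rE : r ^+ m = A.
  by rewrite -powR_mulrn ?powR_ge0// -powRrM mulVf ?powRr1// pnatr_eq0 -lt0n.
have rq : r < q.
  rewrite ltNge; apply/negP => qr; move: hA; rewrite -rE; apply/negP; rewrite -leNgt.
  by apply: lerXn2r => //; rewrite nnegrE; [exact: ltW|exact: powR_ge0].
have [p [rp p1 pq]] : exists p, [/\ r < p, 1 < p & p < q].
  have mx : Num.max r 1 < q by rewrite gt_max rq q1.
  have mx1 : 1 <= Num.max r 1 by rewrite le_max lexx orbT.
  have mxr : r <= Num.max r 1 by rewrite le_max lexx.
  by exists ((Num.max r 1 + q) / 2); split; lra.
have l0 := lip_ge0 (M := M) q1.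
pose z := Num.min M.+1%:R (q + e / (lip (M := M) q + 1)).
have qz : q < z by rewrite lt_min qM ltrDl divr_gt0//; lra.
have zM : z <= M.+1%:R by rewrite ge_min lexx.
have lipz : lip (M := M) q * (z - q) <= e.
  have h : z - q <= e / (lip (M := M) q + 1) by rewrite lerBlDl ge_min lexx orbT.
  apply: le_trans (_ : (lip (M := M) q + 1) * (z - q) <= _).
    by apply: ler_wpM2r; lra.
  by rewrite mulrC -ler_pdivlMr//; lra.
exists p, z, m, W; split=> //; rewrite ?p1 ?qz//.
  by rewrite -/A -rE ltr_pXn2r// nnegrE ?powR_ge0//; lra.
move=> y d n /andP[y1 yz] ud; rewrite inE; apply/asboolP; exists (shift n d).
split=> //; last by rewrite val_ge0 ?val_le.
apply: (univ_almost_univ q1 (ltW qz) lipz); apply: univ_shift.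
exact: univ_mono ud.
Qed.

(** There are at most [A ^+ k] cylinders of [m * k] digits, each of diameter at most [C / B ^+ k];
    the hypothesis on [A] makes the sum of the [s]-th powers tend to 0. *)
Lemma univoque_fin_null x p r (s : R) m (W : {set m.-tuple 'I_M.+1}) (A : R) :
  0 < x -> 1 < p -> p <= r -> r <= M.+1%:R -> 0 < s -> (0 < m)%N ->
  1 <= A -> #|W|%:R <= A -> A < (p ^+ m) `^ s ->
  (forall y d n, 1 < y <= r -> univ y d -> prefix_of m (shift n d) \in W) ->
  fin_null s (univoque_bases M x `&` `[p, r]%classic).
Proof.
move=> x0 p1 pr rM s0 m0 A1 WA; set B := p ^+ m => AB hW eps eps0.
have p0 : 0 < p by lra.
have B1 : 1 < B by rewrite exprn_egt1// -lt0n.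
have B0 : 0 < B by exact: exprn_gt0.
have [N0 /(_ N0 (leqnn N0)) hN0] := expr_inv_small (vmax (M := M) p) p1 x0.
pose C := vmax (M := M) p * M.+1%:R ^+ N0.+1.
have C0 : 0 <= C by rewrite mulr_ge0 ?vmax_ge0// exprn_ge0.
have rat : 1 < B `^ s / A by rewrite ltr_pdivlMr ?mul1r//; lra.
have [k [kN0 hk1 hk2]] : exists k, [/\ (N0 <= m * k)%N, 2 * C / B ^+ k < eps &
    (2 * C) `^ s / (B `^ s / A) ^+ k < eps].
  have [N1 hN1] := expr_inv_small (2 * C) B1 eps0.
  have [N2 hN2] := expr_inv_small ((2 * C) `^ s) rat eps0.
  exists (maxn N0 (maxn N1 N2)); split.
  - exact: leq_trans (leq_maxl _ _) (leq_pmull _ m0).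
  - by apply: hN1; exact: leq_trans (leq_maxl _ _) (leq_maxr _ _).
  - by apply: hN2; exact: leq_trans (leq_maxr _ _) (leq_maxr _ _).
pose rad := C / B ^+ k.
have rad0 : 0 <= rad by rewrite divr_ge0// exprn_ge0// ltW.
pose cyl (tau : {ffun 'I_k -> m.-tuple 'I_M.+1}) : set R := [set y |
  (univoque_bases M x `&` `[p, r]%classic) y /\
  exists d, [/\ val y d = x & forall i : 'I_k, prefix_of m (shift (i * m) d) = tau i]].
pose T := enum (@ffun_on 'I_k W).
have cylE tau y z : cyl tau y -> cyl tau z -> y <= z -> z - y <= rad.
  move=> [[_ yI] [d [dx dt]]] [[_ zI] [u [ux ut]]] yz.
  move: yI zI; rewrite /= !in_itv /= => /andP[py _] /andP[_ zr].
  rewrite /rad /B -exprM.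
  apply: (prefix_dist p1 x0 hN0 kN0 py yz (le_trans zr rM) dx ux).
  move=> i ik; have ikm : (i %/ m < k)%N by rewrite ltn_divLR// mulnC.
  have := dt (Ordinal ikm); rewrite -(ut (Ordinal ikm)) /= => /prefix_ofE /(_ (i %% m)%N).
  by rewrite ltn_mod m0 /shift -divn_eq; exact.
(* [get] returns a point of the cylinder, and an arbitrary number if it is empty; radius [rad]
   around it covers the cylinder. *)
exists [seq (get (cyl tau) - rad, get (cyl tau) + rad) | tau <- T]; split.
- move=> y [Uy yI]; have := yI; rewrite /= in_itv /= => /andP[py yr].
  have y1 : 1 < y := lt_le_trans p1 py.
  have [d dx ud] := (univoqueP x y1 (le_trans yr rM)).1 Uy.
  pose tau : {ffun 'I_k -> m.-tuple 'I_M.+1} :=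
    [ffun i : 'I_k => prefix_of m (shift (i * m) d)].
  have cy : cyl tau y by split; [split|exists d; split=> // i; rewrite ffunE].
  have cg : cyl tau (get (cyl tau)) by apply: getPex; exists y.
  exists (get (cyl tau) - rad, get (cyl tau) + rad) => /=.
    apply/mapP; exists tau => //; rewrite /T mem_enum; apply/ffun_onP => i.
    by rewrite ffunE; apply: (hW y) => //; rewrite y1 yr.
  rewrite lerBlDr -[y <= _]lerBlDl.
  have [yz|zy] := leP y (get (cyl tau)).
    rewrite -lerBlDl (cylE _ _ _ cy cg yz) /=.
    by apply: le_trans rad0; rewrite subr_le0.
  rewrite (cylE _ _ _ cg cy (ltW zy)) andbT.
  by apply: le_trans (ltW zy) _; rewrite lerDl.
- move=> ab /mapP[tau _ ->] /=.
  have : 2 * rad <= eps by rewrite /rad mulrA ltW.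
  by clear -rad0; lra.
rewrite big_map.
have -> : \sum_(tau <- T) (get (cyl tau) + rad - (get (cyl tau) - rad)) `^ s =
    \sum_(tau <- T) (2 * rad) `^ s.
  by apply: eq_bigr => tau _; congr (_ `^ _); ring.
rewrite big_const_seq count_predT iter_addr_0.
have -> : size T = (#|W| ^ k)%N by rewrite /T -cardE card_ffun_on card_ord.
rewrite -[_ *+ (_ ^ _)]mulr_natr natrX.
have -> : (2 * rad) `^ s = (2 * C) `^ s / (B `^ s) ^+ k.
  rewrite /rad mulrA powRM; first last.
  - by rewrite invr_ge0 exprn_ge0// ltW.
  - by rewrite mulr_ge0.
  congr (_ * _); rewrite -powR_exprn ?ltW//.
  by rewrite -powR_inv1 ?exprn_ge0 ?ltW// powRAC powR_inv1// powR_ge0.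
apply: le_trans (ltW hk2); rewrite -mulrA; apply: ler_wpM2l; first exact: powR_ge0.
rewrite expr_div_n invf_div mulrC ler_pM2r ?invr_gt0 ?exprn_gt0 ?powR_gt0//.
by apply: lerXn2r => //; rewrite nnegrE// (le_trans ler01).
Qed.

Lemma univoque_locally_small x q : (0 < M)%N -> 0 < x -> 1 < q -> q < M.+1%:R ->
  exists p r, [/\ p < q, q < r & small (univoque_bases M x `&` `[p, r]%classic)].
Proof.
move=> M0 x0 q1 qM.
have [p [r [m [W [/andP[p1 pq] /andP[qr rM] m0 WB hW]]]]] := univ_word_bound M0 q1 qM.
exists p, r; split=> //.
pose A : R := Num.max #|W|%:R 1.
have B1 : 1 < p ^+ m by rewrite exprn_egt1// -lt0n.
have AB : A < p ^+ m by rewrite gt_max WB.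
have A1 : 1 <= A by rewrite le_max lexx orbT.
have lB : 0 < ln (p ^+ m) by exact: ln_gt0.
have lA : 0 <= ln A by exact: ln_ge0.
have lAB : ln A / ln (p ^+ m) < 1.
  by rewrite ltr_pdivrMr// mul1r ltr_ln ?posrE//; lra.
have lAB0 : 0 <= ln A / ln (p ^+ m) by rewrite divr_ge0// ltW.
exists ((ln A / ln (p ^+ m) + 1) / 2); split; [lra|lra|move=> s hs].
apply: (@univoque_fin_null x p r s m W A) => //; try lra.
  by rewrite le_max lexx.
rewrite -ltr_ln ?posrE ?powR_gt0//; try lra.
by rewrite ln_powR -ltr_pdivrMr//; lra.
Qed.

End LocalCover.

(** * Dimension from free concatenations *)

Lemma hausdorff_measure_le (R : realType) (t : R) (E F : set R) : E `<=` F ->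
  (hausdorff_measure t E <= hausdorff_measure t F)%E.
Proof.
move=> EF; apply: ge_ereal_sup => _ [delta d0 <-].
apply: le_trans (_ : hausdorff_premeasure t delta F <= _)%E; last first.
  by apply: ereal_sup_ubound; exists delta.
apply: le_ereal_inf_tmp => _ [G [cG dG] <-].
by apply: ereal_inf_lbound; exists G => //; split=> //; exact: subset_trans EF cG.
Qed.

Section DimensionLowerBound.
Context {R : realType} {M : nat}.
Implicit Types (p q x y : R) (d s : nat -> 'I_M.+1).
Variables (K n0 L : nat) (x p0 p : R) (D : (nat -> 'I_K.+1) -> nat -> 'I_M.+1).
Hypotheses (K0 : (0 < K)%N) (M0 : (0 < M)%N) (p01 : 1 < p0) (p0p : p0 < p).
Hypothesis base_exists : forall t, exists q,
  [/\ p <= q <= M.+1%:R, val q (D t) = x & univ q (D t)].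
Hypothesis tail_lt1 : forall t j, (n0 <= j)%N -> val p0 (shift j (D t)) < 1.
Hypothesis D_diff : forall t u m, (forall i, (i < m)%N -> t i = u i) -> t m <> u m ->
  (forall i, (i < n0 + m * L)%N -> D t i = D u i) /\
  exists2 i, (i < n0 + m.+1 * L)%N & D t i <> D u i.

Let E : set R := [set q | exists t, [/\ p <= q <= M.+1%:R, val q (D t) = x & univ q (D t)]].

Let p1 : 1 < p. Proof. by have := p01; have := p0p; lra. Qed.

(** Tails below 1 in base [p0] are at most [p0 / p] in bases from [p] on; dividing the margin by the
    Lipschitz constant turns a gap of values into a gap of bases. *)
Let c := (1 - p0 / p) / (lip (M := M) p + 1).

Let l0 : 0 <= lip (M := M) p. Proof. exact: lip_ge0 p1. Qed.

Let eta0 : 0 < 1 - p0 / p.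
Proof. by have h := p01; have h' := p0p; rewrite subr_gt0 ltr_pdivrMr; lra. Qed.

Let c0 : 0 < c.
Proof. by have h := l0; have := eta0 => h'; rewrite /c divr_gt0//; lra. Qed.

Let D_inj t u m : (forall i, (i < m)%N -> t i = u i) -> t m <> u m ->
  exists j, [/\ (n0 <= j)%N, (j < n0 + m.+1 * L)%N, forall i, (i < j)%N -> D t i = D u i
    & D t j != D u j].
Proof.
move=> e ne; have [h1 [i iL hi]] := D_diff e ne.
have /first_diff[j [ej nej]] : D t <> D u by move=> h; rewrite h in hi.
exists j; split=> //.
  rewrite leqNgt; apply/negP => jn.
  by move: nej; rewrite h1 ?eqxx// ltn_addr.
apply: leq_ltn_trans iL; rewrite leqNgt; apply/negP => /ej.
exact: hi.
Qed.

(** In the base of the lexicographically smaller sequence, the larger one exceeds [x] by the margin;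
    to be worth [x] it needs a base larger in proportion. *)
Let separated t u q r m : (forall i, (i < m)%N -> t i = u i) -> t m <> u m ->
  p <= q <= M.+1%:R -> p <= r <= M.+1%:R -> val q (D t) = x -> val r (D u) = x ->
  c * M.+1%:R ^- (n0 + m.+1 * L) <= `|q - r|.
Proof.
move=> e ne qI rI tx ux; have [j [nj jL ej nej]] := D_inj e ne.
have key (a b : R) t' u' : (forall i, (i < j)%N -> D t' i = D u' i) ->
    (D t' j < D u' j)%N -> p <= a <= M.+1%:R -> p <= b <= M.+1%:R ->
    val a (D t') = x -> val b (D u') = x ->
    c * M.+1%:R ^- (n0 + m.+1 * L) <= b - a.
  move=> e' lt /andP[pa aM] /andP[pb bM] ax bx.
  have hp := p1; have hp0 := p01; have hpp := p0p.
  have a1 : 1 < a by lra.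
  have hl := l0; have he := eta0.
  have tail : val a (shift j.+1 (D t')) <= p0 / p.
    apply: le_trans (val_mono _ p01 _) _; first by lra.
    have v0 := val_ge0 (shift j.+1 (D t')) p01.
    have v1 := tail_lt1 t' (leqW nj).
    have q1 : 0 <= p0 / a by apply: divr_ge0; lra.
    have q2 : p0 / a <= p0 / p by rewrite ler_pM2l ?lef_pV2 ?posrE; lra.
    nra.
  have gap : (1 - p0 / p) * M.+1%:R ^- (n0 + m.+1 * L) <= val a (D u') - x.
    rewrite -ax (@val_diff _ _ a (D u') (D t') j a1); last by move=> i ij; rewrite e'.
    rewrite mulrC; apply: ler_pM.
    - by rewrite invr_ge0 exprn_ge0.
    - lra.
    - rewrite lef_pV2 ?posrE ?exprn_gt0//; last by lra.
      apply: le_trans (_ : M.+1%:R ^+ j.+1 <= _).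
        by apply: lerXn2r => //; rewrite nnegrE; lra.
      by rewrite ler_weXn2l// ler1n.
    - have := natrB_ge1 (R := R) lt; have := val_ge0 (shift j.+1 (D u')) a1; lra.
  have M10 : 0 < M.+1%:R ^- (n0 + m.+1 * L) :> R by rewrite invr_gt0 exprn_gt0.
  have [ab|ba] := leP a b.
    have := val_lip (D u') p1 pa ab; rewrite bx => lp.
    rewrite /c mulrAC ler_pdivrMr; last lra.
    apply: le_trans gap _; apply: le_trans lp _; rewrite mulrC; nra.
  have := val_mono_le (D u') (ltac:(lra) : 1 < b) (ltW ba); rewrite bx => h.
  have : 0 < (1 - p0 / p) * M.+1%:R ^- (n0 + m.+1 * L) by apply: mulr_gt0.
  lra.
have [l|l|l] := ltngtP (D t j) (D u j).
- rewrite distrC; apply: le_trans (ler_norm _); exact: key l _ _ tx ux.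
- by apply: le_trans (ler_norm _); apply: key l _ _ ux tx => // i ij; rewrite ej.
- by move: nej; rewrite -val_eqE /= l eqxx.
Qed.

Let K1 : 1 < K.+1%:R :> R. Proof. by rewrite ltr1n. Qed.

Let vK : vmax (M := K) (K.+1%:R : R) = 1.
Proof. by rewrite /vmax -natr1 addrK divff// pnatr_eq0 -lt0n. Qed.

(** Read the code of a base in base [K.+1]. Codes that first differ at letter [m] have images within
    [K.+1%:R ^- m], and bases apart by at least a constant times [M.+1%:R ^- (m * L)]: a Hoelder
    condition of exponent [s]. *)
Lemma hausdorff_measure_gt0 (s : R) : 0 <= s -> (M.+1%:R ^+ L) `^ s <= K.+1%:R ->
  hausdorff_measure s (univoque_bases M x) <> 0%E.
Proof.
move=> s0 hs H0; have hp := p1.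
have EU : E `<=` univoque_bases M x.
  move=> q [t [/andP[pq qM] tx ut]]; apply/univoqueP => //; first lra.
  by exists (D t).
have : hausdorff_measure s E = 0%E.
  by apply/eqP; rewrite eq_le hausdorff_measure_ge0 -H0 hausdorff_measure_le.
have /choice[T hT] : forall q, exists t, E q ->
      [/\ p <= q <= M.+1%:R, val q (D t) = x & univ q (D t)].
  by move=> q; have [[t ht]|nE] := pselect (E q); [exists t|exists (fun=> ord0)].
pose g q : R := val K.+1%:R (T q).
have MM : 0 < M.+1%:R :> R by [].
pose C := (c^-1 * M.+1%:R ^+ (n0 + L)) `^ s.
have ic : 0 < c^-1 * M.+1%:R ^+ (n0 + L) by rewrite mulr_gt0 ?invr_gt0 ?exprn_gt0.
have C0 : 0 < C by rewrite powR_gt0.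
apply: (@hausdorff_measure_holder _ s E g C) => //.
  move=> q r Eq Er; have [qI tx _] := hT q Eq; have [rI ux _] := hT r Er.
  have [e|/first_diff[m [em /eqP nem]]] := pselect (T q = T r).
    by rewrite /g e subrr normr0 mulr_ge0 ?powR_ge0// ltW.
  have sep := separated em nem qI rI tx ux.
  have gm : `|g q - g r| <= K.+1%:R ^- m.
    rewrite /g (val_split (T q) m K1) (val_split (T r) m K1) (psum_eq _ em).
    have -> : forall a b c' : R, a + b * c' - (a + b * val K.+1%:R (shift m (T r))) =
      b * (c' - val K.+1%:R (shift m (T r))) by move=> *; ring.
    rewrite normrM normfV normrX ger0_norm// ler_piMr ?invr_ge0 ?exprn_ge0//.
    have := val_le (shift m (T q)) K1; have := val_le (shift m (T r)) K1.
    have := val_ge0 (shift m (T q)) K1; have := val_ge0 (shift m (T r)) K1.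
    rewrite vK ler_norml; lra.
  apply: le_trans gm _.
  rewrite /C -powRM ?(ltW ic)//.
  apply: le_trans (_ : (M.+1%:R ^- (m * L)) `^ s <= _); last first.
    apply: ge0_ler_powR; rewrite ?nnegrE ?invr_ge0 ?exprn_ge0//.
      by rewrite mulr_ge0// ltW.
    have -> : M.+1%:R ^- (m * L) =
        c^-1 * M.+1%:R ^+ (n0 + L) * (c * M.+1%:R ^- (n0 + m.+1 * L)) :> R.
      rewrite mulSn addnA [_ ^+ (n0 + L + m * L)]exprD.
      have cn : c != 0 by rewrite gt_eqF.
      have : M.+1%:R ^+ (n0 + L) != 0 :> R by rewrite expf_neq0.
      have : M.+1%:R ^+ (m * L) != 0 :> R by rewrite expf_neq0.
      move: (_ ^+ (m * L)) (_ ^+ (n0 + L)) c cn => a b c' cn an bn.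
      by field; rewrite an bn cn.
    by apply: ler_wpM2l => //; exact: ltW.
  rewrite -exprVn mulnC exprM exprVn -powR_inv1 ?exprn_ge0// powRAC powR_inv1 ?powR_ge0//.
  have -> : (M.+1%:R ^+ L ^+ m) `^ s = ((M.+1%:R ^+ L) `^ s) ^+ m :> R.
    by rewrite -powR_mulrn ?exprn_ge0// powRAC powR_mulrn ?powR_ge0.
  rewrite lef_pV2 ?posrE ?exprn_gt0 ?powR_gt0 ?exprn_gt0//.
  by apply: lerXn2r => //; rewrite nnegrE ?powR_ge0.
move=> y /=; rewrite in_itv /= => /andP[y0 y1].
have [||t ty] := @expansion_exists R K K.+1%:R y K1 (lexx _); rewrite ?vK//.
have [q [qI tx ut]] := base_exists t.
have Eq : E q by exists t.
exists q => //; rewrite /g -ty; congr val.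
have [_ ux uu] := hT q Eq; have q1 : 1 < q by move: qI; lra.
(* Both codes give univoque expansions of [x] in base [q], and [D] is injective, so the chosen code
   is the intended one. *)
have DD : D (T q) = D t.
  have [h|//|h] := dlt_total (D (T q)) (D t).
    by have := lex_val_lt q1 uu h; rewrite tx ux ltxx.
  by have := lex_val_lt q1 ut h; rewrite tx ux ltxx.
apply: contrapT => /first_diff[m [em /eqP nem]].
have [j [_ _ _]] := D_inj em nem.
by rewrite DD eqxx.
Qed.

Lemma hausdorff_dim_univoque_ge : (0 < L)%N ->
  ((ln K.+1%:R / (L%:R * ln M.+1%:R))%:E <= hausdorff_dim (univoque_bases M x))%E.
Proof.
move=> L0; apply: hausdorff_dim_ge => t t0 Ht; rewrite leNgt; apply/negP => lt.
apply: (@hausdorff_measure_gt0 t) => //.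
have lM : 0 < ln (M.+1%:R : R) by rewrite ln_gt0// ltr1n.
have ML : 0 < M.+1%:R ^+ L :> R by rewrite exprn_gt0.
rewrite -ler_ln ?posrE ?powR_gt0//.
rewrite ln_powR -powR_mulrn// ln_powR -ler_pdivlMr; last by rewrite mulr_gt0 ?ltr0n.
exact: ltW.
Qed.

End DimensionLowerBound.

(** * Bases close to [M + 1] *)

Lemma base_digits_inj B L a b : (0 < B)%N -> (a < B ^ L)%N -> (b < B ^ L)%N ->
  (forall j, (j < L)%N -> ((a %/ B ^ j) %% B = (b %/ B ^ j) %% B)%N) -> a = b.
Proof.
move=> B0; elim: L a b => [|L IH] a b; first by rewrite expn0 !ltnS !leqn0 => /eqP -> /eqP ->.
rewrite expnS => ha hb h.
have h0 := h 0%N (ltn0Sn L); rewrite expn0 !divn1 in h0.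
rewrite (divn_eq a B) (divn_eq b B) h0; congr (_ * _ + _)%N.
apply: IH => [||j jL]; rewrite ?ltn_divLR// 1?mulnC//.
by rewrite -!divnMA -!expnS; exact: (h j.+1).
Qed.

Section FullDimension.
Context {R : realType} (M : nat) (M0 : (0 < M)%N).
Implicit Types (p q x y : R) (d s : nat -> 'I_M.+1).

Let B : R := M.+1%:R.
Let B2 : 2 <= B. Proof. by rewrite ler_nat. Qed.
Let B1 : 1 < B. Proof. by have := B2; lra. Qed.
Let vB : vmax (M := M) B = 1.
Proof. by rewrite /vmax /B -natr1 addrK divff// pnatr_eq0 -lt0n. Qed.

Section Blocks.
Variable L : nat.
Let K := (M.+1 ^ L).-1.
Let KE : K.+1 = (M.+1 ^ L)%N. Proof. by rewrite prednK// expn_gt0. Qed.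

(* A free concatenation of the blocks [0 M u], with [u] an arbitrary word of length [L]
   encoded by its value in base [M + 1]. *)
Definition block_seq (t : nat -> 'I_K.+1) (i : nat) : nat :=
  let r := (i %% L.+2)%N in
  if r == 0%N then 0%N else if r == 1%N then M
  else ((t (i %/ L.+2)%N %/ M.+1 ^ (r - 2)) %% M.+1)%N.

Lemma block_seqE t b r : (r < L.+2)%N -> block_seq t (b * L.+2 + r) =
  if r == 0%N then 0%N else if r == 1%N then M
  else ((t b %/ M.+1 ^ (r - 2)) %% M.+1)%N.
Proof.
move=> rL.
by rewrite /block_seq modnMDl divnMDl// (modn_small rL) (divn_small rL) addn0.
Qed.

Lemma block_seq_bounded t : bounded_by M (block_seq t).
Proof.
by move=> i; rewrite /block_seq; do 2?case: eqP => // _; rewrite -ltnS ltn_mod.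
Qed.

Lemma block_seq0 t i : exists2 j, (j < L.+2)%N & block_seq t (i + j) = 0%N.
Proof.
have r := ltn_pmod i (ltn0Sn L.+1); have iE := divn_eq i L.+2.
have [e|ne] := eqVneq (i %% L.+2)%N 0%N.
  by exists 0%N => //; rewrite addn0 /block_seq e.
exists (L.+2 - i %% L.+2)%N; first lia.
have -> : (i + (L.+2 - i %% L.+2) = (i %/ L.+2).+1 * L.+2 + 0)%N by rewrite mulSn; lia.
by rewrite block_seqE.
Qed.

Lemma block_seqM t i : exists2 j, (j < L.+2)%N & block_seq t (i + j) = M.
Proof.
have r := ltn_pmod i (ltn0Sn L.+1); have iE := divn_eq i L.+2.
have [e|ne] := leqP (i %% L.+2)%N 1%N.
  exists (1 - i %% L.+2)%N; first lia.
  have -> : (i + (1 - i %% L.+2) = (i %/ L.+2) * L.+2 + 1)%N by lia.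
  by rewrite block_seqE.
exists (L.+3 - i %% L.+2)%N; first lia.
have -> : (i + (L.+3 - i %% L.+2) = (i %/ L.+2).+1 * L.+2 + 1)%N by rewrite mulSn; lia.
by rewrite block_seqE.
Qed.

Lemma block_seq_diff t u m : (forall i, (i < m)%N -> t i = u i) -> t m <> u m ->
  (forall i, (i < m * L.+2)%N -> block_seq t i = block_seq u i) /\
  exists2 i, (i < m.+1 * L.+2)%N & block_seq t i <> block_seq u i.
Proof.
move=> e ne; split=> [i im|].
  by rewrite /block_seq e// ltn_divLR.
apply: contrapT => h; apply: ne; apply: val_inj => /=.
apply: (@base_digits_inj M.+1 L) => //; rewrite -?KE// => j jL.
apply: contrapT => nj; apply: h; exists (m * L.+2 + j.+2)%N; first by rewrite mulSn; lia.
by rewrite !block_seqE//= subSS subSS subn0.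
Qed.

(** Windows of length [L.+2] contain both 0 and [M], so they and their reflections lie strictly
    below a run of [M]. The 0 after that run makes the bound worth less than 1 in base [M + 1],
    where digits [M] alone give exactly 1. *)
Let bound_seq := fun i => if i == L.+2 then 0%N else M.

Lemma block_seq_strong : exists p, [/\ 3/2 <= p, p < B &
  forall t, strong p (to_digits M (block_seq t))].
Proof.
have sb : bounded_by M bound_seq by move=> i; rewrite /bound_seq; case: ifP.
pose s := to_digits M bound_seq.
have sE i : (s i : nat) = bound_seq i by rewrite /s /to_digits inordK ?ltnS.
have v1 : val B s < 1.
  by apply: (@val_M1_lt1 _ _ M0 _ L.+2); rewrite sE /bound_seq eqxx.
have h32 : 1 < 3/2 :> R by lra.
have l0 := lip_ge0 (M := M) h32.
pose e := Num.min (1/2) ((1 - val B s) / (lip (M := M) (3/2) + 1)).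
have e0 : 0 < e.
  by rewrite lt_min; apply/andP; split; [lra|apply: divr_gt0; lra].
have e1 : e <= 1/2 by rewrite ge_min lexx.
have e2 : lip (M := M) (3/2) * e <= 1 - val B s.
  apply: le_trans (_ : (lip (M := M) (3/2) + 1) * e <= _); first by nra.
  by rewrite mulrC -ler_pdivlMr; [rewrite ge_min lexx orbT|lra].
have b2 := B2.
exists (B - e); split; [lra|lra|] => t.
have p1 : 1 < B - e by lra.
have lt u : bounded_by M u -> (forall i, exists2 j, (j < L.+2)%N & u (i + j) = 0%N) ->
    forall i, dlt (shift i (to_digits M u)) s.
  move=> ub hu i; apply/(dlt_to_digits (shift_bounded i ub) sb).
  have /ex_minnP[m mu mmin] : exists j, u (i + j) != M.
    by have [j _ uj] := hu i; exists j; rewrite uj; lia.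
  have mL : (m < L.+2)%N.
    have [j jL uj] := hu i; apply: leq_ltn_trans jL; apply: mmin; rewrite uj; lia.
  apply/lexltP; exists m; rewrite /bound_seq /shift; split=> [j jm|].
    have -> : (j == L.+2) = false by lia.
    by apply/eqP; apply: contraTT jm => /mmin; rewrite -leqNgt.
  have -> : (m == L.+2) = false by lia.
  by rewrite ltn_neqAle mu ub.
have tb := block_seq_bounded t.
apply: (@lex_strong _ _ _ s) => //.
- have := @val_lip _ M (3/2) (B - e) B s h32; rewrite (_ : B - (B - e) = e); last by ring.
  move=> hl; have : val (B - e) s - val B s <= lip (M := M) (3/2) * e by apply: hl; lra.
  lra.
- move=> n; exists (n + L.+3)%N; first exact: leq_addr.
  by rewrite sE /bound_seq ifF//; lia.
- by apply: lt => // i; exact: block_seq0.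
- move=> i; rewrite refl_to_digits//; apply: lt; first exact: bar_bounded.
  by move=> l; have [j jL h] := block_seqM t l; exists j => //; rewrite /bar h subnn.
Qed.

End Blocks.

Section Prefix.
Variables (L : nat) (x p0 : R) (e : nat -> 'I_M.+1).
Let K := (M.+1 ^ L).-1.
Hypotheses (p0_ge : 3/2 <= p0) (p0B : p0 < B).
Hypothesis block_strong : forall t : nat -> 'I_K.+1, strong p0 (to_digits M (block_seq t)).
Hypotheses (x0 : 0 < x) (ex : val B e = x).
Hypothesis e_rem : forall n, 0 < val B (shift n e) <= 1.

Let conc (t : nat -> 'I_K.+1) := to_digits M (block_seq t).
Let D n t := cat_seq (mkseq e n) (conc t).
Let p := (p0 + B) / 2.

Let D_lt n t i : (i < n)%N -> D n t i = e i.
Proof. by move=> i_n; rewrite /D (cat_seq_lt ord0) ?size_mkseq// nth_mkseq. Qed.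

Let D_ge n t j : shift (n + j) (D n t) = shift j (conc t).
Proof.
by rewrite -shift_shift; congr shift; rewrite -[X in shift X _](size_mkseq e) shift_cat_seq.
Qed.

Let D_geE n t j : D n t (n + j) = conc t j.
Proof. by have := congr1 (@^~ 0%N) (D_ge n t j); rewrite /shift !addn0. Qed.

Let conc0 t : conc t 0 = 0%N :> nat.
Proof.
by rewrite /conc /to_digits inordK ?ltnS ?block_seq_bounded.
Qed.

Let conc1 t : conc t 1 = M :> nat.
Proof.
by rewrite /conc /to_digits inordK ?ltnS ?block_seq_bounded.
Qed.

Let e_inf N : exists2 n, (N <= n)%N & (0 < e n)%N.
Proof.
have /andP[h _] := e_rem N; have [n hn] := val_gt0_ex B1 h.
by exists (N + n)%N => //; exact: leq_addr.
Qed.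

Let p1 : 1 < p. Proof. by have := p0_ge; have := p0B; have := B2; rewrite /p; lra. Qed.
Let pB : p < B. Proof. by have := p0B; rewrite /p; lra. Qed.

Let psumD q n t m : (m <= n)%N -> psum q (D n t) m = psum q e m.
Proof. by move=> mn; apply: psum_eq => i im; rewrite D_lt// (leq_trans im). Qed.

(** The leading 0 of the first block replaces a nonzero digit of [e], so in base [B] the value is
    below [x]; in base [p] the prefix alone reaches [x]. *)
Let solve n t : (0 < e n)%N -> x <= psum p e n ->
  exists q, [/\ p <= q, q < B & val q (D n t) = x].
Proof.
move=> en xp; have b1 := B1.
have lt : val B (D n t) < x.
  rewrite -ex (val_split _ n b1) (val_split e n b1) psumD// ltrD2l ltr_pM2l; last first.
    by rewrite invr_gt0 exprn_gt0//; lra.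
  have := D_ge n t 0; rewrite addn0 shift0 => ->.
  rewrite (val_rec (conc t))// (val_rec (shift n e))// conc0 add0r ltr_pM2r; last first.
    by rewrite invr_gt0; lra.
  have := val_le (shift 1 (conc t)) b1; rewrite vB => h.
  rewrite shift_shift (_ : shift n e 0%N = e n); last by rewrite /shift addn0.
  have /andP[h2 _] := e_rem (n + 1).
  have h3 : 1 <= (e n)%:R :> R by rewrite ler1n.
  lra.
have [||q /andP[pq qB] qx] := @val_ivt _ _ p B (D n t) x p1 (ltW pB).
- exact: ltW.
- by apply: le_trans xp _; rewrite -(psumD p t (leqnn n)) psum_le_val// p1.
exists q; split=> //; rewrite lt_neqAle qB andbT; apply/eqP => qe.
by move: lt; rewrite -qx qe ltxx.
Qed.

(** Passing from [q] to [B] lowers the prefix sum by at least [(B - q) / B ^+ i0.+2], yet in base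
    [B] this sum misses [x] by at most [B ^- n]. *)
Let B_sub n t q i0 : p <= q -> q < B -> val q (D n t) = x -> (i0 < n)%N -> (0 < e i0)%N ->
  B - q <= B ^+ i0.+2 / B ^+ n.
Proof.
move=> pq qB qx i0n ei0; have hp := p1; have q1 : 1 < q by lra.
have h1 := psum_drop q1 (ltW qB) i0n ei0.
have h2 : psum q e n <= x by rewrite -qx -(psumD q t (leqnn n)) psum_le_val.
have h3 : x - B ^- n <= psum B e n.
  rewrite -{1}ex (val_split e n B1) lerBlDr lerD2l ler_piMr ?invr_ge0 ?exprn_ge0//.
  by have /andP[] := e_rem n.
have B0 : 0 < B by have := B1; lra.
have : (B - q) / B ^+ i0.+2 <= B ^- n by lra.
by rewrite ler_pdivrMr ?exprn_gt0// mulrC.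
Qed.

(** A tail starting in the prefix is worth less than the corresponding remainder of [e], because
    [q < B]. For its reflection, [vmax q - 1] is of order [B ^- n] by [B_sub], so a nonzero digit
    not too far ahead suffices. *)
Let univD n t q i0 m0 : p <= q -> q < B -> val q (D n t) = x ->
  (i0 < n)%N -> (0 < e i0)%N -> (i0 + 4 < m0)%N -> (0 < e m0)%N -> (m0 + i0 + 4 <= n)%N ->
  univ q (D n t).
Proof.
move=> pq qB qx i0n ei0 im0 em0 mn i.
have hp := p1; have q1 : 1 < q by lra.
have q0 : 0 < q by lra.
have b2 := B2; have B0 : 0 < B by lra.
have p0q : p0 <= q by move: pq; have := p0B; rewrite /p; lra.
have [ni|i_n] := leqP n i.
  rewrite -(subnKC ni) -addnS D_ge D_geE; apply: strong_univ.
  by apply: (strong_mono _ p0q (block_strong t)); have := p0_ge; lra.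
set v := val q (shift i.+1 (D n t)).
have q32 : 3/2 <= q by have := p0_ge; lra.
split=> [_|Di].
  have /andP[r0 r1] := e_rem i.+1; set w := val B _ in r0 r1.
  have qi : 0 < q ^+ i.+1 by rewrite exprn_gt0.
  have Bi : 0 < B ^+ i.+1 by rewrite exprn_gt0.
  have h1 : q ^- i.+1 * v = x - psum q e i.+1.
    have := val_split (D n t) i.+1 q1; rewrite qx psumD// -/v => ->.
    by rewrite addrC addKr.
  have h2 : B ^- i.+1 * w = x - psum B e i.+1.
    by have := val_split e i.+1 B1; rewrite ex -/w => ->; rewrite addrC addKr.
  have mono : psum B e i.+1 <= psum q e i.+1.
    apply: ler_sum => j _; apply: ler_wpM2l => //.
    by rewrite lef_pV2 ?posrE ?exprn_gt0//; apply: lerXn2r; rewrite ?nnegrE; lra.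
  have h3 : q ^- i.+1 * v <= B ^- i.+1 * w by rewrite h1 h2; lra.
  have qBi : q ^+ i.+1 < B ^+ i.+1 by rewrite ltr_pXn2r// nnegrE; lra.
  have : v <= w * (q ^+ i.+1 / B ^+ i.+1).
    by move: h3; rewrite mulrC ler_pdivrMr// mulrAC -mulrA mulrC; rewrite mulrCA mulrA.
  have f1 : q ^+ i.+1 / B ^+ i.+1 < 1 by rewrite ltr_pdivrMr// mul1r.
  have f0 : 0 < q ^+ i.+1 / B ^+ i.+1 by rewrite divr_gt0.
  by move/le_lt_trans; apply; apply: lt_le_trans r1; rewrite gtr_pMr.
rewrite val_refl// -/v.
have gap : vmax (M := M) q - 1 <= B ^+ (i0 + 3) / B ^+ n.
  have -> : vmax (M := M) q - 1 = (B - q) / (q - 1).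
    by rewrite /vmax /B -natr1; field; lra.
  have := B_sub pq qB qx i0n ei0 => hb.
  rewrite ler_pdivrMr; last lra.
  apply: le_trans hb _.
  have -> : B ^+ (i0 + 3) / B ^+ n = B * (B ^+ i0.+2 / B ^+ n) by rewrite addn3 exprS mulrA.
  set z := B ^+ i0.+2 / _; have z0 : 0 < z by rewrite divr_gt0// exprn_gt0.
  have h : 1 <= B * (q - 1) by have : 1/2 <= q - 1 by [lra]; nra.
  by rewrite mulrAC ler_peMl// ltW.
(* For small [i] this digit is the one prepared at [m0]; otherwise it is the [M] in second place of
   the first block, at [n.+1]. *)
suff [m [im Dm mi]] : exists m, [/\ (i < m)%N, (0 < D n t m)%N & (m + i0 + 3 < n + i)%N].
  have : (D n t m)%:R * q ^- (m - i.+1).+1 <= v.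
    have := digit_le_val (shift i.+1 (D n t)) (m - i.+1) q1.
    by rewrite /shift subnKC.
  have D1 : 1 <= (D n t m)%:R :> R by rewrite ler1n.
  have low : B ^- (m - i) <= q ^- (m - i.+1).+1.
    have -> : (m - i.+1).+1 = (m - i)%N by clear -im; lia.
    by rewrite lef_pV2 ?posrE ?exprn_gt0//; apply: lerXn2r; rewrite ?nnegrE; lra.
  have str : B ^+ (i0 + 3) / B ^+ n < B ^- (m - i).
    rewrite ltr_pdivrMr ?exprn_gt0// mulrC ltr_pdivlMr ?exprn_gt0// -exprD.
    by rewrite ltr_eXn2l ?B1//; clear -im mi; lia.
  have q0' : 0 <= q ^- (m - i.+1).+1 by rewrite invr_ge0 exprn_ge0// ltW.
  have : q ^- (m - i.+1).+1 <= (D n t m)%:R * q ^- (m - i.+1).+1 by rewrite ler_peMl.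
  lra.
have [le|lt] := leqP i (i0 + 4)%N.
  exists m0; split; [by clear -im0 le; lia| |by clear -mn le; lia].
  by rewrite D_lt//; clear -mn; lia.
exists n.+1; split; [exact: ltnW| |by clear -lt; lia].
by have := D_geE n t 1; rewrite addn1 => ->; rewrite conc1.
Qed.

Lemma hausdorff_dim_blocks : (0 < L)%N ->
  ((L%:R / L.+2%:R)%:E <= hausdorff_dim (univoque_bases M x))%E.
Proof.
move=> L0; have hp := p1; have hpB := pB; have b1 := B1.
have KE : K.+1 = (M.+1 ^ L)%N by rewrite prednK// expn_gt0.
have vp : x < val p e.
  rewrite -ex; apply: val_mono_lt => //.
  by apply: lt_le_trans (val_mono_le _ hp (ltW hpB)); rewrite ex.
have [N hN] : exists N, forall n, (N <= n)%N -> x <= psum p e n.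
  have g0 : 0 < val p e - x by rewrite subr_gt0.
  have [N hN] := expr_inv_small (vmax (M := M) p) hp g0; exists N => n /hN h.
  have := val_split e n hp.
  have : p ^- n * val p (shift n e) <= p ^- n * vmax (M := M) p.
    by apply: ler_wpM2l (val_le _ hp); rewrite invr_ge0 exprn_ge0//; lra.
  lra.
have [i0 _ ei0] := e_inf 0.
have [m0 im0 em0] := e_inf (i0 + 5).
have [n nN en] := e_inf (N + m0 + i0 + 4).
have [nN' i0n mn] : [/\ (N <= n)%N, (i0 < n)%N & (m0 + i0 + 4 <= n)%N].
  by clear -nN im0; split; lia.
have im0' : (i0 + 4 < m0)%N by clear -im0; lia.
have le : ((ln K.+1%:R / (L.+2%:R * ln M.+1%:R) : R)%:E <=
    hausdorff_dim (univoque_bases M x))%E.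
  apply: (@hausdorff_dim_univoque_ge R M K n L.+2 x p0 p (D n)) => //.
  - have : (1 < K.+1)%N by rewrite KE -{1}(expn0 M.+1) ltn_exp2l.
    by lia.
  - by have := p0_ge; lra.
  - by have := p0B; rewrite /p; lra.
  - move=> t; have [q [pq qB qx]] := solve t en (hN n nN').
    exists q; split=> //; first by rewrite pq ltW.
    exact: (@univD n t q i0 m0).
  - by move=> t j nj; rewrite -(subnKC nj) D_ge; have [] := block_strong t (j - n)%N.
  - move=> t u m tu tum; have [h1 [i im hi]] := block_seq_diff tu tum; split.
      move=> l ln; have [lt|ge] := ltnP l n; first by rewrite !D_lt.
      by rewrite -(subnKC ge) !D_geE /conc /to_digits h1//; lia.
    exists (n + i)%N; first by rewrite ltn_add2l.
    rewrite !D_geE /conc /to_digits => /(congr1 (fun z : 'I_M.+1 => z : nat)).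
    by rewrite !inordK ?ltnS ?block_seq_bounded.
suff -> : L%:R / L.+2%:R = ln K.+1%:R / (L.+2%:R * ln M.+1%:R) :> R by [].
have lM : 0 < ln (M.+1%:R : R) by apply: ln_gt0; exact: B1.
rewrite KE natrX -powR_mulrn// ln_powR; field.
by rewrite gt_eqF//= pnatr_eq0.
Qed.

End Prefix.

Lemma hausdorff_dim_ge1 x : 0 < x <= 1 -> (1 <= hausdorff_dim (univoque_bases M x))%E.
Proof.
move=> x01; apply/lee_addgt0Pr => eps eps0.
have [e ex e_rem] := @quasi_greedy_exists R M x M0 x01.
pose L := (Num.truncn (2 / eps)).+1.
have [p0 [h1 h2 h3]] := block_seq_strong L.
have /andP[x0 _] := x01.
have := @hausdorff_dim_blocks L x p0 e h1 h2 h3 x0 ex e_rem (ltn0Sn _).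
move=> /(leeD2r eps%:E); apply: le_trans.
rewrite -EFinD lee_fin.
have hL : 2 / eps < L%:R by exact: truncnS_gt.
have L2 : L.+2%:R = L%:R + 2 :> R by rewrite -addn2 natrD.
rewrite L2 -lerBlDr ler_pdivlMr; last by have : 0 <= L%:R :> R; [|lra].
move: hL; rewrite ltr_pdivrMr// => hL.
have : 0 <= L%:R :> R by [].
lra.
Qed.

End FullDimension.

(** * The sets of univoque bases *)

Section UnivoqueBases.
Context {R : realType} (M : nat) (M0 : (0 < M)%N).
Implicit Types (p q x y : R) (d s : nat -> 'I_M.+1).

(** The base in which [x] is the largest possible value, attained by the constant sequence [M]. *)
Let top x : R := 1 + M%:R / x.

Let MR : 0 < M%:R :> R. Proof. by rewrite ltr0n. Qed.

Let top_gt1 x : 0 < x -> 1 < top x.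
Proof. by move=> x0; rewrite ltrDl divr_gt0. Qed.

Let vmax_top x : 0 < x -> vmax (M := M) (top x) = x.
Proof.
move=> x0; rewrite /vmax /top addrAC subrr add0r invf_div mulrCA divff ?mulr1//.
by rewrite gt_eqF.
Qed.

Let le_top x q : 0 < x -> 1 < q -> (x <= vmax (M := M) q) = (q <= top x).
Proof.
move=> x0 q1; rewrite /vmax /top ler_pdivlMr ?subr_gt0// -lerBlDl ler_pdivlMr//.
by rewrite mulrC.
Qed.

Let lt_top x q : 0 < x -> 1 < q -> (vmax (M := M) q < x) = (top x < q).
Proof. by move=> x0 q1; rewrite !ltNge le_top. Qed.

Lemma univoque_le_top x q : 0 < x -> univoque_bases M x q -> q <= top x.
Proof.
move=> x0 Uq; have [/andP[q1 qM] _] := Uq.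
by have [d dx _] := (univoqueP x q1 qM).1 Uq; rewrite -le_top// -dx val_le.
Qed.

Lemma univoque_lt_q_G x q : 0 < x -> univoque_bases M x q -> q < q_G M -> q = top x.
Proof.
move=> x0 Uq qg; have [/andP[q1 qM] _] := Uq.
have [d dx ud] := (univoqueP x q1 qM).1 Uq.
have e : vmax (M := M) q = x.
  by rewrite -dx (univ_golden_max M0 q1 qM qg ud)// dx.
by rewrite /top -e /vmax invf_div mulrCA divff ?gt_eqF// mulr1 subrKC.
Qed.

Lemma q_G_le : q_G M <= M.+1%:R :> R.
Proof.
have M1 : 1 < M.+1%:R :> R by rewrite ltr1n.
rewrite leNgt; apply/negP => h.
have [_ [_ /(_ _ M1)[/(_ h)]]] := q_G_bounds (R := R) M0.
have : val M.+1%:R (golden_seq M) < 1 :> R.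
  apply: (@val_M1_lt1 _ _ M0 _ 1); rewrite /golden_seq /to_digits /alternate /=.
  by have := odd_double_half M => hM; rewrite inordK; lia.
lra.
Qed.

Lemma le_x_G x : x_G M <= x -> 0 < x /\ top x <= q_G M.
Proof.
have [g1 _] := q_G_bounds (R := R) M0 => h.
have x0 : 0 < x by apply: lt_le_trans h; rewrite /x_G divr_gt0// subr_gt0.
split=> //; move: h; rewrite /x_G /top ler_pdivrMr ?subr_gt0// => h.
by rewrite -lerBrDl ler_pdivrMr// mulrC.
Qed.

Lemma univoque_ge_x_G x : x_G M <= x -> univoque_bases M x = [set q_base M x].
Proof.
move=> /le_x_G[x0 tg]; have t1 := top_gt1 x0.
have tM : top x <= M.+1%:R by apply: le_trans tg q_G_le.
have -> : q_base M x = top x by rewrite /q_base min_r// -/(top x) nat1r.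
apply/seteqP; split=> q /=.
  move=> Uq; have := univoque_le_top x0 Uq; rewrite le_eqVlt => /orP[/eqP//|lt].
  by apply: univoque_lt_q_G => //; apply: lt_le_trans tg.
move=> ->; apply/(univoqueP x t1 tM); exists (fun=> ord_max).
  by rewrite val_cst//; exact: vmax_top.
move=> n; rewrite ltnn; split=> // _.
by rewrite val_refl// [shift _ _](_ : _ = (fun=> ord_max))// val_cst// subrr.
Qed.

(** A long run of [M] is already worth at least [x] in base [p], and in base [top x] nothing exceeds
    [x]; so the base can be solved for whatever the continuation. *)
Lemma solve_nseq_max x p : 0 < x -> 1 < p -> p < top x -> exists N, forall n d, (N <= n)%N ->
  exists q, [/\ p <= q, q <= top x & val q (cat_seq (nseq n ord_max) d) = x].
Proof.
move=> x0 p1 pt; have t1 := top_gt1 x0.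
have g0 : 0 < vmax (M := M) p - x.
  rewrite subr_gt0 ltNge le_eqVlt negb_or lt_top// -leNgt ltW// andbT; apply/eqP => e.
  by move: pt; rewrite /top -e /vmax invf_div mulrCA divff ?gt_eqF// mulr1 subrKC ltxx.
have [N hN] := expr_inv_small (vmax (M := M) p) p1 g0.
exists N => n d /hN h.
have [||q /andP[pq qt] qx] := @val_ivt _ _ p (top x) (cat_seq (nseq n ord_max) d) x p1 (ltW pt).
- by apply: le_trans (val_le _ t1) _; rewrite vmax_top.
- apply: le_trans (psum_le_val _ n p1).
  have -> : psum p (cat_seq (nseq n ord_max) d) n = psum p (fun=> ord_max : 'I_M.+1) n.
    by apply: psum_eq => i i_n; rewrite (cat_seq_lt ord0) ?size_nseq// nth_nseq i_n.
  have := val_split (fun=> ord_max : 'I_M.+1) n p1.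
  rewrite [shift _ _](_ : _ = (fun=> ord_max))// val_cst// -/(vmax p).
  by move: h; rewrite mulrC; lra.
by exists q.
Qed.

(** For [x > 1] the bases stay away from [M + 1], where the local estimate degenerates, and below
    [q_G] only [top x] can occur; so compactness applies. *)
Lemma univoque_small x : 1 < x -> small (univoque_bases M x).
Proof.
move=> x1; have x0 : 0 < x by lra.
have [g1 _] := q_G_bounds (R := R) M0.
have tM : top x < M.+1%:R.
  by rewrite /top -nat1r ltrD2l ltr_pdivrMr// ltr_pMr.
have sm : small (univoque_bases M x `&` `[q_G M, top x]%classic).
  apply: small_compact => q /andP[gq qt].
  by apply: univoque_locally_small => //; lra.
apply: small_sub (smallU (small1 (top x)) sm) => q Uq.
have [lt|ge] := ltP q (q_G M); first by left; exact: univoque_lt_q_G.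
by right; split => //=; rewrite in_itv /= ge univoque_le_top.
Qed.

(** The exponents may tend to 1 near [M + 1], but exponent 1 itself works on each of countably many
    compact pieces. *)
Lemma univoque_negligible x : 0 < x -> (@lebesgue_measure R).-negligible (univoque_bases M x).
Proof.
move=> x0.
have cov : univoque_bases M x `<=` [set M.+1%:R] `|`
    \bigcup_n (univoque_bases M x `&` `[1 + n.+1%:R^-1, M.+1%:R - n.+1%:R^-1]%classic).
  move=> q Uq; have [/andP[q1 qM] _] := Uq.
  have [e|ne] := eqVneq q M.+1%:R; first by left.
  right; have qM' : q < M.+1%:R by rewrite lt_neqAle ne.
  pose e := Num.min (q - 1) (M.+1%:R - q).
  have e0 : 0 < e by rewrite lt_min !subr_gt0 q1.
  have h : (Num.truncn e^-1).+1%:R^-1 <= e.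
    by rewrite -[leRHS]invrK lef_pV2 ?posrE ?invr_gt0//; exact/ltW/truncnS_gt.
  have h1 : e <= q - 1 by rewrite ge_min lexx.
  have h2 : e <= M.+1%:R - q by rewrite ge_min lexx orbT.
  exists (Num.truncn e^-1) => //; split => //=; rewrite in_itv /=.
  have {}h1 := le_trans h h1; have {}h2 := le_trans h h2.
  by rewrite -lerBrDl h1 lerBrDr -lerBrDl h2.
apply: (@negligibleS _ _ _ (@lebesgue_measure R) _ _ cov).
apply: (@negligibleU _ _ _ (@lebesgue_measure R)).
  by apply: fin_null_negligible; exact: fin_null1.
apply: (@negligible_bigcup _ _ _ (@lebesgue_measure R)) => n; apply: fin_null_negligible.
have : 0 < n.+1%:R^-1 :> R by rewrite invr_gt0.
move: (n.+1%:R^-1) => z z0.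
have [s0 [_ s1 hs]] : small (univoque_bases M x `&` `[1 + z, M.+1%:R - z]%classic).
  apply: small_compact => q /andP[zq qz].
  by apply: univoque_locally_small => //; lra.
exact: hs (ltW s1).
Qed.

Definition ev_periodic (c : seq 'I_M.+1 * seq 'I_M.+1) : nat -> 'I_M.+1 :=
  cat_seq c.1 (fun i => nth ord0 c.2 (i %% size c.2)%N).

Lemma ev_periodicP d i P : (0 < P)%N -> shift (i + P) d = shift i d ->
  exists c, d = ev_periodic c.
Proof.
move=> P0 e; exists (mkseq d i, mkseq (shift i d) P).
apply/funext => j; rewrite /ev_periodic /=.
have [ji|ij] := ltnP j i.
  by rewrite (cat_seq_lt ord0) ?size_mkseq// nth_mkseq.
rewrite -(subnKC ij); set k := (j - i)%N.
have := @cat_seq_ge _ (mkseq d i) (fun l => nth ord0 (mkseq (shift i d) P) (l %% P)%N) k.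
rewrite !size_mkseq => ->; rewrite nth_mkseq ?ltn_mod//.
have per l : d (i + P + l)%N = d (i + l)%N by have := congr1 (@^~ l) e.
rewrite /shift [in LHS](divn_eq k P); elim: (k %/ P)%N => [|c IH]; first by rewrite mul0n add0n.
by rewrite mulSn -addnA addnA per.
Qed.

Lemma univoque_countable x : 0 < x -> top x <= q_KL M -> countable (univoque_bases M x).
Proof.
move=> x0 tk; have [/andP[k1 kM] kv] := q_KLP (R := R) M0.
have code q : exists c, univoque_bases M x q -> 1 < q /\ val q (ev_periodic c) = x.
  have [Uq|nU] := pselect (univoque_bases M x q); last by exists ([::], [::]).
  have [/andP[q1 qM] _] := Uq; have [d dx ud] := (univoqueP x q1 qM).1 Uq.
  have cst (a : 'I_M.+1) : exists c, (fun=> a) = ev_periodic c :> (nat -> 'I_M.+1).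
    exact: (@ev_periodicP (fun=> a) 0 1).
  (* The base [top x] may equal [q_KL], but there the constant expansion [M] is available. *)
  have := univoque_le_top x0 Uq; rewrite le_eqVlt => /orP[/eqP qt|qt].
    have [c ce] := cst ord_max; exists c => _; split=> //.
    by rewrite -ce val_cst// qt; exact: vmax_top.
  have qk : q < q_KL M by lra.
  have v1 : 1 < val q (dtm M).
    by rewrite -kv; apply: val_mono_lt => //; apply: val_gt0_inf => //; exact: dtm_inf.
  suff [c ce] : exists c, d = ev_periodic c by exists c => _; split; rewrite -?ce.
  case: (univ_strong_ex q1 qM ud) => [->|->|[n sn]]; [exact: cst|exact: cst|].
  have [i [P [P0 e]]] := strong_periodic M0 q1 v1 sn.
  apply: (@ev_periodicP d (n + i) P) => //.
  by move: e; rewrite !shift_shift addnA.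
have /choice[f hf] := code.
(* A base is recovered from its sequence, as values decrease strictly in the base. *)
apply/countable_injP; exists (fun q => choice.pickle (f q)) => q r /[!inE] Uq Ur.
move=> /(pcan_inj choice.pickleK) fe.
have [q1 qx] := hf _ Uq; have [r1 rx] := hf _ Ur; rewrite -fe in rx.
have [lt|lt|//] := ltgtP q r.
  by have := @val_mono_lt _ _ r q (ev_periodic (f q)) q1 lt; rewrite qx rx ltxx => /(_ x0).
by have := @val_mono_lt _ _ q r (ev_periodic (f q)) r1 lt; rewrite qx rx ltxx => /(_ x0).
Qed.

Lemma univoque_infinite x : 0 < x -> q_G M < top x -> top x <= M.+1%:R ->
  infinite_set (univoque_bases M x).
Proof.
move=> x0 gt tM; have [g1 [_ gv]] := q_G_bounds (R := R) M0.
pose p := (q_G M + top x) / 2.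
have p1 : 1 < p by rewrite /p; lra.
have gp : q_G M < p by rewrite /p; lra.
have pt : p < top x by rewrite /p; lra.
have sg : strong p (golden_seq M).
  by apply: golden_seq_strong => //; have [_ /(_ gp)] := gv p p1.
have [N hN] := solve_nseq_max x0 p1 pt.
have /choice[f hf] : forall n, exists q, [/\ p <= q, q <= top x &
    val q (cat_seq (nseq (N + n) ord_max) (golden_seq M)) = x].
  by move=> n; apply: hN; exact: leq_addr.
have f1 n : 1 < f n by have [] := hf n; lra.
have fM n : f n <= M.+1%:R by have [] := hf n; lra.
have uf n : univ (f n) (cat_seq (nseq (N + n) ord_max) (golden_seq M)).
  have [pf _ _] := hf n; apply: univ_nseq_max => //.
  exact: strong_mono p1 pf sg.
have fU n : univoque_bases M x (f n).
  apply/(univoqueP x (f1 n) (fM n)).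
  by have [_ _ fx] := hf n; exists (cat_seq (nseq (N + n) ord_max) (golden_seq M)).
have inj : injective f.
  suff lt m n : (m < n)%N -> f m <> f n.
    move=> m n e; have [h|h|//] := ltngtP m n.
      by case: (lt _ _ h).
    by case: (lt _ _ h).
  (* Equal bases force equal sequences. After [N + m] digits [M] the first goes on with [M - k], [k]
     for [k = M./2], the second with at least one more [M]. A second extra [M] contradicts [k < M];
     with only one, [k = M - k] and [M - k = M] would follow. *)
  move=> mn fe; have [_ [d [_ du]]] := fU m.
  have [_ _ mx] := hf m; have [_ _ nx] := hf n; rewrite -fe in nx.
  have e1 := du _ ((is_expansionE _ _ (f1 m)).2 mx).
  have e2 := du _ ((is_expansionE _ _ (f1 m)).2 nx).
  have /(congr1 (@^~ (N + m).+1)) := etrans (esym e1) e2.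
  have half := odd_double_half M.
  have -> : cat_seq (nseq (N + m) ord_max) (golden_seq M) (N + m).+1 = golden_seq M 1.
    by have := cat_nseq_ge (N + m) (ord_max : 'I_M.+1) (golden_seq M) 1; rewrite addn1.
  have [lt|ge] := ltnP (N + m).+1 (N + n).
    rewrite (cat_seq_lt ord0) ?size_nseq// nth_nseq lt => /(congr1 (fun z : 'I_M.+1 => z : nat)).
    by rewrite /golden_seq /to_digits /alternate /= inordK ?ltnS; lia.
  have -> : ((N + m).+1 = (N + n) + 0)%N by lia.
  rewrite cat_nseq_ge.
  have nm : n = m.+1 by lia.
  move=> /(congr1 (fun z : 'I_M.+1 => z : nat)).
  rewrite /golden_seq /to_digits /alternate /= !inordK ?ltnS; [|lia|lia] => k1.
  have /(congr1 (@^~ (N + m))) := etrans (esym e1) e2.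
  have := cat_nseq_ge (N + m) (ord_max : 'I_M.+1) (golden_seq M) 0; rewrite addn0 => ->.
  rewrite (cat_seq_lt ord0) ?size_nseq ?nm ?addnS// nth_nseq ltnSn.
  move=> /(congr1 (fun z : 'I_M.+1 => z : nat)).
  by rewrite /golden_seq /to_digits /alternate /= inordK ?ltnS; lia.
apply/infiniteP.
have im : f @` [set: nat] `<=` univoque_bases M x by move=> _ [n _ <-].
apply: card_le_trans (subset_card_le im).
by rewrite (card_le_eqr (inj_card_eq (in2W inj))).
Qed.

(** Binary codes choose between the two words of [tm_free]. The points [p0] and [p] cut the interval
    from [q_KL] to [top x] into thirds, leaving room for the margin and for the solved bases. *)
Lemma hausdorff_dim_gt0 x : 0 < x -> q_KL M < top x -> top x <= M.+1%:R ->
  (0 < hausdorff_dim (univoque_bases M x))%E.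
Proof.
move=> x0 kt tM; have [/andP[k1 kM] kv] := q_KLP (R := R) M0.
pose p0 := (2 * q_KL M + top x) / 3; pose p := (q_KL M + 2 * top x) / 3.
have kp0 : q_KL M < p0 by rewrite /p0; lra.
have p0p : p0 < p by rewrite /p0 /p; lra.
have pt : p < top x by rewrite /p; lra.
have p01 : 1 < p0 by lra.
have p1 : 1 < p by lra.
have [n n0 hn] := tm_free_strong M0 kp0.
have [N hN] := solve_nseq_max x0 p1 pt.
pose b (t : nat -> 'I_2) i := t i != ord0.
pose w (t : nat -> 'I_2) := to_digits M (tm_free M n (b t)).
pose D t := cat_seq (nseq N ord_max) (w t).
have wE t i : (w t i : nat) = tm_free M n (b t) i.
  by rewrite /w /to_digits inordK// ltnS; exact: tm_free_bounded.
have DN t i : D t (N + i) = w t i.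
  exact: cat_nseq_ge.
have Dsh t j : shift (N + j) (D t) = shift j (w t).
  by apply/funext => i; rewrite /shift -addnA DN.
have L0 : (0 < 2 * 2 ^ n)%N by rewrite muln_gt0 expn_gt0.
have := @hausdorff_dim_univoque_ge R M 1 N (2 * 2 ^ n) x p0 p D isT M0 p01 p0p.
have h1 : forall t, exists q, [/\ p <= q <= M.+1%:R, val q (D t) = x & univ q (D t)].
  move=> t; have [q [pq qt qx]] := hN N (w t) (leqnn N).
  exists q; split=> //; first lra.
  apply: univ_nseq_max; first lra.
  by apply: strong_mono (hn (b t)); lra.
have h2 : forall t j, (N <= j)%N -> val p0 (shift j (D t)) < 1.
  by move=> t j Nj; rewrite -(subnKC Nj) Dsh; have [] := hn (b t) (j - N)%N.
have h3 : forall t u m, (forall i, (i < m)%N -> t i = u i) -> t m <> u m ->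
    (forall i, (i < N + m * (2 * 2 ^ n))%N -> D t i = D u i) /\
    exists2 i, (i < N + m.+1 * (2 * 2 ^ n))%N & D t i <> D u i.
  move=> t u m tu tum.
  have bm : b t m <> b u m.
    move=> e; apply: tum; apply: val_inj; move: e; rewrite /b -!val_eqE /=.
    by case: (t m) => [[|[|]]] //; case: (u m) => [[|[|]]].
  have [a1 [i im a2]] := tm_free_diff M0 n0 (fun i im => congr1 (fun z => z != ord0) (tu i im)) bm.
  split=> [j jN|].
    have [lt|ge] := ltnP j N.
      by rewrite /D !(cat_seq_lt ord0) ?size_nseq.
    rewrite -(subnKC ge) !DN; apply: val_inj; rewrite /= !wE a1//.
    by rewrite -(ltn_add2l N) subnKC.
  exists (N + i)%N; first by rewrite ltn_add2l.
  by rewrite !DN => /(congr1 (fun z : 'I_M.+1 => z : nat)); rewrite !wE.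
move=> /(_ h1 h2 h3 L0); apply: lt_le_trans.
rewrite lte_fin divr_gt0// ?mulr_gt0 ?ltr0n//.
  by rewrite ln_gt0// ltr1n.
by rewrite ln_gt0// ltr1n.
Qed.

(** Boundedness is enough: a grid of [N] intervals of length [M / N] has a sum of [s]-th powers
    tending to 0 for [s > 1]. *)
Lemma univoque_fin_null_gt1 x (s : R) : 1 < s -> fin_null s (univoque_bases M x).
Proof.
move=> s1 eps eps0.
pose T := M%:R `^ s / eps.
have T0 : 0 < T by rewrite divr_gt0 ?powR_gt0.
have [N [N0 NT Ne]] : exists N : nat, [/\ (0 < N)%N, T <= N%:R `^ (s - 1) & M%:R / N%:R <= eps].
  pose a := Num.truncn (T `^ (s - 1)^-1); pose c := Num.truncn (M%:R / eps).
  have ha : T `^ (s - 1)^-1 <= (a + c).+1%:R.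
    apply: le_trans (ltW (truncnS_gt _)) _; rewrite ler_nat ltnS; exact: leq_addr.
  have hc : M%:R / eps <= (a + c).+1%:R.
    apply: le_trans (ltW (truncnS_gt _)) _; rewrite ler_nat ltnS; exact: leq_addl.
  exists (a + c).+1; split=> //.
    have s10 : 0 < s - 1 by rewrite subr_gt0.
    have -> : T = (T `^ (s - 1)^-1) `^ (s - 1).
      by rewrite -powRrM mulVf ?gt_eqF// powRr1// ltW.
    by apply: ge0_ler_powR; rewrite ?nnegrE ?powR_ge0// ltW.
  by rewrite ler_pdivrMr// mulrC -ler_pdivrMr.
have NR : 0 < N%:R :> R by rewrite ltr0n.
pose w : R := M%:R / N%:R.
have w0 : 0 < w by rewrite divr_gt0.
exists [seq (1 + i%:R * w, 1 + i.+1%:R * w) | i <- iota 0 N]; split.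
- move=> q [/andP[q1 qM] _].
  pose i := Num.truncn ((q - 1) / w).
  have u0 : 0 <= (q - 1) / w by rewrite divr_ge0 ?subr_ge0// ltW.
  have h1 : i%:R <= (q - 1) / w by rewrite truncn_le.
  have h2 : (q - 1) / w < i.+1%:R by exact: truncnS_gt.
  rewrite ler_pdivlMr// in h1; rewrite ltr_pdivrMr// in h2.
  have [iN|Ni] := ltnP i N.
    exists (1 + i%:R * w, 1 + i.+1%:R * w) => /=; last by lra.
    by apply/mapP; exists i => //; rewrite mem_iota.
  (* This case is the right endpoint [q = M + 1], which belongs to the last interval. *)
  exists (1 + N.-1%:R * w, 1 + N.-1.+1%:R * w) => /=.
    by apply/mapP; exists N.-1 => //; rewrite mem_iota leq0n ltn_predL.
  have wN : N%:R * w = M%:R by rewrite /w mulrC divfK// gt_eqF.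
  have e : N.-1%:R * w = M%:R - w.
    by rewrite -wN -{2}(prednK N0) -[N.-1.+1%:R]natr1 mulrDl mul1r addrK.
  have : N%:R * w <= i%:R * w by rewrite ler_pM2r// ler_nat.
  rewrite prednK// e wN; move: qM; rewrite -natr1; lra.
- move=> ab /mapP[i _ ->] /=; rewrite -natr1 mulrDl mul1r; rewrite -/w in Ne; lra.
rewrite big_map (eq_bigr (fun=> w `^ s)); last first.
  by move=> i _ /=; congr (_ `^ _); rewrite -natr1; ring.
rewrite big_const_seq count_predT iter_addr_0 size_iota -mulr_natr.
have -> : w `^ s = M%:R `^ s / N%:R `^ s.
  by rewrite /w powRM ?invr_ge0 ?ltW// -powR_inv1 ?ltW// powRAC powR_inv1// powR_ge0.
have Ns : N%:R `^ s = N%:R `^ (s - 1) * N%:R.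
  by rewrite -{3}(powRr1 (ltW NR)) -powRD ?subrK// (gt_eqF NR) implybT.
rewrite Ns -mulrA invfM divfK ?gt_eqF//.
rewrite ler_pdivrMr ?powR_gt0// mulrC -ler_pdivrMr//.
Qed.

Lemma hausdorff_dim_le1 x : (hausdorff_dim (univoque_bases M x) <= 1)%E.
Proof.
apply/lee_addgt0Pr => e e0; rewrite -EFinD.
by apply: fin_null_dim; [lra|apply: univoque_fin_null_gt1; lra].
Qed.

End UnivoqueBases.

Theorem theorem1p5 (R : realType) (M : nat) (hM : (1 <= M)%N) :
  (forall x : R, 0 < x ->
     (@lebesgue_measure R).-negligible (univoque_bases M x)) /\
  (forall x : R, 0 < x <= 1 ->
     hausdorff_dim (univoque_bases M x) = 1%E) /\
  (forall x : R, 1 < x < x_KL M ->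
     (0 < hausdorff_dim (univoque_bases M x) < 1)%E) /\
  (forall x : R, x_KL M <= x < x_G M ->
     (univoque_bases M x #= [set: nat])%card) /\
  (forall x : R, x_G M <= x ->
     univoque_bases M x = [set q_base M x]).
Proof.
have [/andP[k1 kM] _] := q_KLP (R := R) hM.
have M0 : 0 < M%:R :> R by rewrite ltr0n.
have [g1 _] := q_G_bounds (R := R) hM.
have gt1_top x : 1 < x -> 1 + M%:R / x <= M.+1%:R :> R.
  move=> x1; rewrite -nat1r lerD2l ler_pdivrMr; last lra.
  by rewrite ler_peMr// ltW.
split; first by move=> x; exact: univoque_negligible.
split.
  move=> x hx; apply/eqP; rewrite eq_le.
  by rewrite hausdorff_dim_ge1// hausdorff_dim_le1.
split.
  move=> x /andP[x1 xk]; have x0 : 0 < x by lra.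
  apply/andP; split.
    apply: hausdorff_dim_gt0 => //; last exact: gt1_top.
    by move: xk; rewrite /x_KL ltr_pdivlMr ?subr_gt0// -ltrBlDl ltr_pdivlMr// mulrC.
  have [s [s0 s1 hs]] := univoque_small hM x1.
  by apply: le_lt_trans (fin_null_dim (ltW s0) (hs s (lexx s))) _; rewrite lte_fin.
split; last by move=> x; exact: univoque_ge_x_G.
move=> x /andP[kx xg].
have xKL1 : 1 < x_KL M :> R.
  by rewrite /x_KL ltr_pdivlMr ?subr_gt0// mul1r; move: kM; rewrite -natr1; lra.
have x1 : 1 < x by lra.
have x0 : 0 < x by lra.
apply: eq_card_nat.
  apply: univoque_countable => //.
  by move: kx; rewrite /x_KL ler_pdivrMr ?subr_gt0// => kx; rewrite -lerBrDl ler_pdivrMr// mulrC.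
apply: univoque_infinite => //; last exact: gt1_top.
by move: xg; rewrite /x_G ltr_pdivlMr ?subr_gt0// => xg; rewrite -ltrBlDl ltr_pdivlMr// mulrC.
Qed.
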